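(* Consider the urn with replacement matrix $\begin{pmatrix} -2 & 3 \\ 4 & -3\end{pmatrix}$ (the $\mathcal{T}_{2,3}$ model) initialized with two balls of the first type ($a_0=t_0=2$, $b_0=0$). The function $\psi$ of this model is exactly $$\psi(z)=\frac{1}{(\rho\sqrt3)^2}\,\wp\!\left(\frac{z-\rho}{\rho\sqrt3}\right)\qquad\text{with}\quad \rho:=\frac16\,\frac{\Gamma(1/3)\Gamma(1/6)}{\Gamma(1/2)},$$ where $\wp(z):=\wp(z;\Lambda_{\mathrm{hex}})$ is the Weierstrass function of the hexagonal lattice. In particular, the bivariate generating function of the model, $H(z,u)=\delta(u)^2\,\psi(z\delta(u)+I(u))$, is expressible in terms of elliptic functions.
   Context: Urn process: at each time step a ball is drawn uniformly at random, observed and put back; if it is of the first type, 2 balls of the first type are removed and 3 of the second type are added; if it is of the second type, 4 balls of the first type are added and 3 of the second type are removed. The function $\psi$ of the model is the function analytic near $0$ defined implicitly (for $u$ near $0$) by $\psi(I(u))=\dfrac{u^2}{\delta(u)^2}$, where $\delta(u)=(1-u^6)^{1/6}$ (with $\delta(0)=1$) and $I(u)=\int_0^u t\,\delta(t)^{-5}\,dt$; it is identified with its analytic continuation. The bivariate generating function is $H(z,u)=\sum_{n\ge0}h_n(u)z^n/n!$, where the coefficient of $u^k$ in $h_n(u)$ is the number of evolution histories of length $n$ (balls distinguishable, a history being the sequence of $n$ choices of balls) ending with $k$ balls of the first type. $\Lambda_{\mathrm{hex}}:=\{n_1e^{i\pi/6}+n_2e^{-i\pi/6}: n_1,n_2\in\mathbb{Z}\}$,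 and for a lattice $\Lambda$, $\wp(z;\Lambda)=\frac1{z^2}+\sum_{w\in\Lambda\setminus\{0\}}\left(\frac1{(z-w)^2}-\frac1{w^2}\right)$. *)

(* Defs.v *)
(* Stdlib reals with Coquelicot; complex numbers are Coquelicot's [C]. *)
From Stdlib Require Import Reals.
From Coquelicot Require Import Coquelicot.
From Stdlib Require Import ZArith List Lia.
Import ListNotations.

Local Open Scope C_scope.

Definition analytic_at (f : C -> C) (z0 : C) : Prop :=
  exists (a : nat -> C) (r : R), (0 < r)%R /\
    forall z : C, (Cmod (z - z0) < r)%R ->
      is_pseries (K := C_AbsRing) (V := C_NormedModule) a (z - z0) (f z).

Definition connected (U : C -> Prop) : Prop :=
  forall A B : C -> Prop,
    open (T := C_UniformSpace) A -> open (T := C_UniformSpace) B ->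
    (forall z, U z -> A z \/ B z) ->
    (exists z, U z /\ A z) -> (exists z, U z /\ B z) ->
    exists z, U z /\ A z /\ B z.

Definition domain (U : C -> Prop) : Prop :=
  open (T := C_UniformSpace) U /\ connected U.

Definition meromorphic_at (f : C -> C) (z0 : C) : Prop :=
  exists (g : C -> C) (m : nat) (r : R),
    analytic_at g z0 /\ (0 < r)%R /\
    forall z : C, z <> z0 -> (Cmod (z - z0) < r)%R -> f z = g z / (z - z0) ^ m.

(* A meromorphic function is represented by a total function whose values at
   the poles are meaningless, so periodicity is only required where both sides
   are analytic. *)
Definition period (f : C -> C) (w : C) : Prop :=
  forall z : C, analytic_at f z -> analytic_at f (z + w) -> f (z + w) = f z.

Definition elliptic (f : C -> C) : Prop :=
  (forall z : C, meromorphic_at f z) /\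
  exists w1 w2 : C,
    Im (w1 * Cconj w2) <> 0%R /\ period f w1 /\ period f w2.

Definition cis (t : R) : C := (cos t, sin t).

(* Principal argument, in (-PI, PI]; irrelevant at 0. *)
Definition Carg (w : C) : R :=
  if Rle_dec 0 (Im w) then acos (Re w / Cmod w) else (- acos (Re w / Cmod w))%R.

(* Principal branch of [w ^ x], for [w <> 0] and a real exponent [x]. *)
Definition Cpower (w : C) (x : R) : C :=
  RtoC (Rpower (Cmod w) x) * cis (x * Carg w).

Definition sum_list (f : C -> C) (l : list C) : C :=
  fold_right (fun w s => f w + s) (RtoC 0) l.

(* Unordered (unconditional) summation over a subset of [C]: convergence along
   the finite subsets ordered by inclusion. *)
Definition is_sum_over (S : C -> Prop) (f : C -> C) (s : C) : Prop :=
  forall eps : R, (0 < eps)%R ->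
    exists l0 : list C, Forall S l0 /\
      forall l : list C, NoDup l -> Forall S l -> incl l0 l ->
        (Cmod (sum_list f l - s) < eps)%R.

Definition sum_over (S : C -> Prop) (f : C -> C) : C :=
  iota (T := C_CompleteNormedModule) (is_sum_over S f).

Definition wp (L : C -> Prop) (z : C) : C :=
  / z ^ 2 +
  sum_over (fun w => L w /\ w <> RtoC 0) (fun w => / (z - w) ^ 2 - / w ^ 2).

Definition hex_lattice (w : C) : Prop :=
  exists n1 n2 : Z,
    w = RtoC (IZR n1) * cis (PI / 6) + RtoC (IZR n2) * cis (- (PI / 6)).

Definition Gamma (x : R) : R :=
  RInt_gen (fun t : R => (Rpower t (x - 1) * exp (- t))%R)
    (at_right 0) (Rbar_locally p_infty).

Definition rho : R :=
  (1 / 6 * (Gamma (1 / 3) * Gamma (1 / 6) / Gamma (1 / 2)))%R.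

Definition delta (u : C) : C := Cpower (1 - u ^ 6) (1 / 6).

(* Integral of [t * delta t ^ (-5)] along the segment [0, u], parametrised by
   [t = x u] with [x] in [0, 1]. *)
Definition Iu (u : C) : C :=
  RInt (V := C_R_CompleteNormedModule)
    (fun x : R => u * (RtoC x * u / delta (RtoC x * u) ^ 5)) 0 1.

(* [psi], considered on the domain [U], is an analytic continuation of the germ
   at 0 defined implicitly by [psi (Iu u) = u^2 / delta u ^ 2]. *)
Definition is_psi (U : C -> Prop) (psi : C -> C) : Prop :=
  domain U /\ U (RtoC 0) /\
  (forall z, U z -> analytic_at psi z) /\
  locally (T := C_UniformSpace) (RtoC 0)
    (fun u => psi (Iu u) = u ^ 2 / delta u ^ 2).

(* A state lists the numbers of balls of the first and of the second type; a
   replacement matrix is given by its two rows. *)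
Definition state : Type := (Z * Z)%type.
Definition matrix : Type := (state * state)%type.

(* The balls of a state [(a, b)] are labelled 0, ..., a + b - 1, the first [a]
   labels being those of the balls of the first type. *)
Definition balls (s : state) : list Z :=
  map Z.of_nat (seq 0 (Z.to_nat (fst s + snd s))).

Definition draw (M : matrix) (s : state) (i : Z) : state :=
  let row := if (i <? fst s)%Z then fst M else snd M in
  ((fst s + fst row)%Z, (snd s + snd row)%Z).

Fixpoint histories (M : matrix) (n : nat) (s : state) : list (list Z) :=
  match n with
  | O => [[]]
  | S n' => flat_map (fun i => map (cons i) (histories M n' (draw M s i)))
                     (balls s)
  end.

Definition final (M : matrix) (s : state) (h : list Z) : state :=
  fold_left (draw M) h s.

Definition count_histories (M : matrix) (s : state) (n k : nat) : nat :=
  length (filter (fun h => (fst (final M s h) =? Z.of_nat k)%Z)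
                 (histories M n s)).

Definition T23 : matrix := ((-2, 3), (4, -3))%Z.
Definition T23_start : state := (2, 0)%Z.

(* The urn is balanced and tenable: after [n] draws it holds [n + 2] balls and
   neither number of balls is negative. *)
Lemma T23_final (n : nat) (h : list Z) :
  In h (histories T23 n T23_start) ->
  let s := final T23 T23_start h in
  (0 <= fst s /\ 0 <= snd s /\ fst s + snd s = Z.of_nat n + 2)%Z.
Proof.
enough (H : forall n s, (exists a b, 0 <= a /\ 0 <= b /\ s = (2 * a, 3 * b))%Z ->
  forall h, In h (histories T23 n s) ->
  (0 <= fst (final T23 s h) /\ 0 <= snd (final T23 s h) /\
   fst (final T23 s h) + snd (final T23 s h)
     = Z.of_nat n + (fst s + snd s))%Z).
{ intros Hh. apply (H n T23_start); [|exact Hh].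
  exists 1%Z, 0%Z. repeat split; lia. }
clear n h. induction n as [|n IH]; intros s (a & b & Ha & Hb & ->) h Hh.
- destruct Hh as [<-|[]]. unfold final; cbn [fold_left fst snd]. lia.
- cbn [histories] in Hh. apply in_flat_map in Hh. destruct Hh as (i & Hi & Hh).
  apply in_map_iff in Hh. destruct Hh as (h' & <- & Hh').
  unfold balls in Hi. apply in_map_iff in Hi. destruct Hi as (j & <- & Hj).
  apply in_seq in Hj. cbn [fst snd] in Hj.
  apply IH in Hh'.
  + change (final T23 ((2 * a)%Z, (3 * b)%Z) (Z.of_nat j :: h'))
      with (final T23 (draw T23 ((2 * a)%Z, (3 * b)%Z) (Z.of_nat j)) h').
    destruct Hh' as (H1 & H2 & H3). split; [exact H1|split; [exact H2|]].
    rewrite H3. unfold draw, T23. cbn [fst snd].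
    destruct (Z.ltb_spec (Z.of_nat j) (2 * a)); cbn [fst snd]; lia.
  + unfold draw, T23. cbn [fst snd].
    destruct (Z.ltb_spec (Z.of_nat j) (2 * a)); cbn [fst snd].
    * exists (a - 1)%Z, (b + 1)%Z. repeat split; try lia. f_equal; lia.
    * exists (a + 2)%Z, (b - 1)%Z. repeat split; try lia. f_equal; lia.
Qed.

(* [sum_n] includes its last index; by [T23_final] no history of length [n]
   ends with more than [n + 2] balls of the first type. *)
Definition h_poly (n : nat) (u : C) : C :=
  sum_n (G := C_AbelianMonoid)
    (fun k => RtoC (INR (count_histories T23 T23_start n k)) * u ^ k) (n + 2).

(* [H(z, u) = v]. *)
Definition is_H (z u v : C) : Prop :=
  is_series (K := C_AbsRing) (V := C_NormedModule)
    (fun n => h_poly n u * z ^ n / RtoC (INR (fact n))) v.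

(* Main.v *)
Require Import Defs.
From Stdlib Require Import Reals.
From Coquelicot Require Import Coquelicot.
From Stdlib Require Import Lra Lia List ZArith Classical ClassicalEpsilon.

Open Scope C_scope.
Set Bullet Behavior "Strict Subproofs".

(** Write [psi] for the germ at [0] with [psi (I u) = u^2 / delta u^2] and [q = psi' / 2].
    Differentiating the relation, with [delta^6 = 1 - u^6], gives
    [q (I u) = 1 / delta u^3], so that [psi' = 2 q], [q' = 3 psi^2],
    [psi 0 = 0] and [q 0 = 1]; equivalently [psi'^2 = 4 psi^3 + 4].  The theorem says that
    the rescaled and translated hexagonal Weierstrass function solves this system
    ([psi_formula_Cder], [psi_half_derivative_Cder], [psi_formula_0],
    [psi_half_derivative_0]); uniqueness of solutions along the rays from [0]
    ([ode_unique], [germ_along_Iu]) then identifies it with the germ, and the identity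
    theorem with every continuation of the germ ([psi_unique]).

    The equation of [wp].  The lattice sum is expanded in power series about
    every point with an explicit remainder ([wp_sum_has_ps]).  The rotation by [pi / 3]
    kills the Eisenstein sum of order 4, so [wp^2 - wp'' / 6] tends to [0] at
    the lattice.  This function is doubly periodic, so its modulus attains its
    maximum, and the maximum principle for power series makes it vanish
    ([wp_second_derivative]).  Hence [wp'^2 - 4 wp^3] is a constant [k].  The centre
    [1 / sqrt 3] of a lattice triangle is a zero of [wp], again by rotation
    ([wp_centre]); there [wp'] is real, and it is nonzero by uniqueness of solutions, so
    [k > 0] ([wp_k_pos]).

    The scale.  On the real axis [wp] decreases from infinity at [0] to [0] at
    [1 / sqrt 3], solving [wp' = - sqrt (4 wp^3 + k)].  Separating variables expresses
    [1 / sqrt 3] as a beta integral, and Euler's relation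
    [Gamma a * Gamma b = Gamma (a + b) * B (a, b)] ([gamma_beta]) turns it into
    [(rho * sqrt 3)^6 = k / 4] ([rho_eq]), which is the condition [q 0 = 1].

    The generating function.  Give a state with [2 a] and [3 b] balls the weight
    [psi^a q^b].  Its derivative is [2 a psi^(a-1) q^(b+1) + 3 b psi^(a+2) q^(b-1)]: the
    system differentiates exactly as the urn draws ([history_poly_derive]).  So the
    [n]-th derivative of [psi] is the sum of the final weights over all histories of
    length [n].  At the point [I u] such a weight is [u^(2 a) / delta^(n+2)], which makes
    [delta^2 psi (z delta + I u)] the Taylor series of [H (z, u)] in [z] ([urn_series]). *)


(** * Unconditional sums *)

Lemma Rlt_Rmin (x a b : R) : (x < Rmin a b)%R -> (x < a)%R /\ (x < b)%R.
Proof. intros H. pose proof (Rmin_l a b). pose proof (Rmin_r a b). lra. Qed.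

Fixpoint Rsum (g : C -> R) (l : list C) : R :=
  match l with nil => 0%R | w :: l => (g w + Rsum g l)%R end.

Lemma sum_list_cons f w l : sum_list f (w :: l) = f w + sum_list f l.
Proof. reflexivity. Qed.

Definition bounded_sums (S : C -> Prop) (g : C -> R) (M : R) : Prop :=
  forall l, NoDup l -> Forall S l -> (Rsum g l <= M)%R.

Lemma Rsum_app g l l' : Rsum g (l ++ l') = (Rsum g l + Rsum g l')%R.
Proof. induction l as [|a l IH]; cbn; [|rewrite IH]; ring. Qed.

Lemma Rsum_incl g l l' :
  (forall w, In w l' -> (0 <= g w)%R) -> NoDup l -> incl l l' ->
  (Rsum g l <= Rsum g l')%R.
Proof.
revert l'. induction l as [|a l IH]; intros l' Hg Hl Hi.
- cbn. clear Hi Hl. induction l' as [|b l' IH']; cbn; [lra|].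
  assert (0 <= g b)%R by (apply Hg; now left).
  assert (0 <= Rsum g l')%R; [|lra]. apply IH'. intros w Hw; apply Hg; now right.
- inversion_clear Hl as [|? ? Ha Hl'].
  destruct (in_split a l') as (l1 & l2 & ->). { apply Hi; now left. }
  rewrite Rsum_app. cbn.
  assert (H : (Rsum g l <= Rsum g (l1 ++ l2))%R).
  { apply IH; auto.
    - intros w Hw. apply Hg. apply in_app_iff in Hw. apply in_app_iff. cbn; tauto.
    - intros w Hw. assert (Hw' : In w (l1 ++ a :: l2)) by (apply Hi; now right).
      apply in_app_iff in Hw'. apply in_app_iff. cbn in Hw'.
      destruct Hw' as [|[->|]]; tauto. }
  rewrite Rsum_app in H. lra.
Qed.

Lemma Rsum_le g h l : (forall w, In w l -> (g w <= h w)%R) -> (Rsum g l <= Rsum h l)%R.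
Proof.
induction l as [|a l IH]; intros H; cbn; [lra|].
assert (g a <= h a)%R by (apply H; now left).
assert (Rsum g l <= Rsum h l)%R; [|lra]. apply IH; intros w Hw; apply H; now right.
Qed.

Lemma Rsum_scal g c l : Rsum (fun w => (c * g w)%R) l = (c * Rsum g l)%R.
Proof. induction l as [|a l IH]; cbn; [|rewrite IH]; ring. Qed.

Lemma Forall_In {A} (S : A -> Prop) l w : Forall S l -> In w l -> S w.
Proof. intros H; revert w; now apply Forall_forall. Qed.

Lemma bounded_sums_le S g h M c :
  (0 <= c)%R -> (forall w, S w -> (g w <= c * h w)%R) -> bounded_sums S h M ->
  bounded_sums S g (c * M).
Proof.
intros Hc Hgh HM l Hl Hs.
apply Rle_trans with (Rsum (fun w => (c * h w)%R) l).
- apply Rsum_le. intros w Hw. apply Hgh. eapply Forall_In; eauto.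
- rewrite Rsum_scal. apply Rmult_le_compat_l; auto.
Qed.

Lemma sum_list_RtoC g l : sum_list (fun w => RtoC (g w)) l = RtoC (Rsum g l).
Proof. induction l as [|a l IH]; [reflexivity|].
rewrite sum_list_cons, IH, <- RtoC_plus. reflexivity. Qed.

Lemma sum_list_lin f g a b l :
  sum_list (fun w => a * f w + b * g w) l = a * sum_list f l + b * sum_list g l.
Proof. induction l as [|x l IH]; [cbn|rewrite !sum_list_cons, IH]; ring. Qed.

Lemma sum_list_ext f g l : (forall w, In w l -> f w = g w) -> sum_list f l = sum_list g l.
Proof.
induction l as [|x l IH]; intros H; [reflexivity|].
rewrite !sum_list_cons, H by now left. rewrite IH; auto.
intros v Hv; apply H; now right.
Qed.

Lemma sum_list_Cmod f g l :
  (forall w, In w l -> (Cmod (f w) <= g w)%R) -> (Cmod (sum_list f l) <= Rsum g l)%R.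
Proof.
induction l as [|x l IH]; intros H; [cbn; rewrite Cmod_0; lra|].
rewrite sum_list_cons. eapply Rle_trans; [apply Cmod_triangle|].
apply Rplus_le_compat; [apply H; now left|apply IH; intros; apply H; now right].
Qed.

Lemma is_sum_over_witness S f s eps :
  is_sum_over S f s -> (0 < eps)%R ->
  exists l0, NoDup l0 /\ Forall S l0 /\
    forall l, NoDup l -> Forall S l -> incl l0 l -> (Cmod (sum_list f l - s) < eps)%R.
Proof.
intros H He. destruct (H eps He) as (l0 & H0 & H1).
exists (nodup Ceq_dec l0). split; [apply NoDup_nodup|split].
- apply Forall_forall. intros w Hw. apply nodup_In in Hw. eapply Forall_In; eauto.
- intros l Hl Hs Hi. apply H1; auto. intros w Hw. apply Hi. now apply nodup_In.
Qed.

Lemma common_list (S : C -> Prop) l1 l2 :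
  Forall S l1 -> Forall S l2 ->
  exists l, NoDup l /\ Forall S l /\ incl l1 l /\ incl l2 l.
Proof.
intros H1 H2. exists (nodup Ceq_dec (l1 ++ l2)).
split; [apply NoDup_nodup|split; [|split]].
- apply Forall_forall. intros w Hw. apply nodup_In, in_app_iff in Hw.
  destruct Hw as [Hw|Hw]; [exact (Forall_In _ _ _ H1 Hw)|exact (Forall_In _ _ _ H2 Hw)].
- intros w Hw. apply nodup_In, in_app_iff; now left.
- intros w Hw. apply nodup_In, in_app_iff; now right.
Qed.

Lemma Ceq_of_small (x y : C) :
  (forall eps, (0 < eps)%R -> (Cmod (x - y) < eps)%R) -> x = y.
Proof.
intros H. apply Ceq_minus. apply Cmod_eq_0.
destruct (Rle_lt_or_eq_dec 0 (Cmod (x - y)) (Cmod_ge_0 _)) as [Hp|He]; auto.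
specialize (H _ Hp). lra.
Qed.

Lemma Cmod_minus_sym (x y : C) : Cmod (x - y) = Cmod (y - x).
Proof. rewrite <- Cmod_opp. f_equal. ring. Qed.

Lemma Cmod_triangle3 (x y z : C) : (Cmod (x - z) <= Cmod (x - y) + Cmod (y - z))%R.
Proof. replace (x - z) with ((x - y) + (y - z)) by ring. apply Cmod_triangle. Qed.

Lemma is_sum_over_unique S f s t : is_sum_over S f s -> is_sum_over S f t -> s = t.
Proof.
intros Hs Ht. apply Ceq_of_small. intros eps He.
destruct (Hs (eps / 2)%R) as (l1 & H1 & H1'); [lra|].
destruct (Ht (eps / 2)%R) as (l2 & H2 & H2'); [lra|].
destruct (common_list S l1 l2 H1 H2) as (l & Hl & HS & Hi1 & Hi2).
specialize (H1' l Hl HS Hi1). specialize (H2' l Hl HS Hi2).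
rewrite Cmod_minus_sym in H1'.
pose proof (Cmod_triangle3 s (sum_list f l) t). lra.
Qed.

Lemma sum_over_unique S f s : is_sum_over S f s -> sum_over S f = s.
Proof.
intros H. apply (iota_unique (V := C_CompleteNormedModule)); auto.
intros y Hy. eapply is_sum_over_unique; eauto.
Qed.

Lemma is_sum_over_ext S f g s :
  (forall w, S w -> f w = g w) -> is_sum_over S f s -> is_sum_over S g s.
Proof.
intros He H eps Heps. destruct (H eps Heps) as (l0 & H0 & H1).
exists l0. split; auto. intros l Hl HS Hi.
rewrite <- (sum_list_ext f g); auto. intros w Hw. apply He. eapply Forall_In; eauto.
Qed.

Lemma is_sum_over_lin S f g s t a b :
  is_sum_over S f s -> is_sum_over S g t ->
  is_sum_over S (fun w => a * f w + b * g w) (a * s + b * t).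
Proof.
intros Hf Hg eps He.
set (K := (Cmod a + Cmod b + 1)%R).
assert (HK : (0 < K)%R) by (unfold K; pose proof (Cmod_ge_0 a); pose proof (Cmod_ge_0 b); lra).
assert (He' : (0 < eps / K)%R) by now apply Rdiv_lt_0_compat.
destruct (Hf _ He') as (l1 & H1 & H1'). destruct (Hg _ He') as (l2 & H2 & H2').
destruct (common_list S l1 l2 H1 H2) as (l0 & _ & HS & Hi1 & Hi2).
exists l0. split; auto. intros l Hl Hs Hi.
rewrite sum_list_lin.
specialize (H1' l Hl Hs (incl_tran Hi1 Hi)). specialize (H2' l Hl Hs (incl_tran Hi2 Hi)).
replace (a * sum_list f l + b * sum_list g l - (a * s + b * t))
  with (a * (sum_list f l - s) + b * (sum_list g l - t)) by ring.
eapply Rle_lt_trans; [apply Cmod_triangle|]. rewrite !Cmod_mult.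
assert (Cmod a * Cmod (sum_list f l - s) <= Cmod a * (eps / K))%R
  by (apply Rmult_le_compat_l; [apply Cmod_ge_0|lra]).
assert (Cmod b * Cmod (sum_list g l - t) <= Cmod b * (eps / K))%R
  by (apply Rmult_le_compat_l; [apply Cmod_ge_0|lra]).
assert (K * (eps / K) = eps)%R by (field; lra).
unfold K in *. nra.
Qed.

Lemma is_sum_over_scal S f s a :
  is_sum_over S f s -> is_sum_over S (fun w => a * f w) (a * s).
Proof.
intros H. replace (a * s) with (a * s + 0 * s) by ring.
apply (is_sum_over_ext S (fun w => a * f w + 0 * f w)); [intros; ring|].
now apply is_sum_over_lin.
Qed.

Lemma is_sum_over_plus S f g s t :
  is_sum_over S f s -> is_sum_over S g t -> is_sum_over S (fun w => f w + g w) (s + t).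
Proof.
intros H H'. replace (s + t) with (1 * s + 1 * t) by ring.
apply (is_sum_over_ext S (fun w => 1 * f w + 1 * g w)); [intros; ring|].
now apply is_sum_over_lin.
Qed.

Lemma is_sum_over_minus S f g s t :
  is_sum_over S f s -> is_sum_over S g t -> is_sum_over S (fun w => f w - g w) (s - t).
Proof.
intros H H'. replace (s - t) with (1 * s + (-1) * t) by ring.
apply (is_sum_over_ext S (fun w => 1 * f w + (-1) * g w)); [intros; ring|].
now apply is_sum_over_lin.
Qed.

Lemma is_sum_over_bound S f g M s :
  (forall w, S w -> (Cmod (f w) <= g w)%R) -> bounded_sums S g M ->
  is_sum_over S f s -> (Cmod s <= M)%R.
Proof.
intros Hg HM H. apply le_epsilon. intros eps He.
destruct (is_sum_over_witness S f s eps H He) as (l & Hl & HS & Hc).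
specialize (Hc l Hl HS (incl_refl l)).
assert (Cmod (sum_list f l) <= M)%R.
{ eapply Rle_trans; [|apply (HM l Hl HS)]. apply sum_list_Cmod.
  intros w Hw. apply Hg. eapply Forall_In; eauto. }
replace s with (sum_list f l - (sum_list f l - s)) by ring.
eapply Rle_trans; [apply Cmod_triangle|]. rewrite Cmod_opp. lra.
Qed.

Lemma nonneg_sum_exists S g M :
  (forall w, S w -> (0 <= g w)%R) -> bounded_sums S g M ->
  exists s : R, is_sum_over S (fun w => RtoC (g w)) (RtoC s).
Proof.
intros Hg HM.
destruct (completeness (fun x => exists l, NoDup l /\ Forall S l /\ x = Rsum g l))
  as (s & Hub & Hlub).
- exists M. intros x (l & Hl & HS & ->). now apply HM.
- exists 0%R, nil. repeat constructor.
- exists s. intros eps He.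
  assert (Hex : exists l, NoDup l /\ Forall S l /\ (s - eps < Rsum g l)%R).
  { apply NNPP. intros Hn.
    assert (s <= s - eps)%R; [|lra]. apply Hlub. intros x (l & Hl & HS & ->).
    apply Rnot_lt_le. intros Hlt. apply Hn. now exists l. }
  destruct Hex as (l0 & Hl0 & HS0 & H0). exists l0. split; auto.
  intros l Hl HS Hi. rewrite sum_list_RtoC, <- RtoC_minus, Cmod_R.
  assert (Rsum g l <= s)%R by (apply Hub; now exists l).
  assert (Rsum g l0 <= Rsum g l)%R.
  { apply Rsum_incl; auto. intros w Hw. apply Hg. eapply Forall_In; eauto. }
  apply Rabs_def1; lra.
Qed.

Lemma Im_le_Cmod (c : C) : (Rabs (Im c) <= Cmod c)%R.
Proof. eapply Rle_trans; [|apply Rmax_Cmod]. apply Rmax_r. Qed.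

(** Absolute summability suffices: the real and imaginary parts are differences
    of the nonnegative summable families [|f| + Re f], [|f| + Im f] and [|f|]. *)
Lemma abs_sum_exists S f g M :
  (forall w, S w -> (Cmod (f w) <= g w)%R) -> bounded_sums S g M ->
  exists s, is_sum_over S f s.
Proof.
intros Hg HM.
assert (Hb : forall h : C -> R, (forall w, S w -> (h w <= 2 * Cmod (f w))%R) ->
  (forall w, S w -> (0 <= h w)%R) ->
  exists s : R, is_sum_over S (fun w => RtoC (h w)) (RtoC s)).
{ intros h H1 H0. apply (nonneg_sum_exists S h (2 * M)); auto.
  apply bounded_sums_le with g; [lra| |auto].
  intros w Hw. specialize (H1 w Hw). specialize (Hg w Hw). lra. }
destruct (Hb (fun w => Cmod (f w))) as (s1 & H1);
  [intros w _; pose proof (Cmod_ge_0 (f w)); lra|intros; apply Cmod_ge_0|].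
destruct (Hb (fun w => (Cmod (f w) + Re (f w))%R)) as (s2 & H2).
1,2: intros w _; pose proof (re_le_Cmod (f w)) as Hr; apply Rabs_le_between in Hr; lra.
destruct (Hb (fun w => (Cmod (f w) + Im (f w))%R)) as (s3 & H3).
1,2: intros w _; pose proof (Im_le_Cmod (f w)) as Hr; apply Rabs_le_between in Hr; lra.
exists ((RtoC s2 - RtoC s1) + Ci * (RtoC s3 - RtoC s1)).
apply (is_sum_over_ext S (fun w =>
  (RtoC (Cmod (f w) + Re (f w))%R - RtoC (Cmod (f w))) +
  Ci * (RtoC (Cmod (f w) + Im (f w))%R - RtoC (Cmod (f w))))).
- intros w _. rewrite !RtoC_plus.
  replace (RtoC (Cmod (f w)) + RtoC (Re (f w)) - RtoC (Cmod (f w)))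
    with (RtoC (Re (f w))) by ring.
  replace (RtoC (Cmod (f w)) + RtoC (Im (f w)) - RtoC (Cmod (f w)))
    with (RtoC (Im (f w))) by ring.
  destruct (f w) as [x y]. unfold Ci, RtoC, Cplus, Cmult, Re, Im; cbn.
  apply f_equal2; ring.
- apply is_sum_over_plus; [now apply is_sum_over_minus|].
  apply is_sum_over_scal. now apply is_sum_over_minus.
Qed.

Lemma sum_list_map f (phi : C -> C) l :
  sum_list f (map phi l) = sum_list (fun w => f (phi w)) l.
Proof. induction l as [|x l IH]; [reflexivity|].
cbn [map]. rewrite !sum_list_cons, IH; reflexivity. Qed.

Lemma is_sum_over_reindex (S S' : C -> Prop) (phi psi : C -> C) f s :
  (forall w, S w -> S' (phi w) /\ psi (phi w) = w) ->
  (forall w, S' w -> S (psi w) /\ phi (psi w) = w) ->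
  is_sum_over S' f s -> is_sum_over S (fun w => f (phi w)) s.
Proof.
intros H1 H2 H eps He. destruct (H eps He) as (l0 & H0 & Hc).
exists (map psi l0). split.
- apply Forall_map. eapply Forall_impl; [|exact H0]. intros w Hw; now apply H2.
- intros l Hl HS Hi. rewrite <- sum_list_map. apply Hc.
  + clear Hi. induction Hl as [|x l Hx Hl IH]; cbn; [constructor|].
    inversion_clear HS as [|? ? Sx Sl]. constructor; auto.
    intros Hin. apply in_map_iff in Hin. destruct Hin as (y & Hy & Hyl).
    apply Hx. rewrite <- (proj2 (H1 x Sx)), <- Hy, (proj2 (H1 y (Forall_In _ _ _ Sl Hyl))).
    exact Hyl.
  + apply Forall_map. eapply Forall_impl; [|exact HS]. intros w Hw; now apply H1.
  + intros w Hw. rewrite <- (proj2 (H2 w (Forall_In _ _ _ H0 Hw))).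
    apply in_map. apply Hi. now apply in_map.
Qed.

Lemma sum_list_app f l l' : sum_list f (l ++ l') = sum_list f l + sum_list f l'.
Proof.
induction l as [|x l IH]; [change (sum_list f l' = 0 + sum_list f l'); ring|].
cbn [app]. rewrite !sum_list_cons, IH. ring.
Qed.

Lemma is_sum_over_add_point (S : C -> Prop) (a : C) f s :
  S a -> is_sum_over (fun w => S w /\ w <> a) f s -> is_sum_over S f (f a + s).
Proof.
intros Ha H eps He. destruct (H eps He) as (l0 & H0 & Hc).
exists (a :: l0). split.
- constructor; auto. eapply Forall_impl; [|exact H0]. now intros w [].
- intros l Hl HS Hi. destruct (in_split a l) as (l1 & l2 & ->). { apply Hi; now left. }
  assert (Hna := NoDup_remove_2 _ _ _ Hl).
  specialize (Hc (l1 ++ l2)).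
  replace (sum_list f (l1 ++ a :: l2) - (f a + s)) with (sum_list f (l1 ++ l2) - s)
    by (rewrite !sum_list_app, sum_list_cons; ring).
  apply Hc.
  + eapply NoDup_remove_1; eauto.
  + apply Forall_forall. intros w Hw. split.
    * eapply Forall_In; [exact HS|]. apply in_app_iff in Hw. apply in_app_iff; cbn; tauto.
    * intros ->. contradiction.
  + intros w Hw. assert (Hwl : In w (l1 ++ a :: l2)) by (apply Hi; now right).
    apply in_app_iff in Hwl. apply in_app_iff. cbn in Hwl.
    destruct Hwl as [|[<-|]]; try tauto.
    exfalso. exact (proj2 (Forall_In _ _ _ H0 Hw) eq_refl).
Qed.

Lemma bounded_sums_add_point (S : C -> Prop) (a : C) g M :
  (0 <= g a)%R ->
  bounded_sums (fun w => S w /\ w <> a) g M -> bounded_sums S g (g a + M).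
Proof.
intros Hg HM l Hl HS. destruct (classic (In a l)) as [Hin|Hn].
- destruct (in_split a l Hin) as (l1 & l2 & ->).
  assert (Hna := NoDup_remove_2 _ _ _ Hl).
  assert (H : (Rsum g (l1 ++ l2) <= M)%R).
  { apply HM; [eapply NoDup_remove_1; eauto|]. apply Forall_forall. intros w Hw. split.
    - eapply Forall_In; [exact HS|]. apply in_app_iff in Hw. apply in_app_iff; cbn; tauto.
    - intros ->. contradiction. }
  rewrite Rsum_app in *. cbn. lra.
- assert (H : (Rsum g l <= M)%R); [|lra]. apply HM; auto. apply Forall_forall.
  intros w Hw. split; [eapply Forall_In; eauto|]. intros ->; contradiction.
Qed.

(** * Power series with complex coefficients *)

Notation Cseries := (is_series (K := C_AbsRing) (V := C_NormedModule)).
Definition Csum (u : nat -> C) (n : nat) : C := sum_n (G := C_AbelianMonoid) u n.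

Lemma Csum_S (u : nat -> C) n : Csum u (S n) = Csum u n + u (S n).
Proof. exact (sum_Sn (G := C_AbelianMonoid) u n). Qed.

Lemma sum_n_R_S (u : nat -> R) n : sum_n u (S n) = (sum_n u n + u (S n))%R :> R.
Proof. exact (sum_Sn u n). Qed.

Lemma sum_n_R_0 (u : nat -> R) : sum_n u 0 = u 0%nat :> R.
Proof. exact (sum_O u). Qed.

Lemma Csum_0 (u : nat -> C) : Csum u 0 = u 0%nat.
Proof. exact (sum_O (G := C_AbelianMonoid) u). Qed.

Lemma Re_Csum (u : nat -> C) n : Re (Csum u n) = sum_n (fun k => Re (u k)) n.
Proof. induction n as [|n IH]; [now rewrite Csum_0, sum_O|]. rewrite Csum_S, sum_Sn, re_plus, IH. reflexivity. Qed.

Lemma Im_Csum (u : nat -> C) n : Im (Csum u n) = sum_n (fun k => Im (u k)) n.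
Proof. induction n as [|n IH]; [now rewrite Csum_0, sum_O|]. rewrite Csum_S, sum_Sn, im_plus, IH. reflexivity. Qed.

Lemma Cmod_le_Re_Im (c : C) : (Cmod c <= Rabs (Re c) + Rabs (Im c))%R.
Proof.
replace c with (RtoC (Re c) + Ci * RtoC (Im c)) at 1.
- eapply Rle_trans; [apply Cmod_triangle|]. rewrite Cmod_mult, Cmod_Ci, !Cmod_R. lra.
- destruct c as [x y]. unfold Ci, RtoC, Cplus, Cmult, Re, Im; cbn. apply f_equal2; ring.
Qed.

Lemma Cseries_eps (u : nat -> C) (l : C) :
  Cseries u l <->
  forall eps, (0 < eps)%R ->
    exists N, forall n, (N <= n)%nat -> (Cmod (Csum u n - l) < eps)%R.
Proof.
split.
- intros H eps He. unfold is_series in H.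
  assert (He2 : (0 < eps / 2)%R) by lra.
  destruct (proj1 (filterlim_locally _ _) H (mkposreal _ He2)) as (N & HN).
  exists N. intros n Hn. specialize (HN n Hn). destruct HN as [H1 H2].
  change (Rabs (Re (Csum u n) - Re l) < eps / 2)%R in H1.
  change (Rabs (Im (Csum u n) - Im l) < eps / 2)%R in H2.
  eapply Rle_lt_trans; [apply Cmod_le_Re_Im|].
  unfold Cminus. rewrite re_plus, im_plus, re_opp, im_opp. unfold Rminus in *. lra.
- intros H. unfold is_series. apply (filterlim_locally (U := C_UniformSpace)). intros eps.
  destruct (H eps (cond_pos eps)) as (N & HN). exists N. intros n Hn.
  specialize (HN n Hn). split.
  + change (Rabs (Re (Csum u n) - Re l) < eps)%R.
    pose proof (re_le_Cmod (Csum u n - l)) as Hr.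
    unfold Cminus in *. rewrite re_plus, re_opp in Hr. unfold Rminus; lra.
  + change (Rabs (Im (Csum u n) - Im l) < eps)%R.
    pose proof (Im_le_Cmod (Csum u n - l)) as Hr.
    unfold Cminus in *. rewrite im_plus, im_opp in Hr. unfold Rminus; lra.
Qed.

Lemma Rseries_eps (u : nat -> R) (l : R) :
  is_series u l <->
  forall eps, (0 < eps)%R ->
    exists N, forall n, (N <= n)%nat -> (Rabs (sum_n u n - l) < eps)%R.
Proof.
split.
- intros H eps He.
  destruct (proj1 (filterlim_locally _ _) H (mkposreal _ He)) as (N & HN).
  exists N. exact HN.
- intros H. apply (filterlim_locally (U := R_UniformSpace)). intros eps.
  destruct (H eps (cond_pos eps)) as (N & HN). exists N. exact HN.
Qed.

Lemma Cseries_Re_Im (u : nat -> C) (l : C) :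
  Cseries u l <->
  is_series (fun n => Re (u n)) (Re l) /\ is_series (fun n => Im (u n)) (Im l).
Proof.
rewrite Cseries_eps, !Rseries_eps. split.
- intros H. split; intros eps He; destruct (H eps He) as (N & HN); exists N;
    intros n Hn; specialize (HN n Hn); eapply Rle_lt_trans; try exact HN.
  + rewrite <- Re_Csum. pose proof (re_le_Cmod (Csum u n - l)) as Hr.
    unfold Cminus in *. rewrite re_plus, re_opp in Hr. exact Hr.
  + rewrite <- Im_Csum. pose proof (Im_le_Cmod (Csum u n - l)) as Hr.
    unfold Cminus in *. rewrite im_plus, im_opp in Hr. exact Hr.
- intros [H1 H2] eps He.
  destruct (H1 (eps / 2)%R) as (N1 & HN1); [lra|].
  destruct (H2 (eps / 2)%R) as (N2 & HN2); [lra|].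
  exists (max N1 N2). intros n Hn.
  specialize (HN1 n ltac:(lia)). specialize (HN2 n ltac:(lia)).
  eapply Rle_lt_trans; [apply Cmod_le_Re_Im|].
  unfold Cminus. rewrite re_plus, im_plus, re_opp, im_opp, Re_Csum, Im_Csum.
  unfold Rminus in *. lra.
Qed.

Lemma Cseries_ext (u v : nat -> C) (l : C) : (forall n, u n = v n) -> Cseries u l -> Cseries v l.
Proof. intros H. apply is_series_ext. exact H. Qed.

Lemma Cseries_unique (u : nat -> C) (l m : C) : Cseries u l -> Cseries u m -> l = m.
Proof.
rewrite !Cseries_eps. intros H H'. apply Ceq_of_small. intros eps He.
destruct (H (eps / 2)%R) as (N1 & HN1); [lra|].
destruct (H' (eps / 2)%R) as (N2 & HN2); [lra|].
specialize (HN1 (max N1 N2) ltac:(lia)). specialize (HN2 (max N1 N2) ltac:(lia)).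
pose proof (Cmod_triangle3 l (Csum u (max N1 N2)) m).
rewrite Cmod_minus_sym in HN1. lra.
Qed.

Lemma Cseries_plus (u v : nat -> C) (l m : C) :
  Cseries u l -> Cseries v m -> Cseries (fun n => u n + v n) (l + m).
Proof. apply (is_series_plus (V := C_NormedModule)). Qed.

Lemma Cseries_scal (c : C) (u : nat -> C) (l : C) : Cseries u l -> Cseries (fun n => c * u n) (c * l).
Proof. apply (is_series_scal (V := C_NormedModule)). Qed.

Lemma Cseries_incr_1 (u : nat -> C) (l : C) :
  Cseries u (l + u 0%nat) -> Cseries (fun n => u (S n)) l.
Proof. exact (is_series_incr_1 (V := C_NormedModule) u l). Qed.

Lemma Cseries_single (u : nat -> C) : (forall n, u (S n) = 0) -> Cseries u (u 0%nat).
Proof.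
intros H. apply Cseries_eps. intros eps He. exists 0%nat. intros n _.
replace (Csum u n) with (u 0%nat).
- replace (u 0%nat - u 0%nat) with (RtoC 0) by ring. now rewrite Cmod_0.
- induction n as [|n IH]; [now rewrite Csum_0|]. rewrite Csum_S, H, <- IH. ring.
Qed.

Lemma Cseries_mult (u v : nat -> C) (l m : C) :
  ex_series (fun n => Cmod (u n)) -> ex_series (fun n => Cmod (v n)) ->
  Cseries u l -> Cseries v m ->
  Cseries (fun n => Csum (fun k => u k * v (n - k)%nat) n) (l * m).
Proof.
intros Eu Ev Hu Hv.
assert (HR : forall w : nat -> C, ex_series (fun n => Cmod (w n)) ->
  ex_series (fun n => Rabs (Re (w n))) /\ ex_series (fun n => Rabs (Im (w n)))).
{ intros w Hw. split; apply (ex_series_le (V := R_CompleteNormedModule) _ (fun n => Cmod (w n))); auto;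
    intros n; change norm with Rabs; cbv beta; rewrite Rabs_Rabsolu;
    [apply re_le_Cmod|apply Im_le_Cmod]. }
destruct (HR u Eu) as [Eu1 Eu2]. destruct (HR v Ev) as [Ev1 Ev2].
apply Cseries_Re_Im in Hu. apply Cseries_Re_Im in Hv.
destruct Hu as [Hu1 Hu2]. destruct Hv as [Hv1 Hv2].
apply Cseries_Re_Im. rewrite re_mult, im_mult. split.
- apply (is_series_ext (fun n =>
    minus (sum_f_R0 (fun k => Re (u k) * Re (v (n - k)%nat))%R n)
      (sum_f_R0 (fun k => Im (u k) * Im (v (n - k)%nat))%R n))).
  + intros n. rewrite Re_Csum, <- !sum_n_Reals.
    enough (H : forall (w : nat -> C) N, (sum_n (fun k => Re (u k) * Re (w k)) N -
      sum_n (fun k => Im (u k) * Im (w k)) N = sum_n (fun k => Re (u k * w k)%C) N :> R)%R)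
      by exact (H (fun j => v (n - j)%nat) n).
    intros w N.
    induction N as [|N IH]; [rewrite !sum_n_R_0; symmetry; apply re_mult|].
    rewrite !sum_n_R_S, <- IH, re_mult. ring.
  + apply (is_series_minus (V := R_NormedModule) _ _ (Re l * Re m)%R (Im l * Im m)%R).
    * now apply (is_series_mult (fun n => Re (u n)) (fun n => Re (v n))).
    * now apply (is_series_mult (fun n => Im (u n)) (fun n => Im (v n))).
- apply (is_series_ext (fun n =>
    plus (sum_f_R0 (fun k => Re (u k) * Im (v (n - k)%nat))%R n)
      (sum_f_R0 (fun k => Im (u k) * Re (v (n - k)%nat))%R n))).
  + intros n. rewrite Im_Csum, <- !sum_n_Reals.
    enough (H : forall (w : nat -> C) N, (sum_n (fun k => Re (u k) * Im (w k)) N +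
      sum_n (fun k => Im (u k) * Re (w k)) N = sum_n (fun k => Im (u k * w k)%C) N :> R)%R)
      by exact (H (fun j => v (n - j)%nat) n).
    intros w N.
    induction N as [|N IH]; [rewrite !sum_n_R_0; symmetry; apply im_mult|].
    rewrite !sum_n_R_S, <- IH, im_mult. ring.
  + apply (is_series_plus (V := R_NormedModule) _ _ (Re l * Im m)%R (Im l * Re m)%R).
    * now apply (is_series_mult (fun n => Re (u n)) (fun n => Im (v n))).
    * now apply (is_series_mult (fun n => Im (u n)) (fun n => Re (v n))).
Qed.

(** The coefficients and the radius are explicit because the generating function
    needs a radius of convergence that is uniform in [u]. *)
Definition has_ps (f : C -> C) (z0 : C) (a : nat -> C) (r : R) : Prop :=
  (0 < r)%R /\ forall h, (Cmod h < r)%R -> Cseries (fun n => a n * h ^ n) (f (z0 + h)).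

Lemma is_pseries_Cseries a x l :
  is_pseries (K := C_AbsRing) (V := C_NormedModule) a x l
  <-> Cseries (fun n => a n * x ^ n) l.
Proof.
assert (H : forall n, scal (V := C_NormedModule) (pow_n (K := C_AbsRing) x n) (a n) = a n * x ^ n).
{ intros n. replace (pow_n (K := C_AbsRing) x n) with (x ^ n).
  - apply Cmult_comm.
  - induction n as [|n IH]; [reflexivity|]. rewrite Cpow_S, IH. reflexivity. }
unfold is_pseries. split; apply is_series_ext; intros n; now rewrite H.
Qed.

Lemma analytic_at_iff f z0 : analytic_at f z0 <-> exists a r, has_ps f z0 a r.
Proof.
split.
- intros (a & r & Hr & H). exists a, r. split; auto. intros h Hh.
  specialize (H (z0 + h)). rewrite is_pseries_Cseries in H.
  replace (z0 + h - z0) with h in H by ring. auto.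
- intros (a & r & Hr & H). exists a, r. split; auto. intros z Hz.
  rewrite is_pseries_Cseries. replace (f z) with (f (z0 + (z - z0))) by (f_equal; ring).
  now apply H.
Qed.

Lemma has_ps_shrink (f : C -> C) z0 a r r' : (0 < r' <= r)%R -> has_ps f z0 a r -> has_ps f z0 a r'.
Proof. intros Hr [_ H]. split; [lra|]. intros h Hh. apply H. lra. Qed.

Lemma has_ps_ext (f g : C -> C) z0 a r :
  (forall h, (Cmod h < r)%R -> f (z0 + h) = g (z0 + h)) -> has_ps f z0 a r -> has_ps g z0 a r.
Proof. intros He [Hr H]. split; auto. intros h Hh. rewrite <- He; auto. Qed.

Lemma finite_max (g : nat -> R) N : exists K, (0 <= K)%R /\ forall n, (n < N)%nat -> (g n <= K)%R.
Proof.
induction N as [|N (K & HK & H)].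
- exists 0%R. split; [lra|]. lia.
- exists (Rmax K (g N)). split; [eapply Rle_trans; [exact HK|apply Rmax_l]|].
  intros n Hn. destruct (Nat.eq_dec n N) as [->|Hne]; [apply Rmax_r|].
  eapply Rle_trans; [apply H; lia|apply Rmax_l].
Qed.

Lemma has_ps_bound (f : C -> C) z0 a r rho :
  has_ps f z0 a r -> (0 < rho < r)%R ->
  exists K, (0 <= K)%R /\ forall n, (Cmod (a n) * rho ^ n <= K)%R.
Proof.
intros [Hr H] [H0 H1].
specialize (H (RtoC rho)). rewrite Cmod_R, Rabs_pos_eq in H by lra. specialize (H H1).
assert (Hm : forall n, Cmod (a n * RtoC rho ^ n) = (Cmod (a n) * rho ^ n)%R).
{ intros n. rewrite Cmod_mult, Cmod_pow, Cmod_R, Rabs_pos_eq by lra. reflexivity. }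
destruct (proj1 (Cseries_eps _ _) H 1%R Rlt_0_1) as (N & HN).
destruct (finite_max (fun n => Cmod (a n) * rho ^ n)%R (S N)) as (K & HK0 & HK).
exists (Rmax K 2). split; [eapply Rle_trans; [exact HK0|apply Rmax_l]|].
intros n. destruct (le_lt_dec n N) as [Hn|Hn].
- eapply Rle_trans; [apply HK; lia|apply Rmax_l].
- eapply Rle_trans; [|apply Rmax_r]. rewrite <- Hm.
  destruct n as [|n]; [lia|].
  pose proof (HN n ltac:(lia)) as A1. pose proof (HN (S n) ltac:(lia)) as A2.
  rewrite Csum_S in A2. set (s := Csum _ n) in *. set (l := f _) in *.
  set (t := a (S n) * RtoC rho ^ S n) in *.
  replace t with ((s + t - l) - (s - l)) by ring.
  eapply Rle_trans; [apply Cmod_triangle|]. rewrite Cmod_opp. lra.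
Qed.

Lemma pow_ratio x rho n : (0 < rho)%R -> ((x / rho) ^ n * rho ^ n = x ^ n)%R.
Proof. intros H. rewrite <- Rpow_mult_distr. f_equal. field. lra. Qed.

(** Taylor's estimate: Cauchy's bound on the coefficients leaves a geometric
    remainder.  It yields continuity, the derivative at the centre, isolation of
    zeros and the maximum principle. *)
Lemma has_ps_taylor (f : C -> C) z0 a r k :
  has_ps f z0 a r ->
  exists K r', (0 <= K)%R /\ (0 < r' < r)%R /\ forall h, (Cmod h < r')%R ->
    (Cmod (f (z0 + h) - Csum (fun n => a n * h ^ n) k)%C <= K * Cmod h ^ S k)%R.
Proof.
intros Hf. pose proof (proj1 Hf) as Hr.
destruct (has_ps_bound f z0 a r (r / 2) Hf) as (K & HK0 & HK); [lra|].
set (rho := (r / 2)%R) in *. assert (Hrho : (0 < rho)%R) by (unfold rho; lra).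
exists (2 * K / rho ^ S k)%R, (rho / 2)%R.
assert (Hpk : (0 < rho ^ S k)%R) by now apply pow_lt.
split; [apply Rmult_le_pos; [lra|]; left; now apply Rinv_0_lt_compat|].
split; [unfold rho; lra|].
intros h Hh. set (x := (Cmod h / rho)%R).
assert (Hx : (0 <= x <= 1 / 2)%R).
{ unfold x. split; [apply Rmult_le_pos; [apply Cmod_ge_0|left; now apply Rinv_0_lt_compat]|].
  apply Rmult_le_reg_r with rho; auto. unfold Rdiv at 1. rewrite Rmult_assoc, Rinv_l by lra. lra. }
replace (2 * K / rho ^ S k * Cmod h ^ S k)%R with (2 * K * x ^ S k)%R.
2:{ unfold x. rewrite <- (pow_ratio (Cmod h) rho (S k)) by auto. field. lra. }
set (u := fun n => a n * h ^ n).
assert (Hu : forall n, (Cmod (u n) <= K * x ^ n)%R).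
{ intros n. unfold u. rewrite Cmod_mult, Cmod_pow, <- (pow_ratio (Cmod h) rho n) by auto.
  fold x. rewrite (Rmult_comm (x ^ n)), <- Rmult_assoc.
  apply Rmult_le_compat_r; [apply pow_le; lra|apply HK]. }
(* On half the radius a tail is at most twice its first term. *)
assert (Hs : forall j, (Cmod (Csum u (k + j) - Csum u k) <= 2 * K * x ^ S k * (1 - (1 / 2) ^ j))%R).
{ induction j as [|j IH].
  - rewrite Nat.add_0_r. replace (Csum u k - Csum u k) with (RtoC 0) by ring. rewrite Cmod_0. cbn; lra.
  - rewrite Nat.add_succ_r, Csum_S.
    replace (Csum u (k + j) + u (S (k + j)) - Csum u k)
      with ((Csum u (k + j) - Csum u k) + u (S (k + j))) by ring.
    eapply Rle_trans; [apply Cmod_triangle|].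
    specialize (Hu (S (k + j))).
    replace (S (k + j)) with (S k + j)%nat in Hu at 2 by lia. rewrite pow_add in Hu.
    assert (K * (x ^ S k * x ^ j) <= K * (x ^ S k * (1 / 2) ^ j))%R.
    { apply Rmult_le_compat_l; auto. apply Rmult_le_compat_l; [apply pow_le; lra|].
      apply pow_incr; lra. }
    replace ((1 / 2) ^ S j)%R with ((1 / 2) ^ j / 2)%R by (cbn; lra). nra. }
assert (Hs' : forall j, (Cmod (Csum u (k + j) - Csum u k) <= 2 * K * x ^ S k)%R).
{ intros j. eapply Rle_trans; [apply Hs|].
  assert (0 < (1 / 2) ^ j)%R by (apply pow_lt; lra).
  assert (0 <= x ^ S k)%R by (apply pow_le; lra). assert (0 <= 2 * K * x ^ S k)%R by (apply Rmult_le_pos; lra). nra. }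
apply le_epsilon. intros eps He.
destruct (proj1 (Cseries_eps _ _) (proj2 Hf h ltac:(unfold rho in *; lra)) eps He) as (N & HN).
specialize (HN (k + N)%nat ltac:(lia)). specialize (Hs' N). fold u in HN |- *.
pose proof (Cmod_triangle3 (f (z0 + h)) (Csum u (k + N)) (Csum u k)).
rewrite Cmod_minus_sym in HN. lra.
Qed.

Lemma has_ps_center (f : C -> C) z0 a r : has_ps f z0 a r -> a 0%nat = f z0.
Proof.
intros [Hr H]. specialize (H (RtoC 0)). rewrite Cmod_0 in H. specialize (H Hr).
replace (z0 + RtoC 0) with z0 in H by ring.
apply (Cseries_unique (fun n => a n * RtoC 0 ^ n)); auto.
replace (a 0%nat) with (a 0%nat * RtoC 0 ^ 0) by (cbn; ring).
apply (Cseries_single (fun n => a n * RtoC 0 ^ n)).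
intros n. rewrite Cpow_S. ring.
Qed.

Definition Cder (f : C -> C) (z l : C) : Prop :=
  forall eps, (0 < eps)%R -> exists d, (0 < d)%R /\ forall h, (Cmod h < d)%R ->
    (Cmod (f (z + h)%C - f z - l * h) <= eps * Cmod h)%R.

Lemma Cder_unique (f : C -> C) z l m : Cder f z l -> Cder f z m -> l = m.
Proof.
intros H H'. apply Ceq_of_small. intros eps He.
destruct (H (eps / 3)%R) as (d & Hd & A); [lra|].
destruct (H' (eps / 3)%R) as (d' & Hd' & A'); [lra|].
set (t := (Rmin d d' / 2)%R).
assert (Ht : (0 < t)%R) by (unfold t; apply Rdiv_lt_0_compat; [now apply Rmin_glb_lt|lra]).
assert (t < d /\ t < d')%R by (unfold t in *; pose proof (Rmin_l d d'); pose proof (Rmin_r d d'); lra).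
assert (Hm : Cmod (RtoC t) = t) by (rewrite Cmod_R; apply Rabs_pos_eq; lra).
specialize (A (RtoC t)). specialize (A' (RtoC t)). rewrite Hm in A, A'.
specialize (A ltac:(lra)). specialize (A' ltac:(lra)).
apply Rmult_lt_reg_r with t; auto. rewrite <- Hm at 1. rewrite <- Cmod_mult.
replace ((l - m) * RtoC t) with ((f (z + RtoC t) - f z - m * RtoC t) - (f (z + RtoC t) - f z - l * RtoC t)) by ring.
eapply Rle_lt_trans; [apply Cmod_triangle|]. rewrite Cmod_opp. nra.
Qed.

(** Bernoulli's inequality [1 + n (s / t - 1) <= (s / t) ^ n], for the midpoint [s]
    of [t] and [1]. *)
Lemma linear_geometric t : (0 <= t < 1)%R ->
  exists K phi, (0 <= K)%R /\ (0 <= phi < 1)%R /\ forall n, (INR n * t ^ n <= K * phi ^ n)%R.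
Proof.
intros Ht. set (s := ((1 + t) / 2)%R). assert (Hs : (0 < s < 1)%R) by (unfold s; lra).
assert (Hx : (0 < s - t)%R) by (unfold s; lra).
exists (s / (s - t))%R, s. split; [apply Rmult_le_pos; [lra|left; now apply Rinv_0_lt_compat]|].
split; [lra|].
intros n.
destruct (Rle_lt_or_eq_dec 0 t (proj1 Ht)) as [Htp|<-].
- assert (HB : (1 + INR n * ((s - t) / t) <= (s / t) ^ n)%R).
  { replace (s / t)%R with (1 + (s - t) / t)%R by (field; lra). apply poly. now apply Rdiv_lt_0_compat. }
  assert (Htn : (0 < t ^ n)%R) by now apply pow_lt.
  assert (E : ((s / t) ^ n * t ^ n = s ^ n)%R) by now apply pow_ratio.
  rewrite <- E.
  apply Rmult_le_reg_l with ((s - t) / t)%R; [now apply Rdiv_lt_0_compat|].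
  replace ((s - t) / t * (s / (s - t) * ((s / t) ^ n * t ^ n)))%R
    with (s / t * (s / t) ^ n * t ^ n)%R by (field; lra).
  replace ((s - t) / t * (INR n * t ^ n))%R with (INR n * ((s - t) / t) * t ^ n)%R by ring.
  apply Rmult_le_compat_r; [lra|].
  assert (1 <= s / t)%R.
  { apply Rmult_le_reg_r with t; auto. unfold Rdiv. rewrite Rmult_assoc, Rinv_l by lra. lra. }
  assert (0 < (s / t) ^ n)%R by (apply pow_lt; lra). nra.
- destruct n as [|n]; [cbn; rewrite Rmult_0_l; apply Rmult_le_pos; [|lra];
    apply Rmult_le_pos; [lra|left; apply Rinv_0_lt_compat; lra]|].
  rewrite pow_ne_zero, Rmult_0_r by lia. apply Rmult_le_pos; [|apply pow_le; lra].
  apply Rmult_le_pos; [lra|left; now apply Rinv_0_lt_compat].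
Qed.

Lemma ex_series_geom_bound u K t :
  (0 <= t < 1)%R -> (forall n, (Rabs (u n) <= K * t ^ n)%R) -> ex_series u.
Proof.
intros Ht Hu. apply (ex_series_le (V := R_CompleteNormedModule) u (fun n => K * t ^ n)%R); auto.
apply (ex_series_scal (V := R_NormedModule) K). apply ex_series_geom. rewrite Rabs_pos_eq; lra.
Qed.

Lemma Cseries_exists (u : nat -> C) : ex_series (fun n => Cmod (u n)) -> exists l, Cseries u l.
Proof.
intros H.
assert (H1 : ex_series (fun n => Re (u n))).
{ apply (ex_series_le (V := R_CompleteNormedModule) _ (fun n => Cmod (u n))); auto.
  intros n. apply re_le_Cmod. }
assert (H2 : ex_series (fun n => Im (u n))).
{ apply (ex_series_le (V := R_CompleteNormedModule) _ (fun n => Cmod (u n))); auto.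
  intros n. apply Im_le_Cmod. }
destruct H1 as [x Hx]. destruct H2 as [y Hy]. exists (x, y).
apply Cseries_Re_Im. now split.
Qed.

Lemma Csum_Cmod (u : nat -> C) b n : (forall k, (Cmod (u k) <= b k)%R) -> (Cmod (Csum u n) <= sum_n b n)%R.
Proof.
intros H. induction n as [|n IH]; [rewrite Csum_0, sum_O; apply H|].
rewrite Csum_S, sum_Sn. eapply Rle_trans; [apply Cmod_triangle|].
apply Rplus_le_compat; auto.
Qed.

Lemma Cseries_bound (u : nat -> C) (l : C) b B :
  (forall k, (Cmod (u k) <= b k)%R) -> is_series b B -> Cseries u l -> (Cmod l <= B)%R.
Proof.
intros Hb HB Hl. apply le_epsilon. intros eps He.
destruct (proj1 (Cseries_eps _ _) Hl (eps / 2)%R) as (N & HN); [lra|].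
destruct (proj1 (Rseries_eps _ _) HB (eps / 2)%R) as (N' & HN'); [lra|].
specialize (HN (max N N') ltac:(lia)). specialize (HN' (max N N') ltac:(lia)).
pose proof (Csum_Cmod u b (max N N') Hb). apply Rabs_def2 in HN'.
replace l with (Csum u (max N N') - (Csum u (max N N') - l)) by ring.
eapply Rle_trans; [apply Cmod_triangle|]. rewrite Cmod_opp. lra.
Qed.

Lemma has_ps_abs (f : C -> C) z0 a r h :
  has_ps f z0 a r -> (Cmod h < r)%R -> ex_series (fun n => Cmod (a n * h ^ n)).
Proof.
intros Hf Hh. pose proof (proj1 Hf). pose proof (Cmod_ge_0 h).
set (rho := ((Cmod h + r) / 2)%R).
destruct (has_ps_bound f z0 a r rho Hf) as (K & HK0 & HK); [unfold rho; lra|].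
assert (Hrho : (0 < rho)%R) by (unfold rho; lra).
apply (ex_series_geom_bound _ K (Cmod h / rho)).
- split; [apply Rmult_le_pos; [lra|left; now apply Rinv_0_lt_compat]|].
  apply Rmult_lt_reg_r with rho; auto. unfold Rdiv at 1. rewrite Rmult_assoc, Rinv_l by lra.
  unfold rho; lra.
- intros n. rewrite Rabs_pos_eq by apply Cmod_ge_0.
  rewrite Cmod_mult, Cmod_pow, <- (pow_ratio (Cmod h) rho n) by auto.
  rewrite (Rmult_comm (_ ^ n)), <- Rmult_assoc. apply Rmult_le_compat_r; [|apply HK].
  apply pow_le. apply Rmult_le_pos; [lra|left; now apply Rinv_0_lt_compat].
Qed.

Lemma has_ps_mult (f g : C -> C) z0 a b r :
  has_ps f z0 a r -> has_ps g z0 b r ->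
  has_ps (fun z => f z * g z) z0 (fun n => Csum (fun k => a k * b (n - k)%nat) n) r.
Proof.
intros Hf Hg. split; [apply Hf|]. intros h Hh.
apply (Cseries_ext (fun n => Csum (fun k => (a k * h ^ k) * (b (n - k)%nat * h ^ (n - k))) n)).
- intros n. rewrite Cmult_comm.
  change (Csum (fun k => a k * h ^ k * (b (n - k)%nat * h ^ (n - k))) n
    = mult (K := C_Ring) (h ^ n) (Csum (fun k => a k * b (n - k)%nat) n)).
  unfold Csum. rewrite <- (sum_n_mult_l (K := C_Ring)). apply sum_n_ext_loc. intros k Hk.
  change (a k * h ^ k * (b (n - k)%nat * h ^ (n - k)) = h ^ n * (a k * b (n - k)%nat)).
  replace (h ^ n) with (h ^ k * h ^ (n - k)); [ring|].
  rewrite <- Cpow_add_r. f_equal. lia.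
- apply (Cseries_mult (fun n => a n * h ^ n) (fun n => b n * h ^ n)); [now apply (has_ps_abs f z0 a r)|now apply (has_ps_abs g z0 b r)| |];
    [now apply Hf|now apply Hg].
Qed.

Lemma has_ps_lin (f g : C -> C) z0 a b r c d :
  has_ps f z0 a r -> has_ps g z0 b r ->
  has_ps (fun z => c * f z + d * g z) z0 (fun n => c * a n + d * b n) r.
Proof.
intros [Hr Hf] [_ Hg]. split; auto. intros h Hh.
apply (Cseries_ext (fun n => c * (a n * h ^ n) + d * (b n * h ^ n))); [intros; ring|].
apply Cseries_plus; apply Cseries_scal; auto.
Qed.

(** A bound for all the terms of a power series at once, which makes termwise
    differentiation a single estimate. *)
Lemma pow_second_order (x k : C) (Rr : R) n :
  (0 < Rr)%R -> (Cmod x <= Rr)%R -> (Cmod (x + k) <= Rr)%R ->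
  (Cmod ((x + k) ^ S n - x ^ S n - RtoC (INR (S n)) * x ^ n * k) * Rr
    <= INR (S n) * INR (S n) * Rr ^ n * (Cmod k * Cmod k))%R.
Proof.
intros HR Hx Hk. pose proof (Cmod_ge_0 k) as Hk0.
induction n as [|n IH].
- replace ((x + k) ^ 1 - x ^ 1 - RtoC (INR 1) * x ^ 0 * k) with (RtoC 0) by (cbn; ring).
  rewrite Cmod_0. cbn. nra.
- set (e := (x + k) ^ S n - x ^ S n - RtoC (INR (S n)) * x ^ n * k) in *.
  replace ((x + k) ^ S (S n) - x ^ S (S n) - RtoC (INR (S (S n))) * x ^ S n * k)
    with ((x + k) * e + RtoC (INR (S n)) * x ^ n * (k * k)).
  2:{ unfold e. rewrite (S_INR (S n)), RtoC_plus, !Cpow_S. ring. }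
  assert (HN : (1 <= INR (S n))%R) by (rewrite S_INR; pose proof (pos_INR n); lra).
  assert (H1 : (Cmod ((x + k) * e + RtoC (INR (S n)) * x ^ n * (k * k))
    <= Rr * Cmod e + INR (S n) * Rr ^ n * (Cmod k * Cmod k))%R).
  { eapply Rle_trans; [apply Cmod_triangle|]. rewrite !Cmod_mult, Cmod_R, Cmod_pow.
    rewrite (Rabs_pos_eq (INR (S n))) by lra.
    apply Rplus_le_compat; [apply Rmult_le_compat_r; [apply Cmod_ge_0|auto]|].
    apply Rmult_le_compat_r; [nra|]. apply Rmult_le_compat_l; [lra|].
    apply pow_incr. split; [apply Cmod_ge_0|auto]. }
  apply Rle_trans with ((Rr * Cmod e + INR (S n) * Rr ^ n * (Cmod k * Cmod k)) * Rr)%R.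
  { apply Rmult_le_compat_r; lra. }
  assert (Hp : (0 <= Rr ^ n)%R) by (apply pow_le; lra).
  assert (H2 : (Rr * (Cmod e * Rr) <= Rr * (INR (S n) * INR (S n) * Rr ^ n * (Cmod k * Cmod k)))%R)
    by (apply Rmult_le_compat_l; lra).
  rewrite (S_INR (S n)). cbn [pow].
  assert (0 <= Rr ^ n * (Cmod k * Cmod k) * Rr)%R by (apply Rmult_le_pos; [apply Rmult_le_pos; nra|lra]).
  set (T := (Rr ^ n * (Cmod k * Cmod k) * Rr)%R) in *.
  replace ((Rr * Cmod e + INR (S n) * Rr ^ n * (Cmod k * Cmod k)) * Rr)%R
    with (Rr * (Cmod e * Rr) + INR (S n) * T)%R by (unfold T; ring).
  replace (Rr * (INR (S n) * INR (S n) * Rr ^ n * (Cmod k * Cmod k)))%R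
    with (INR (S n) * INR (S n) * T)%R in H2 by (unfold T; ring).
  replace ((INR (S n) + 1) * (INR (S n) + 1) * (Rr * Rr ^ n) * (Cmod k * Cmod k))%R
    with ((INR (S n) + 1) * (INR (S n) + 1) * T)%R by (unfold T; ring).
  nra.
Qed.

(** The second-order remainders of the terms are summable, since [n^2 |a_n| R^n] is
    dominated by a geometric series. *)
Lemma has_ps_derive (f : C -> C) z0 a r h :
  has_ps f z0 a r -> (Cmod h < r)%R ->
  exists D, Cseries (fun n => RtoC (INR (S n)) * a (S n) * h ^ n) D /\ Cder f (z0 + h) D.
Proof.
intros Hf Hh. pose proof (proj1 Hf) as Hr. pose proof (Cmod_ge_0 h) as Hh0.
set (Rr := ((2 * Cmod h + r) / 3)%R). set (rho := ((Cmod h + 2 * r) / 3)%R).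
assert (HR : (Cmod h < Rr)%R) by (unfold Rr; lra).
assert (HR0 : (0 < Rr)%R) by lra.
assert (Hrho : (Rr < rho < r)%R) by (unfold Rr, rho; lra).
destruct (has_ps_bound f z0 a r rho Hf) as (K & HK0 & HK); [lra|].
set (t := (Rr / rho)%R).
assert (Ht : (0 < t < 1)%R).
{ unfold t. split; [apply Rdiv_lt_0_compat; lra|]. apply Rmult_lt_reg_r with rho; [lra|].
  unfold Rdiv. rewrite Rmult_assoc, Rinv_l by lra. lra. }
assert (Ha : forall n, (Cmod (a n) * Rr ^ n <= K * t ^ n)%R).
{ intros n. rewrite <- (pow_ratio Rr rho n) by lra. fold t.
  rewrite (Rmult_comm (t ^ n)), <- Rmult_assoc. apply Rmult_le_compat_r; [apply pow_le; lra|apply HK]. }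
destruct (linear_geometric t) as (K1 & p1 & HK1 & Hp1 & H1); [lra|].
destruct (linear_geometric p1) as (K2 & p2 & HK2 & Hp2 & H2); [lra|].
assert (Hsq : forall n, (INR n * INR n * (Cmod (a n) * Rr ^ n) <= K * K1 * K2 * p2 ^ n)%R).
{ intros n. specialize (Ha n). specialize (H1 n). specialize (H2 n). pose proof (pos_INR n) as Hn.
  apply Rle_trans with (K * (INR n * (INR n * t ^ n)))%R; [nra|].
  rewrite !Rmult_assoc. apply Rmult_le_compat_l; auto.
  apply Rle_trans with (K1 * (INR n * p1 ^ n))%R; [nra|]. apply Rmult_le_compat_l; auto. }
assert (HB : ex_series (fun n => INR (S n) * INR (S n) * (Cmod (a (S n)) * Rr ^ S n))%R).
{ apply (ex_series_incr_1 (V := R_NormedModule) (fun n => INR n * INR n * (Cmod (a n) * Rr ^ n))%R).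
  apply (ex_series_geom_bound _ (K * K1 * K2) p2); auto.
  intros n. rewrite Rabs_pos_eq; auto. apply Rmult_le_pos; [apply Rmult_le_pos; apply pos_INR|].
  apply Rmult_le_pos; [apply Cmod_ge_0|apply pow_le; lra]. }
destruct HB as [B HB].
assert (HSn : forall n, (1 <= INR (S n))%R) by (intros n; rewrite S_INR; pose proof (pos_INR n); lra).
destruct (Cseries_exists (fun n => RtoC (INR (S n)) * a (S n) * h ^ n)) as [D HD].
{ apply (ex_series_le (V := R_CompleteNormedModule) _
    (fun n => / Rr * (INR (S n) * INR (S n) * (Cmod (a (S n)) * Rr ^ S n)))%R).
  - intros n. change norm with Rabs. cbv beta. rewrite Rabs_pos_eq by apply Cmod_ge_0.
    rewrite !Cmod_mult, Cmod_R, Cmod_pow, (Rabs_pos_eq (INR _)) by apply pos_INR.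
    specialize (HSn n). pose proof (Cmod_ge_0 (a (S n))).
    assert (Cmod h ^ n <= Rr ^ n)%R by (apply pow_incr; lra).
    assert (0 <= Rr ^ n)%R by (apply pow_le; lra).
    replace (/ Rr * (INR (S n) * INR (S n) * (Cmod (a (S n)) * Rr ^ S n)))%R
      with (INR (S n) * INR (S n) * (Cmod (a (S n)) * Rr ^ n))%R by (cbn [pow]; field; lra).
    rewrite Rmult_assoc. rewrite (Rmult_assoc (INR (S n)) (INR (S n))).
    apply Rmult_le_compat_l; [lra|].
    apply Rle_trans with (Cmod (a (S n)) * Rr ^ n)%R; [now apply Rmult_le_compat_l|].
    assert (0 <= Cmod (a (S n)) * Rr ^ n)%R by now apply Rmult_le_pos. nra.
  - apply (ex_series_scal (V := R_NormedModule)). now exists B. }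
exists D. split; auto.
assert (Hrem : forall k, (Cmod (h + k) <= Rr)%R ->
  (Cmod (f (z0 + h + k)%C - f (z0 + h)%C - D * k) <= B / (Rr * Rr) * (Cmod k * Cmod k))%R).
{ intros k Hk.
  assert (A1 := proj2 Hf (h + k) ltac:(lra)). assert (A0 := proj2 Hf h Hh).
  replace (z0 + (h + k)) with (z0 + h + k) in A1 by ring.
  assert (A : Cseries (fun n => a n * (h + k) ^ n + (-1) * (a n * h ^ n)) (f (z0 + h + k) + (-1) * f (z0 + h))).
  { apply Cseries_plus; auto. now apply Cseries_scal. }
  assert (A' : Cseries (fun n => a (S n) * (h + k) ^ S n + (-1) * (a (S n) * h ^ S n))
     (f (z0 + h + k) - f (z0 + h))).
  { apply (Cseries_incr_1 (fun n => a n * (h + k) ^ n + (-1) * (a n * h ^ n))).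
    replace (f (z0 + h + k) - f (z0 + h) + (a 0%nat * (h + k) ^ 0 + (-1) * (a 0%nat * h ^ 0)))
      with (f (z0 + h + k) + (-1) * f (z0 + h)) by (cbn [Cpow]; ring).
    exact A. }
  assert (A2 := Cseries_plus _ _ _ _ A' (Cseries_scal (- k) _ _ HD)).
  replace (f (z0 + h + k) - f (z0 + h) + - k * D) with (f (z0 + h + k) - f (z0 + h) - D * k) in A2 by ring.
  eapply Cseries_bound; [|  |exact A2].
  2:{ replace (B / (Rr * Rr) * (Cmod k * Cmod k))%R with ((Cmod k * Cmod k) / (Rr * Rr) * B)%R by (field; lra).
      apply (is_series_scal (V := R_NormedModule)). exact HB. }
  intros n. cbv beta.
  replace (a (S n) * (h + k) ^ S n + -1 * (a (S n) * h ^ S n) + - k * (RtoC (INR (S n)) * a (S n) * h ^ n))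
    with (a (S n) * ((h + k) ^ S n - h ^ S n - RtoC (INR (S n)) * h ^ n * k)) by ring.
  rewrite Cmod_mult.
  pose proof (pow_second_order h k Rr n HR0 ltac:(lra) Hk) as P.
  change (scal (Cmod k * Cmod k / (Rr * Rr))%R (INR (S n) * INR (S n) * (Cmod (a (S n)) * Rr ^ S n))%R)
    with ((Cmod k * Cmod k / (Rr * Rr)) * (INR (S n) * INR (S n) * (Cmod (a (S n)) * Rr ^ S n)))%R.
  replace ((Cmod k * Cmod k / (Rr * Rr)) * (INR (S n) * INR (S n) * (Cmod (a (S n)) * Rr ^ S n)))%R
    with (Cmod (a (S n)) * (/ Rr * (INR (S n) * INR (S n) * Rr ^ n * (Cmod k * Cmod k))))%R
    by (cbn [pow]; field; lra).
  apply Rmult_le_compat_l; [apply Cmod_ge_0|].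
  apply Rmult_le_reg_r with Rr; auto. eapply Rle_trans; [exact P|].
  apply Req_le. field. lra. }
intros eps He.
assert (HBp : (0 <= B / (Rr * Rr))%R).
{ apply Rmult_le_pos; [|left; apply Rinv_0_lt_compat; nra].
  eapply Rle_trans; [|eapply (Cseries_bound (fun _ => 0) 0); [|exact HB|]].
  - rewrite Cmod_0; lra.
  - intros n. rewrite Cmod_0. apply Rmult_le_pos; [apply Rmult_le_pos; apply pos_INR|].
    apply Rmult_le_pos; [apply Cmod_ge_0|apply pow_le; lra].
  - apply (Cseries_single (fun _ => RtoC 0)). reflexivity. }
set (Q := (B / (Rr * Rr))%R) in *.
exists (Rmin (Rr - Cmod h) (eps / (Q + 1)))%R.
split; [apply Rmin_glb_lt; [lra|apply Rdiv_lt_0_compat; lra]|].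
intros k Hk.
destruct (Rlt_Rmin _ _ _ Hk) as [K1' K2'].
eapply Rle_trans; [apply Hrem; eapply Rle_trans; [apply Cmod_triangle|]; lra|].
pose proof (Cmod_ge_0 k).
assert (Q * Cmod k <= eps)%R; [|nra].
assert ((Q + 1) * (eps / (Q + 1)) = eps)%R by (field; lra). nra.
Qed.

(** * Local behaviour of analytic functions *)

Definition Ccont (f : C -> C) (z : C) : Prop :=
  forall eps, (0 < eps)%R -> exists d, (0 < d)%R /\ forall h, (Cmod h < d)%R ->
    (Cmod (f (z + h)%C - f z) < eps)%R.

Lemma has_ps_continuous (f : C -> C) z0 a r : has_ps f z0 a r -> Ccont f z0.
Proof.
intros Hf eps He. destruct (has_ps_taylor f z0 a r 0 Hf) as (K & r' & HK & Hr & H).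
exists (Rmin r' (eps / (K + 1)))%R. split; [apply Rmin_glb_lt; [lra|apply Rdiv_lt_0_compat; lra]|].
intros h Hh.
destruct (Rlt_Rmin _ _ _ Hh) as [H1 H2].
specialize (H h H1). rewrite Csum_0 in H. rewrite (has_ps_center f z0 a r Hf) in H.
replace (f z0 * h ^ 0) with (f z0) in H by (cbn; ring).
eapply Rle_lt_trans; [exact H|]. rewrite pow_1. pose proof (Cmod_ge_0 h).
assert ((K + 1) * (eps / (K + 1)) = eps)%R by (field; lra). nra.
Qed.

Lemma analytic_at_mult (f g : C -> C) z0 :
  analytic_at f z0 -> analytic_at g z0 -> analytic_at (fun z => f z * g z) z0.
Proof.
rewrite !analytic_at_iff. intros (a & r & Ha) (b & s & Hb).
pose proof (proj1 Ha). pose proof (proj1 Hb).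
assert (0 < Rmin r s)%R by now apply Rmin_glb_lt.
eexists; exists (Rmin r s). apply has_ps_mult; eapply has_ps_shrink; try eassumption;
  (split; [assumption|]); [apply Rmin_l|apply Rmin_r].
Qed.

Lemma analytic_at_lin (f g : C -> C) z0 c d :
  analytic_at f z0 -> analytic_at g z0 -> analytic_at (fun z => c * f z + d * g z) z0.
Proof.
rewrite !analytic_at_iff. intros (a & r & Ha) (b & s & Hb).
pose proof (proj1 Ha). pose proof (proj1 Hb).
assert (0 < Rmin r s)%R by now apply Rmin_glb_lt.
eexists; exists (Rmin r s). apply has_ps_lin; eapply has_ps_shrink; try eassumption;
  (split; [assumption|]); [apply Rmin_l|apply Rmin_r].
Qed.

Lemma Cseries_finite (u : nat -> C) N : (forall n, (N < n)%nat -> u n = 0) -> Cseries u (Csum u N).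
Proof.
intros H. apply Cseries_eps. intros eps He. exists N. intros n Hn.
replace (Csum u n) with (Csum u N).
- replace (Csum u N - Csum u N) with (RtoC 0) by ring. now rewrite Cmod_0.
- induction Hn as [|n Hn IH]; [reflexivity|]. rewrite Csum_S, H, <- IH by lia. ring.
Qed.

Lemma analytic_at_affine (c d z0 : C) : analytic_at (fun z => c * z + d) z0.
Proof.
apply analytic_at_iff.
exists (fun n => match n with 0%nat => c * z0 + d | 1%nat => c | _ => RtoC 0 end), 1%R.
split; [lra|]. intros h _.
replace (c * (z0 + h) + d) with
  (Csum (fun n => match n with 0%nat => c * z0 + d | 1%nat => c | _ => RtoC 0 end * h ^ n) 1)
  by (rewrite Csum_S, Csum_0; cbn; ring).
apply Cseries_finite. intros [|[|n]] Hn; try lia. ring.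
Qed.

Lemma has_ps_comp_affine (f : C -> C) (c d z0 : C) a r :
  c <> 0 -> has_ps f (c * z0 + d) a r ->
  has_ps (fun z => f (c * z + d)) z0 (fun n => a n * c ^ n) (r / Cmod c).
Proof.
intros Hc [Hr H]. apply Cmod_gt_0 in Hc.
split; [now apply Rdiv_lt_0_compat|]. intros h Hh.
apply (Cseries_ext (fun n => a n * (c * h) ^ n)); [intros n; rewrite Cpow_mult_l; ring|].
replace (c * (z0 + h) + d) with (c * z0 + d + c * h) by ring.
apply H. rewrite Cmod_mult.
apply (Rmult_lt_compat_l (Cmod c)) in Hh; auto.
replace (Cmod c * (r / Cmod c))%R with r in Hh by (field; lra). exact Hh.
Qed.

Lemma first_nonzero (a : nat -> C) :
  (forall n, a n = 0) \/ exists k, a k <> 0 /\ forall j, (j < k)%nat -> a j = 0.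
Proof.
destruct (classic (forall n, a n = 0)) as [H|H]; [now left|right].
apply not_all_ex_not in H. destruct H as [n Hn].
revert Hn. induction n as [n IH] using (well_founded_induction lt_wf). intros Hn.
destruct (classic (exists j, (j < n)%nat /\ a j <> 0)) as [(j & Hj & Hja)|H].
- now apply (IH j).
- exists n. split; auto. intros j Hj. apply NNPP. intros Hja. apply H. now exists j.
Qed.

Lemma has_ps_zero (f : C -> C) z0 a r :
  has_ps f z0 a r -> (forall n, a n = 0) -> forall h, (Cmod h < r)%R -> f (z0 + h) = 0.
Proof.
intros [_ H] Ha h Hh. apply (Cseries_unique (fun n => a n * h ^ n)); auto.
replace (RtoC 0) with (a 0%nat * h ^ 0) by (rewrite Ha; ring).
apply (Cseries_single (fun n => a n * h ^ n)).
intros n. rewrite Ha. ring.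
Qed.

Lemma Csum_zero (u : nat -> C) n : (forall j, (j <= n)%nat -> u j = 0) -> Csum u n = 0.
Proof.
induction n as [|n IH]; intros H; [rewrite Csum_0; apply H; lia|].
rewrite Csum_S, IH, H by (intros; try apply H; lia). ring.
Qed.

(** Zeros of an analytic function are isolated: near a zero of order [k] the
    function is [a_k h^k] up to a term of higher order. *)
Lemma has_ps_isolated_zeros (f : C -> C) z0 a r :
  has_ps f z0 a r ->
  (exists d, (0 < d)%R /\ forall h, (Cmod h < d)%R -> f (z0 + h) = 0) \/
  (exists d, (0 < d)%R /\ forall h : C, h <> 0 -> (Cmod h < d)%R -> f (z0 + h) <> 0).
Proof.
intros Hf. destruct (first_nonzero a) as [Ha|(k & Hk & Hj)].
- left. exists r. split; [apply Hf|]. now apply (has_ps_zero f z0 a).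
- right. destruct (has_ps_taylor f z0 a r k Hf) as (K & r' & HK & Hr & H).
  apply Cmod_gt_0 in Hk.
  exists (Rmin r' (Cmod (a k) / (K + 1)))%R.
  split; [apply Rmin_glb_lt; [lra|apply Rdiv_lt_0_compat; lra]|].
  intros h Hh0 Hh E.
  destruct (Rlt_Rmin _ _ _ Hh) as [H1 H2].
  specialize (H h H1). rewrite E in H.
  replace (Csum (fun n => a n * h ^ n) k) with (a k * h ^ k) in H.
  2:{ destruct k as [|k]; [now rewrite Csum_0|]. rewrite Csum_S.
      rewrite (Csum_zero (fun n => a n * h ^ n)); [ring|]. intros j Hjk. rewrite Hj by lia. ring. }
  replace (0 - a k * h ^ k) with (- (a k * h ^ k)) in H by ring.
  rewrite Cmod_opp, Cmod_mult, Cmod_pow in H. cbn [pow] in H.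
  apply (proj1 (Cmod_gt_0 h)) in Hh0.
  assert (Hp : (0 < Cmod h ^ k)%R) by now apply pow_lt.
  assert (Cmod (a k) <= K * Cmod h)%R by (apply Rmult_le_reg_r with (Cmod h ^ k)%R; lra).
  assert ((K + 1) * (Cmod (a k) / (K + 1)) = Cmod (a k))%R by (field; lra). nra.
Qed.

Lemma cis_plus s t : cis (s + t) = cis s * cis t.
Proof.
unfold cis, Cmult; cbn. rewrite cos_plus, sin_plus. apply f_equal2; ring.
Qed.

Lemma cis_0 : cis 0 = 1.
Proof. unfold cis. now rewrite cos_0, sin_0. Qed.

Lemma cis_pow t n : cis t ^ n = cis (INR n * t).
Proof.
induction n as [|n IH].
- cbn [INR Cpow]. now rewrite Rmult_0_l, cis_0.
- rewrite Cpow_S, IH, S_INR, <- cis_plus. f_equal. ring.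
Qed.

Lemma Cmod_cis t : Cmod (cis t) = 1%R.
Proof.
unfold cis, Cmod; cbn [fst snd]. pose proof (sin2_cos2 t) as H. unfold Rsqr in H.
replace (cos t ^ 2 + sin t ^ 2)%R with 1%R by (cbn; lra). apply sqrt_1.
Qed.

Lemma unit_is_cis (c : C) : Cmod c = 1%R -> exists t, c = cis t.
Proof.
intros H. destruct c as [x y].
assert (E : (x * x + y * y = 1)%R).
{ pose proof (Cmod2_alt (x, y)) as E. rewrite H in E. unfold Re, Im in E; cbn in E. lra. }
assert (Hx : (-1 <= x <= 1)%R) by nra.
assert (Hs : (sin (acos x) = Rabs y)%R).
{ rewrite sin_acos by lra. replace (1 - x²)%R with (y²)%R by (unfold Rsqr; lra). apply sqrt_Rsqr_abs. }
destruct (Rle_dec 0 y) as [Hy|Hy].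
- exists (acos x). unfold cis. rewrite cos_acos, Hs, Rabs_pos_eq; auto.
- exists (- acos x)%R. unfold cis. rewrite cos_neg, sin_neg, cos_acos, Hs, Rabs_left by lra.
  now rewrite Ropp_involutive.
Qed.

Lemma unit_root (c : C) k : Cmod c = 1%R -> exists e, Cmod e = 1%R /\ e ^ S k = c.
Proof.
intros H. destruct (unit_is_cis c H) as [t ->]. exists (cis (t / INR (S k))).
split; [apply Cmod_cis|]. rewrite cis_pow. f_equal. field. apply not_0_INR. lia.
Qed.

(** The maximum principle.  If [a_k h^k] is the first nonconstant term, then
    moving in a direction that rotates it onto [f z0] increases the modulus. *)
Lemma max_principle (f : C -> C) z0 a r :
  has_ps f z0 a r ->
  (exists d, (0 < d)%R /\ forall h, (Cmod h < d)%R -> (Cmod (f (z0 + h)%C) <= Cmod (f z0))%R) ->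
  exists d, (0 < d)%R /\ forall h, (Cmod h < d)%R -> f (z0 + h) = f z0.
Proof.
intros Hf (d & Hd & Hmax).
destruct (Ceq_dec (f z0) 0) as [E|E].
{ exists d. split; auto. intros h Hh. rewrite E. apply Cmod_eq_0.
  specialize (Hmax h Hh). rewrite E, Cmod_0 in Hmax. pose proof (Cmod_ge_0 (f (z0 + h))). lra. }
pose proof (has_ps_center f z0 a r Hf) as Hc.
destruct (first_nonzero (fun n => a (S n))) as [Ha|(k & Hk & Hj)].
- exists r. split; [apply Hf|]. intros h Hh.
  apply (Cseries_unique (fun n => a n * h ^ n)); [now apply Hf|].
  replace (f z0) with (a 0%nat * h ^ 0) by (rewrite Hc; cbn; ring).
  apply (Cseries_single (fun n => a n * h ^ n)). intros n. rewrite Ha. ring.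
- exfalso. destruct (has_ps_taylor f z0 a r (S k) Hf) as (K & r' & HK & Hr & H).
  assert (E' := proj1 (Cmod_gt_0 _) E). assert (Hk' := proj1 (Cmod_gt_0 _) Hk).
  assert (EC : RtoC (Cmod (f z0)) <> 0) by (intros X; apply RtoC_inj in X; lra).
  assert (Hu : Cmod (f z0 / RtoC (Cmod (f z0)) * (RtoC (Cmod (a (S k))) / a (S k))) = 1%R).
  { rewrite Cmod_mult, !Cmod_div, !Cmod_R, !Rabs_pos_eq by (auto; lra). field. lra. }
  destruct (unit_root _ k Hu) as (e & He1 & He).
  set (t := (Rmin (Rmin d r') (Cmod (a (S k)) / (K + 1)) / 2)%R).
  assert (Hm : (0 < Rmin (Rmin d r') (Cmod (a (S k)) / (K + 1)))%R).
  { repeat apply Rmin_glb_lt; try lra. apply Rdiv_lt_0_compat; lra. }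
  assert (Ht : (0 < t)%R) by (unfold t; lra).
  pose proof (Rmin_l (Rmin d r') (Cmod (a (S k)) / (K + 1))).
  pose proof (Rmin_r (Rmin d r') (Cmod (a (S k)) / (K + 1))).
  pose proof (Rmin_l d r'). pose proof (Rmin_r d r').
  assert (Hth : Cmod (RtoC t * e) = t) by (rewrite Cmod_mult, He1, Cmod_R, Rabs_pos_eq; lra).
  specialize (Hmax (RtoC t * e)). specialize (H (RtoC t * e)). rewrite Hth in Hmax, H.
  specialize (Hmax ltac:(unfold t in *; lra)). specialize (H ltac:(unfold t in *; lra)).
  replace (Csum (fun n => a n * (RtoC t * e) ^ n) (S k))
    with (f z0 / RtoC (Cmod (f z0)) * RtoC (Cmod (f z0) + Cmod (a (S k)) * t ^ S k)) in H.
  2:{ rewrite Csum_S, Cpow_mult_l, He, RtoC_plus, RtoC_mult, RtoC_pow.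
      replace (Csum (fun n => a n * (RtoC t * e) ^ n) k) with (f z0).
      - field. split; auto.
      - destruct k as [|k]; [rewrite Csum_0, Hc; cbn; ring|].
        clear - Hj Hc. set (u := fun n => a n * (RtoC t * e) ^ n).
        assert (Hn : forall n, (n <= S k)%nat -> Csum u n = u 0%nat).
        { induction n as [|n IH]; intros Hn; [apply Csum_0|].
          rewrite Csum_S, IH by lia. unfold u at 2. rewrite Hj by lia. ring. }
        rewrite Hn by lia. unfold u. rewrite Hc. cbn; ring. }
  set (v := f z0 / RtoC (Cmod (f z0)) * RtoC (Cmod (f z0) + Cmod (a (S k)) * t ^ S k)) in *.
  assert (Hp : (0 < t ^ S k)%R) by now apply pow_lt.
  assert (Hv : Cmod v = (Cmod (f z0) + Cmod (a (S k)) * t ^ S k)%R).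
  { unfold v. rewrite Cmod_mult, Cmod_div, !Cmod_R by auto.
    rewrite (Rabs_pos_eq (Cmod (f z0))) by lra. rewrite Rabs_pos_eq by nra. field. lra. }
  assert (T : (Cmod v <= Cmod (f (z0 + RtoC t * e)%C) + Cmod (f (z0 + RtoC t * e)%C - v))%R).
  { replace v with (f (z0 + RtoC t * e) - (f (z0 + RtoC t * e) - v)) at 1 by ring.
    eapply Rle_trans; [apply Cmod_triangle|]. rewrite Cmod_opp. lra. }
  rewrite Hv in T. change (t ^ S (S k))%R with (t * t ^ S k)%R in H.
  assert (Cmod (a (S k)) <= K * t)%R by (apply Rmult_le_reg_r with (t ^ S k)%R; lra).
  assert ((K + 1) * (Cmod (a (S k)) / (K + 1)) = Cmod (a (S k)))%R by (field; lra).
  assert (t < Cmod (a (S k)) / (K + 1))%R by (unfold t in *; lra). nra.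
Qed.

(** * Differentiation along paths *)

Definition pder (g : R -> C) (s : R) (l : C) : Prop :=
  is_derive (fun t => Re (g t)) s (Re l) /\ is_derive (fun t => Im (g t)) s (Im l).

Lemma pder_ext (g g' : R -> C) s l : (forall t, g t = g' t) -> pder g s l -> pder g' s l.
Proof.
intros H [H1 H2]. split; [eapply is_derive_ext; [|exact H1]|eapply is_derive_ext; [|exact H2]];
  intros t; cbv beta; now rewrite H.
Qed.

Lemma pder_ext_loc (g g' : R -> C) s l :
  locally s (fun t => g t = g' t) -> pder g s l -> pder g' s l.
Proof.
intros H [H1 H2]. split; [eapply is_derive_ext_loc; [|exact H1]|eapply is_derive_ext_loc; [|exact H2]];
  (eapply filter_imp; [|exact H]); intros t Ht; cbv beta; now rewrite Ht.
Qed.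

Lemma is_derive_eq (f : R -> R) (x l m : R) : is_derive f x l -> l = m -> is_derive f x m.
Proof. now intros H <-. Qed.

Lemma pder_const (c : C) s : pder (fun _ => c) s 0.
Proof. split; apply (is_derive_const (V := R_NormedModule)). Qed.

Lemma pder_affine (a b : C) s : pder (fun t => a + RtoC t * b) s b.
Proof.
destruct a as [x y], b as [x' y']. split; cbn [Re Im Cplus Cmult RtoC fst snd];
  unfold Re, Im; cbn; auto_derive; auto; ring.
Qed.

Lemma pder_mult (g g' : R -> C) s l l' :
  pder g s l -> pder g' s l' -> pder (fun t => g t * g' t) s (l * g' s + g s * l').
Proof.
intros [H1 H2] [H3 H4]. split.
- eapply is_derive_eq.
  + apply (is_derive_ext (fun t => minus (mult (Re (g t)) (Re (g' t))) (mult (Im (g t)) (Im (g' t))))).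
    * intros t. symmetry. apply re_mult.
    * apply (is_derive_minus (V := R_NormedModule)).
      -- apply (is_derive_mult (K := R_AbsRing)); [exact H1|exact H3|exact Rmult_comm].
      -- apply (is_derive_mult (K := R_AbsRing)); [exact H2|exact H4|exact Rmult_comm].
  + rewrite re_plus, !re_mult. unfold minus, plus, mult, opp; cbn. ring.
- eapply is_derive_eq.
  + apply (is_derive_ext (fun t => plus (mult (Re (g t)) (Im (g' t))) (mult (Im (g t)) (Re (g' t))))).
    * intros t. symmetry. apply im_mult.
    * apply (is_derive_plus (V := R_NormedModule)).
      -- apply (is_derive_mult (K := R_AbsRing)); [exact H1|exact H4|exact Rmult_comm].
      -- apply (is_derive_mult (K := R_AbsRing)); [exact H2|exact H3|exact Rmult_comm].
  + rewrite im_plus, !im_mult. unfold minus, plus, mult, opp; cbn. ring.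
Qed.

Lemma pder_eq (g : R -> C) s l l' : pder g s l -> l = l' -> pder g s l'.
Proof. now intros H <-. Qed.

Lemma pder_plus (g g' : R -> C) s l l' :
  pder g s l -> pder g' s l' -> pder (fun t => g t + g' t) s (l + l').
Proof.
intros [H1 H2] [H3 H4]. split.
- eapply is_derive_eq.
  + apply (is_derive_ext (fun t => plus (Re (g t)) (Re (g' t)))).
    * intros t. symmetry. apply re_plus.
    * apply (is_derive_plus (V := R_NormedModule)); [exact H1|exact H3].
  + rewrite re_plus. reflexivity.
- eapply is_derive_eq.
  + apply (is_derive_ext (fun t => plus (Im (g t)) (Im (g' t)))).
    * intros t. symmetry. apply im_plus.
    * apply (is_derive_plus (V := R_NormedModule)); [exact H2|exact H4].
  + rewrite im_plus. reflexivity.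
Qed.

Lemma pder_scal (c : C) (g : R -> C) s l : pder g s l -> pder (fun t => c * g t) s (c * l).
Proof.
intros H. eapply pder_eq; [apply (pder_mult (fun _ => c) g); [apply pder_const|exact H]|]. ring.
Qed.

Lemma pder_minus (g g' : R -> C) s l l' :
  pder g s l -> pder g' s l' -> pder (fun t => g t - g' t) s (l - l').
Proof.
intros H H'. eapply pder_eq.
- apply (pder_ext (fun t => g t + (-1) * g' t)); [intros; ring|].
  apply pder_plus; [exact H|]. apply pder_scal; exact H'.
- ring.
Qed.

Lemma pder_pow (g : R -> C) s l n :
  pder g s l -> pder (fun t => g t ^ n) s (RtoC (INR n) * g s ^ (pred n) * l).
Proof.
intros H. induction n as [|n IH].
- eapply pder_eq; [apply (pder_ext (fun _ => RtoC 1)); [reflexivity|apply pder_const]|]. cbn. ring.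
- eapply pder_eq; [apply (pder_mult g (fun t => g t ^ n)); [exact H|exact IH]|].
  rewrite S_INR, RtoC_plus. destruct n as [|n]; cbn [pred Cpow INR]; ring.
Qed.

Lemma pder_eps (g : R -> C) s l :
  pder g s l <->
  forall eps, (0 < eps)%R -> exists d, (0 < d)%R /\ forall h : R, (Rabs h < d)%R ->
    (Cmod (g (s + h)%R - g s - l * RtoC h) <= eps * Rabs h)%R.
Proof.
assert (HR : forall (f : R -> R) x m, is_derive f x m <->
  forall eps, (0 < eps)%R -> exists d, (0 < d)%R /\ forall h : R, (Rabs h < d)%R ->
    (Rabs (f (x + h) - f x - m * h) <= eps * Rabs h)%R).
{ intros f x m. rewrite is_derive_Reals. split.
  - intros H eps He. destruct (H eps He) as [d Hd]. exists d. split; [apply cond_pos|].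
    intros h Hh. destruct (Req_dec h 0) as [->|Hh0].
    + rewrite Rplus_0_r. replace (f x - f x - m * 0)%R with 0%R by ring. rewrite Rabs_R0. lra.
    + specialize (Hd h Hh0 Hh).
      replace (f (x + h) - f x - m * h)%R with (((f (x + h) - f x) / h - m) * h)%R by now field.
      rewrite Rabs_mult. apply Rmult_le_compat_r; [apply Rabs_pos|lra].
  - intros H eps He. destruct (H (eps / 2)%R) as (d & Hd & A); [lra|].
    exists (mkposreal d Hd). intros h Hh0 Hh. specialize (A h Hh).
    replace ((f (x + h) - f x) / h - m)%R with ((f (x + h) - f x - m * h) / h)%R by now field.
    unfold Rdiv at 1. rewrite Rabs_mult, Rabs_inv.
    assert (Hp : (0 < Rabs h)%R) by now apply Rabs_pos_lt.
    apply Rmult_lt_reg_r with (Rabs h); auto. rewrite Rmult_assoc, Rinv_l by lra. nra. }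
unfold pder. rewrite !HR. clear HR. split.
- intros [H1 H2] eps He.
  destruct (H1 (eps / 2)%R) as (d & Hd & A); [lra|].
  destruct (H2 (eps / 2)%R) as (d' & Hd' & A'); [lra|].
  exists (Rmin d d'). split; [now apply Rmin_glb_lt|]. intros h Hh.
  specialize (A h ltac:(eapply Rlt_le_trans; [exact Hh|apply Rmin_l])).
  specialize (A' h ltac:(eapply Rlt_le_trans; [exact Hh|apply Rmin_r])).
  eapply Rle_trans; [apply Cmod_le_Re_Im|].
  unfold Cminus. rewrite !re_plus, !im_plus, !re_opp, !im_opp, re_scal_r, im_scal_r.
  unfold Rminus in *. lra.
- intros H. split; intros eps He; destruct (H eps He) as (d & Hd & A); exists d; split; auto;
    intros h Hh; (eapply Rle_trans; [|apply (A h Hh)]).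
  + pose proof (re_le_Cmod (g (s + h)%R - g s - l * RtoC h)) as Hr.
    unfold Cminus in *. rewrite !re_plus, !re_opp, re_scal_r in Hr. exact Hr.
  + pose proof (Im_le_Cmod (g (s + h)%R - g s - l * RtoC h)) as Hr.
    unfold Cminus in *. rewrite !im_plus, !im_opp, im_scal_r in Hr. exact Hr.
Qed.

Lemma pder_comp (f : C -> C) (g : R -> C) s l m :
  Cder f (g s) l -> pder g s m -> pder (fun t => f (g t)) s (l * m).
Proof.
rewrite !pder_eps. intros Hf Hg eps He.
set (A := (Cmod m + 1)%R). assert (HA : (0 < A)%R) by (unfold A; pose proof (Cmod_ge_0 m); lra).
set (B := (Cmod l + 1)%R). assert (HB : (0 < B)%R) by (unfold B; pose proof (Cmod_ge_0 l); lra).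
destruct (Hf (eps / 2 / A)%R) as (d & Hd & H1); [apply Rdiv_lt_0_compat; lra|].
destruct (Hg (Rmin 1 (eps / 2 / B))%R) as (d' & Hd' & H2);
  [apply Rmin_glb_lt; [lra|apply Rdiv_lt_0_compat; lra]|].
exists (Rmin d' (d / A))%R. split; [apply Rmin_glb_lt; auto; now apply Rdiv_lt_0_compat|].
intros h Hh. pose proof (Rabs_pos h).
destruct (Rlt_Rmin _ _ _ Hh) as [K1 K2].
specialize (H2 h K1). pose proof (Rmin_l 1 (eps / 2 / B)). pose proof (Rmin_r 1 (eps / 2 / B)).
set (k := g (s + h)%R - g s).
assert (Hk : (Cmod k <= A * Rabs h)%R).
{ replace k with ((k - m * RtoC h) + m * RtoC h) by ring.
  eapply Rle_trans; [apply Cmod_triangle|]. rewrite Cmod_mult, Cmod_R. fold k in H2. unfold A.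
  assert (Rmin 1 (eps / 2 / B) * Rabs h <= 1 * Rabs h)%R by (apply Rmult_le_compat_r; lra). lra. }
assert (Hkd : (Cmod k < d)%R).
{ eapply Rle_lt_trans; [exact Hk|]. apply (Rmult_lt_compat_l A) in K2; auto.
  replace (A * (d / A))%R with d in K2 by (field; lra). lra. }
specialize (H1 k Hkd). replace (g s + k) with (g (s + h)%R) in H1 by (unfold k; ring).
replace (f (g (s + h)%R) - f (g s) - l * m * RtoC h)
  with ((f (g (s + h)%R) - f (g s) - l * k) + l * (k - m * RtoC h)) by ring.
eapply Rle_trans; [apply Cmod_triangle|]. rewrite (Cmod_mult l). fold k in H2.
assert (E1 : (eps / 2 / A * Cmod k <= eps / 2 * Rabs h)%R).
{ replace (eps / 2 * Rabs h)%R with (eps / 2 / A * (A * Rabs h))%R by (field; lra).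
  apply Rmult_le_compat_l; auto. apply Rlt_le, Rdiv_lt_0_compat; lra. }
assert (E2 : (Cmod l * Cmod (k - m * RtoC h) <= eps / 2 * Rabs h)%R).
{ apply Rle_trans with (B * (eps / 2 / B * Rabs h))%R.
  - apply Rmult_le_compat; [apply Cmod_ge_0|apply Cmod_ge_0|unfold B; lra|].
    eapply Rle_trans; [exact H2|]. apply Rmult_le_compat_r; lra.
  - apply Req_le. field. lra. }
lra.
Qed.

Lemma Cder_inv (z : C) : z <> 0 -> Cder Cinv z (- / (z * z)).
Proof.
intros Hz eps He. assert (Hp := proj1 (Cmod_gt_0 _) Hz).
set (m := Cmod z) in *.
exists (Rmin (m / 2) (eps * (m * m * m) / 2))%R.
assert (Hm3 : (0 < m * m * m)%R) by (repeat apply Rmult_lt_0_compat; auto).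
split; [apply Rmin_glb_lt; nra|].
intros h Hh.
destruct (Rlt_Rmin _ _ _ Hh) as [K1 K2].
assert (Hzh : (m / 2 <= Cmod (z + h))%R).
{ replace z with ((z + h) - h) in Hp at 1 by ring.
  assert (m <= Cmod (z + h) + Cmod h)%R; [|lra].
  unfold m. replace z with ((z + h) - h) at 1 by ring.
  eapply Rle_trans; [apply Cmod_triangle|]. rewrite Cmod_opp. lra. }
assert (Hzh0 : z + h <> 0) by (apply Cmod_gt_0; lra).
replace (/ (z + h) - / z - - / (z * z) * h) with (h * h / ((z + h) * (z * z))) by (field; auto).
rewrite Cmod_div by (repeat apply Cmult_neq_0; auto). rewrite !Cmod_mult. fold m.
pose proof (Cmod_ge_0 h).
apply Rmult_le_reg_r with (Cmod (z + h) * (m * m))%R; [nra|].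
unfold Rdiv. rewrite Rmult_assoc, Rinv_l by nra.
apply Rle_trans with (eps * Cmod h * (m / 2 * (m * m)))%R.
- replace (eps * Cmod h * (m / 2 * (m * m)))%R with (eps * (m * m * m) / 2 * Cmod h)%R by field.
  rewrite Rmult_1_r. apply Rmult_le_compat_r; lra.
- apply Rmult_le_compat_l; [nra|]. apply Rmult_le_compat_r; nra.
Qed.

Lemma pder_inv (g : R -> C) s l :
  g s <> 0 -> pder g s l -> pder (fun t => / g t) s (- / (g s * g s) * l).
Proof. intros H Hg. now apply pder_comp; [apply Cder_inv|]. Qed.

Lemma pder_zero_const (g : R -> C) :
  (forall t, (0 <= t <= 1)%R -> pder g t 0) -> g 1%R = g 0%R.
Proof.
intros H.
assert (HR : forall f : R -> R, (forall t, (0 <= t <= 1)%R -> is_derive f t 0%R) -> f 1%R = f 0%R).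
{ intros f Hf. destruct (MVT_gen f 0 1 (fun _ => 0%R)) as (c & _ & E).
  - intros x Hx. rewrite Rmin_left, Rmax_right in Hx by lra. apply Hf. lra.
  - intros x Hx. rewrite Rmin_left, Rmax_right in Hx by lra.
    apply continuity_pt_filterlim, (ex_derive_continuous (V := R_NormedModule)). exists 0%R. apply Hf. lra.
  - lra. }
assert (E1 := HR (fun t => Re (g t)) (fun t Ht => proj1 (H t Ht))).
assert (E2 := HR (fun t => Im (g t)) (fun t Ht => proj2 (H t Ht))).
cbv beta in E1, E2. destruct (g 1%R), (g 0%R). cbn in *. congruence.
Qed.

Lemma pder_unique (g : R -> C) s l l' : pder g s l -> pder g s l' -> l = l'.
Proof.
intros [H1 H2] [H3 H4]. apply is_derive_unique in H1, H2, H3, H4.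
destruct l, l'. cbn in *. congruence.
Qed.

(** * The hexagonal lattice *)

Definition hexpt (m n : Z) : C :=
  ((sqrt 3 / 2 * (IZR m + IZR n))%R, ((IZR m - IZR n) / 2)%R).

Lemma hex_lattice_iff w : hex_lattice w <-> exists m n, w = hexpt m n.
Proof.
assert (H : forall m n, RtoC (IZR m) * cis (PI / 6) + RtoC (IZR n) * cis (- (PI / 6)) = hexpt m n).
{ intros m n. unfold cis, hexpt, RtoC, Cmult, Cplus; cbn [fst snd].
  rewrite cos_neg, sin_neg, cos_PI6, sin_PI6. apply f_equal2; field. }
unfold hex_lattice. split; intros (m & n & ->); exists m, n; rewrite H; reflexivity.
Qed.

Lemma sqrt3_sq : (sqrt 3 * sqrt 3 = 3)%R.
Proof. apply sqrt_sqrt. lra. Qed.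

Lemma sqrt3_pos : (0 < sqrt 3)%R.
Proof. apply sqrt_lt_R0. lra. Qed.

Lemma hex_lattice_0 : hex_lattice 0.
Proof.
apply hex_lattice_iff. exists 0%Z, 0%Z. unfold hexpt, RtoC. apply f_equal2; field.
Qed.

Lemma hex_lattice_plus v w : hex_lattice v -> hex_lattice w -> hex_lattice (v + w).
Proof.
rewrite !hex_lattice_iff. intros (m & n & ->) (m' & n' & ->).
exists (m + m')%Z, (n + n')%Z. unfold hexpt, Cplus; cbn [fst snd]. rewrite !plus_IZR.
apply f_equal2; field.
Qed.

Lemma hex_lattice_opp w : hex_lattice w -> hex_lattice (- w).
Proof.
rewrite !hex_lattice_iff. intros (m & n & ->).
exists (- m)%Z, (- n)%Z. unfold hexpt, Copp; cbn [fst snd]. rewrite !opp_IZR.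
apply f_equal2; field.
Qed.

Lemma hex_lattice_minus v w : hex_lattice v -> hex_lattice w -> hex_lattice (v - w).
Proof. intros Hv Hw. apply hex_lattice_plus; auto. now apply hex_lattice_opp. Qed.

Lemma hex_lattice_conj w : hex_lattice w -> hex_lattice (Cconj w).
Proof.
rewrite !hex_lattice_iff. intros (m & n & ->).
exists n, m. unfold hexpt, Cconj; cbn [fst snd]. apply f_equal2; field.
Qed.

Definition zeta6 : C := (1 / 2, sqrt 3 / 2)%R.

Lemma zeta6_lattice w : hex_lattice w -> hex_lattice (zeta6 * w).
Proof.
rewrite !hex_lattice_iff. intros (m & n & ->).
exists (m + n)%Z, (- m)%Z. unfold hexpt, zeta6, Cmult; cbn [fst snd].
rewrite opp_IZR, plus_IZR. apply f_equal2; [field|].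
replace (1 / 2 * ((IZR m - IZR n) / 2) + sqrt 3 / 2 * (sqrt 3 / 2 * (IZR m + IZR n)))%R
  with ((IZR m - IZR n) / 4 + sqrt 3 * sqrt 3 * (IZR m + IZR n) / 4)%R by field.
rewrite sqrt3_sq. field.
Qed.

Lemma zeta6_sq : zeta6 * zeta6 = zeta6 - 1.
Proof.
unfold zeta6, Cmult, Cminus, Cplus, Copp, RtoC; cbn [fst snd]. pose proof sqrt3_sq.
apply f_equal2; nra.
Qed.

Lemma zeta6_inv : zeta6 * (1 - zeta6) = 1.
Proof. replace (zeta6 * (1 - zeta6)) with (zeta6 - zeta6 * zeta6) by ring. rewrite zeta6_sq. ring. Qed.

Lemma zeta6_inv_lattice w : hex_lattice w -> hex_lattice ((1 - zeta6) * w).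
Proof.
intros H. replace ((1 - zeta6) * w) with (w - zeta6 * w) by ring.
apply hex_lattice_minus; auto. now apply zeta6_lattice.
Qed.

Lemma zeta6_nz : zeta6 <> 0.
Proof. intros E. pose proof zeta6_inv as H. rewrite E in H. apply C1_nz. rewrite <- H. ring. Qed.

Lemma hexpt_norm m n : (Cmod (hexpt m n) ^ 2 = IZR (m * m + m * n + n * n))%R.
Proof.
rewrite Cmod2_alt. unfold hexpt, Re, Im; cbn [fst snd].
rewrite !plus_IZR, !mult_IZR.
replace ((sqrt 3 / 2 * (IZR m + IZR n)) ^ 2)%R
  with (sqrt 3 * sqrt 3 * ((IZR m + IZR n) * (IZR m + IZR n)) / 4)%R by field.
rewrite sqrt3_sq. field.
Qed.

Lemma hex_lattice_norm_ge_1 w : hex_lattice w -> w <> 0 -> (1 <= Cmod w)%R.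
Proof.
rewrite hex_lattice_iff. intros (m & n & ->) H0.
assert (H : (0 < m * m + m * n + n * n)%Z).
{ destruct (Z.eq_dec m 0) as [->|Hm]; [destruct (Z.eq_dec n 0) as [->|Hn]|]; try nia.
  exfalso. apply H0. unfold hexpt, RtoC. apply f_equal2; field. }
assert (H1 : (1 <= Cmod (hexpt m n) ^ 2)%R).
{ rewrite hexpt_norm. apply (IZR_le 1). lia. }
pose proof (Cmod_ge_0 (hexpt m n)). nra.
Qed.

(** A weight of order [x^(-3/2)] whose sums telescope; [|w|^-3] is dominated by the
    product of the weights of the two coordinates of [w]. *)
Definition weight (x : R) : R := (/ sqrt (x + 1) - / sqrt (x + 2))%R.

Lemma weight_lower x : (0 <= x)%R -> (/ (2 * ((x + 2) * sqrt (x + 2))) <= weight x)%R.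
Proof.
intros Hx. unfold weight.
assert (H1 : (0 < sqrt (x + 1))%R) by (apply sqrt_lt_R0; lra).
assert (H2 : (sqrt (x + 1) <= sqrt (x + 2))%R) by (apply sqrt_le_1; lra).
assert (E1 : (sqrt (x + 1) * sqrt (x + 1) = x + 1)%R) by (apply sqrt_sqrt; lra).
assert (E2 : (sqrt (x + 2) * sqrt (x + 2) = x + 2)%R) by (apply sqrt_sqrt; lra).
set (a := sqrt (x + 1)) in *. set (b := sqrt (x + 2)) in *.
rewrite <- E2.
replace (/ a - / b)%R with (/ (a * b * (a + b)))%R.
- apply Rinv_le_contravar; [apply Rmult_lt_0_compat; nra|]. 
  assert (a * b * (a + b) <= (b * b) * (b + b))%R; [apply Rmult_le_compat; nra|nra].
- replace (/ a - / b)%R with ((b * b - a * a) / (a * b * (a + b)))%R by (field; lra).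
  replace (b * b - a * a)%R with 1%R by lra. field. nra.
Qed.

Lemma weight_sum N : (sum_n (fun k => weight (INR k)) N <= 1)%R.
Proof.
assert (H : sum_n (fun k => weight (INR k)) N = (1 - / sqrt (INR N + 2))%R :> R).
{ induction N as [|N IH].
  - rewrite sum_n_R_0. unfold weight. cbn [INR]. rewrite Rplus_0_l, sqrt_1. field.
    apply Rgt_not_eq. apply sqrt_lt_R0. lra.
  - rewrite sum_n_R_S, IH, S_INR. unfold weight.
    replace (INR N + 1 + 1)%R with (INR N + 2)%R by ring. ring. }
rewrite H. assert (0 < / sqrt (INR N + 2))%R; [|lra].
apply Rinv_0_lt_compat, sqrt_lt_R0. pose proof (pos_INR N). lra.
Qed.

Definition hex_weight (w : C) : R :=
  (weight (Rabs (Re w / sqrt 3 + Im w)) * weight (Rabs (Re w / sqrt 3 - Im w)))%R.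

Lemma hex_weight_hexpt m n :
  hex_weight (hexpt m n) = (weight (Rabs (IZR m)) * weight (Rabs (IZR n)))%R.
Proof.
unfold hex_weight, hexpt, Re, Im; cbn [fst snd]. pose proof sqrt3_pos.
f_equal; f_equal; f_equal; field; lra.
Qed.

Lemma weight_nonneg x : (0 <= x)%R -> (0 <= weight x)%R.
Proof.
intros H. eapply Rle_trans; [|now apply weight_lower].
left. apply Rinv_0_lt_compat. assert (0 < sqrt (x + 2))%R by (apply sqrt_lt_R0; lra). nra.
Qed.

Lemma inv_cube_le_weight w :
  hex_lattice w -> w <> 0 -> (/ Cmod w ^ 3 <= 500 * hex_weight w)%R.
Proof.
intros Hw H0. pose proof (hex_lattice_norm_ge_1 w Hw H0) as H1.
apply hex_lattice_iff in Hw. destruct Hw as (m & n & ->).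
pose proof (hexpt_norm m n) as E. rewrite hex_weight_hexpt.
rewrite !plus_IZR, !mult_IZR in E.
set (x := Rabs (IZR m)). set (y := Rabs (IZR n)). set (r := Cmod (hexpt m n)) in *.
assert (Hx : (0 <= x)%R) by apply Rabs_pos. assert (Hy : (0 <= y)%R) by apply Rabs_pos.
assert (Ex : (x * x = IZR m * IZR m)%R) by (unfold x; rewrite <- Rabs_mult; apply Rabs_pos_eq; nra).
assert (Ey : (y * y = IZR n * IZR n)%R) by (unfold y; rewrite <- Rabs_mult; apply Rabs_pos_eq; nra).
pose proof (weight_lower x Hx) as Wx. pose proof (weight_lower y Hy) as Wy.
assert (Sx : (0 < sqrt (x + 2))%R) by (apply sqrt_lt_R0; lra).
assert (Sy : (0 < sqrt (y + 2))%R) by (apply sqrt_lt_R0; lra).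
assert (Fx : (sqrt (x + 2) * sqrt (x + 2) = x + 2)%R) by (apply sqrt_sqrt; lra).
assert (Fy : (sqrt (y + 2) * sqrt (y + 2) = y + 2)%R) by (apply sqrt_sqrt; lra).
set (a := sqrt (x + 2)) in *. set (b := sqrt (y + 2)) in *.
(* [500 = 4 * 5 ^ 3]: the two lower bounds for the weights contribute [4]. *)
assert (Hq : (a * b <= 5 * r)%R).
{ assert (Hab : ((a * b) * (a * b) <= 25 * (r * r))%R).
  { replace ((a * b) * (a * b))%R with ((a * a) * (b * b))%R by ring. rewrite Fx, Fy.
    assert (x * x + y * y <= 2 * (r * r))%R by (pose proof (pow2_ge_0 (IZR m + IZR n)); nra).
    assert (1 <= r * r)%R by nra.
    pose proof (pow2_ge_0 (x - y)). pose proof (pow2_ge_0 (x - 2)). pose proof (pow2_ge_0 (y - 2)). nra. }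
  assert (0 < a * b)%R by nra. nra. }
apply Rle_trans with (500 * (/ (2 * ((x + 2) * a)) * / (2 * ((y + 2) * b))))%R.
2:{ apply Rmult_le_compat_l; [lra|].
    apply Rmult_le_compat; auto; left; apply Rinv_0_lt_compat; nra. }
rewrite <- Fx, <- Fy.
replace (500 * (/ (2 * (a * a * a)) * / (2 * (b * b * b))))%R with (/ ((a * b) ^ 3 / 125))%R
  by (field; lra).
assert (0 < a * b)%R by nra.
assert (0 < (a * b) ^ 3)%R by now apply pow_lt.
apply Rinv_le_contravar; [lra|].
assert ((a * b) ^ 3 <= (5 * r) ^ 3)%R by (apply pow_incr; lra).
replace ((5 * r) ^ 3)%R with (125 * r ^ 3)%R in * by ring. lra.
Qed.

Fixpoint Zsum (f : Z -> R) (l : list Z) : R :=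
  match l with nil => 0%R | m :: l => (f m + Zsum f l)%R end.

Lemma Zsum_app f l l' : Zsum f (l ++ l') = (Zsum f l + Zsum f l')%R.
Proof. induction l as [|m l IH]; cbn; [|rewrite IH]; ring. Qed.

Definition box (N : nat) : list Z :=
  map Z.of_nat (seq 0 (S N)) ++ map (fun k => (- Z.of_nat k)%Z) (seq 0 (S N)).

Lemma box_In N m : (Z.abs m <= Z.of_nat N)%Z -> In m (box N).
Proof.
intros H. apply in_app_iff. destruct (Z_le_gt_dec 0 m) as [Hm|Hm].
- left. apply in_map_iff. exists (Z.to_nat m). split; [lia|]. apply in_seq. lia.
- right. apply in_map_iff. exists (Z.to_nat (- m)). split; [lia|]. apply in_seq. lia.
Qed.

Lemma box_weight N : (0 <= Zsum (fun m => weight (Rabs (IZR m))) (box N) <= 2)%R.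
Proof.
assert (H : forall f : nat -> Z, (forall k, Rabs (IZR (f k)) = INR k) -> forall M,
  Zsum (fun m => weight (Rabs (IZR m))) (map f (seq 0 (S M))) = sum_n (fun k => weight (INR k)) M :> R).
{ intros f Hf. induction M as [|M IH].
  - cbn [seq map Zsum]. rewrite Hf, sum_n_R_0. ring.
  - rewrite seq_S, map_app, Zsum_app, IH, sum_n_R_S. cbn [map Zsum].
    rewrite Hf. cbn [Nat.add]. ring. }
unfold box. rewrite Zsum_app, !H.
- pose proof (weight_sum N). split; [|lra].
  assert (0 <= sum_n (fun k => weight (INR k)) N)%R; [|lra].
  induction N as [|N IH]; [rewrite sum_n_R_0; apply weight_nonneg, pos_INR|].
  rewrite sum_n_R_S. pose proof (weight_nonneg (INR (S N)) (pos_INR _)).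
  pose proof (weight_sum N). specialize (IH ltac:(lra)). lra.
- intros k. rewrite opp_IZR, Rabs_Ropp, <- INR_IZR_INZ. apply Rabs_pos_eq, pos_INR.
- intros k. rewrite <- INR_IZR_INZ. apply Rabs_pos_eq, pos_INR.
Qed.

Definition hexbox (N : nat) : list C := flat_map (fun m => map (hexpt m) (box N)) (box N).

Lemma hexbox_weight N : (Rsum hex_weight (hexbox N) <= 4)%R.
Proof.
assert (H : forall L L', Rsum hex_weight (flat_map (fun m => map (hexpt m) L') L)
  = (Zsum (fun m => weight (Rabs (IZR m))) L * Zsum (fun m => weight (Rabs (IZR m))) L')%R).
{ intros L L'. induction L as [|m L IH]; [cbn; ring|].
  cbn [flat_map Zsum]. rewrite Rsum_app, IH.
  assert (E : Rsum hex_weight (map (hexpt m) L')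
    = (weight (Rabs (IZR m)) * Zsum (fun m => weight (Rabs (IZR m))) L')%R).
  { clear IH. induction L' as [|n L' IH]; [cbn; ring|].
    cbn [map Rsum Zsum]. rewrite IH, hex_weight_hexpt. ring. }
  rewrite E. ring. }
unfold hexbox. rewrite H. pose proof (box_weight N). nra.
Qed.

Definition hex_star (w : C) : Prop := hex_lattice w /\ w <> RtoC 0.

Lemma hex_inv_cube_bounded : bounded_sums hex_star (fun w => (/ Cmod w ^ 3)%R) (500 * 4).
Proof.
apply bounded_sums_le with hex_weight; [lra|intros w [H H0]; now apply inv_cube_le_weight|].
intros l Hl HS.
assert (HN : exists N, incl l (hexbox N)).
{ assert (H : exists N, forall w, In w l -> exists m n, w = hexpt m n /\
    (Z.abs m <= Z.of_nat N)%Z /\ (Z.abs n <= Z.of_nat N)%Z).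
  { clear Hl. induction HS as [|w l [Hw _] _ (N & HN)].
    - exists 0%nat. intros w [].
    - apply hex_lattice_iff in Hw. destruct Hw as (m & n & ->).
      exists (N + Z.to_nat (Z.abs m) + Z.to_nat (Z.abs n))%nat. intros v [<-|Hv].
      + exists m, n. split; auto. lia.
      + destruct (HN v Hv) as (m' & n' & -> & H1 & H2). exists m', n'. split; auto. lia. }
  destruct H as (N & HN). exists N. intros w Hw. destruct (HN w Hw) as (m & n & -> & H1 & H2).
  apply in_flat_map. exists m. split; [now apply box_In|]. apply in_map. now apply box_In. }
destruct HN as (N & HN).
eapply Rle_trans; [|apply (hexbox_weight N)]. apply Rsum_incl; auto.
intros w _. unfold hex_weight. apply Rmult_le_pos; apply weight_nonneg, Rabs_pos.
Qed.

Lemma hex_lattice_gap z : ~ hex_lattice z ->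
  exists d, (0 < d)%R /\ forall w, hex_lattice w -> (d <= Cmod (z - w))%R.
Proof.
intros Hz. destruct (classic (exists w0, hex_lattice w0 /\ (Cmod (z - w0) < 1 / 2)%R)) as [(w0 & H0 & H1)|Hn].
- assert (Hp : (0 < Cmod (z - w0))%R).
  { apply Cmod_gt_0. intros E. apply Hz. apply Ceq_minus in E. now rewrite E. }
  exists (Cmod (z - w0)). split; auto. intros w Hw.
  destruct (Ceq_dec w w0) as [->|Hne]; [lra|].
  assert (1 <= Cmod (w - w0))%R.
  { apply hex_lattice_norm_ge_1; [now apply hex_lattice_minus|]. now apply Cminus_eq_contra. }
  pose proof (Cmod_triangle3 w z w0). rewrite (Cmod_minus_sym w z) in *. lra.
- exists (1 / 2)%R. split; [lra|]. intros w Hw. apply Rnot_lt_le. intros Hlt. apply Hn. now exists w.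
Qed.

(** Far from the origin [|z - w|] is comparable to [|w|]; near it the gap [d] is. *)
Lemma hex_comparison (S : C -> Prop) z d :
  (0 < d)%R -> (forall w, S w -> (d <= Cmod (z - w))%R) ->
  exists eta, (0 < eta)%R /\ forall w, S w -> (eta * Cmod w <= Cmod (z - w))%R.
Proof.
intros Hd HS. pose proof (Cmod_ge_0 z) as Hz.
exists (Rmin (1 / 2) (d / (2 * Cmod z + 1)))%R.
assert (Hp : (0 < d / (2 * Cmod z + 1))%R) by (apply Rdiv_lt_0_compat; lra).
split; [apply Rmin_glb_lt; lra|]. intros w Hw. pose proof (Cmod_ge_0 w).
destruct (Rle_lt_dec (2 * Cmod z) (Cmod w)) as [H1|H1].
- apply Rle_trans with (1 / 2 * Cmod w)%R; [apply Rmult_le_compat_r; auto; apply Rmin_l|].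
  pose proof (Cmod_triangle z (- (z - w))) as T. rewrite Cmod_opp in T.
  replace (z + - (z - w)) with w in T by ring. lra.
- eapply Rle_trans; [|now apply HS].
  apply Rle_trans with (d / (2 * Cmod z + 1) * Cmod w)%R; [apply Rmult_le_compat_r; auto; apply Rmin_r|].
  apply Rle_trans with (d / (2 * Cmod z + 1) * (2 * Cmod z + 1))%R; [apply Rmult_le_compat_l; lra|].
  apply Req_le. field. lra.
Qed.

Lemma hex_inv_cube_bounded_at (S : C -> Prop) z d :
  (forall w, S w -> hex_lattice w) ->
  (0 < d)%R -> (forall w, S w -> (d <= Cmod (z - w))%R) ->
  exists M, bounded_sums S (fun w => (/ Cmod (z - w) ^ 3)%R) M.
Proof.
intros HL Hd HS. destruct (hex_comparison S z d Hd HS) as (eta & He & Hc).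
assert (H : bounded_sums (fun w => S w /\ w <> 0) (fun w => (/ Cmod (z - w) ^ 3)%R) (/ eta ^ 3 * (500 * 4))).
{ apply bounded_sums_le with (fun w => (/ Cmod w ^ 3)%R).
  - left. now apply Rinv_0_lt_compat, pow_lt.
  - intros w [Hw H0]. rewrite <- Rinv_mult, <- Rpow_mult_distr.
    assert (0 < Cmod w)%R by now apply Cmod_gt_0.
    apply Rinv_le_contravar; [apply pow_lt; nra|]. apply pow_incr. split; [nra|]. now apply Hc.
  - intros l Hl HSl. apply hex_inv_cube_bounded; auto. eapply Forall_impl; [|exact HSl].
    intros w [Hw H0]. split; auto. }
exists (/ Cmod (z - 0) ^ 3 + / eta ^ 3 * (500 * 4))%R.
apply (bounded_sums_add_point S 0); auto.
destruct (Req_dec (Cmod (z - 0)) 0) as [E|E].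
- rewrite E. cbn. rewrite Rmult_0_l, Rinv_0. lra.
- left. apply Rinv_0_lt_compat, pow_lt. pose proof (Cmod_ge_0 (z - 0)). lra.
Qed.

(** * Expansions of the Weierstrass function *)

Lemma has_ps_Cder_center (f : C -> C) z0 a r : has_ps f z0 a r -> Cder f z0 (a 1%nat).
Proof.
intros Hf. destruct (has_ps_derive f z0 a r 0 Hf) as (D & HD & H).
- rewrite Cmod_0. apply Hf.
- replace (z0 + 0) with z0 in H by ring. replace (a 1%nat) with D; auto.
  apply (Cseries_unique _ _ _ HD).
  replace (a 1%nat) with (RtoC (INR 1) * a 1%nat * 0 ^ 0) by (cbn; ring).
  apply (Cseries_single (fun n => RtoC (INR (S n)) * a (S n) * 0 ^ n)).
  intros n. rewrite Cpow_S. ring.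
Qed.

Lemma has_ps_Cder (f g : C -> C) z0 a r :
  has_ps f z0 a r ->
  (forall h, (Cmod h < r)%R -> Cder f (z0 + h) (g (z0 + h))) ->
  has_ps g z0 (fun n => RtoC (INR (S n)) * a (S n)) r.
Proof.
intros Hf Hg. split; [apply Hf|]. intros h Hh.
destruct (has_ps_derive f z0 a r h Hf Hh) as (D & HD & H).
now rewrite <- (Cder_unique _ _ _ _ H (Hg h Hh)).
Qed.

Definition wp_term (z w : C) : C := / (z - w) ^ 2 - / w ^ 2.

(** The coefficient of [h ^ n] in the binomial expansion of [wp_term (z0 + h) w]. *)
Definition wp_coef (z0 : C) (n : nat) (w : C) : C :=
  RtoC ((-1) ^ n * INR (S n)) * / (z0 - w) ^ (n + 2)
  - match n with 0%nat => / w ^ 2 | _ => RtoC 0 end.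

(** With [x = - h / t] this is
    [sum_(n > N) (n + 1) x^n = x^(N+1) (N + 2 - (N + 1) x) / (1 - x)^2]. *)
Lemma inv_sq_remainder (t h : C) N : t <> 0 -> t + h <> 0 ->
  / (t + h) ^ 2 - Csum (fun n => RtoC ((-1) ^ n * INR (S n)) * / t ^ (n + 2) * h ^ n) N
  = (- h / t) ^ S N * (RtoC (INR (S (S N))) - RtoC (INR (S N)) * (- h / t)) / (t + h) ^ 2.
Proof.
intros Ht Hth.
assert (E : forall n, RtoC ((-1) ^ n * INR (S n)) * / t ^ (n + 2) * h ^ n
  = RtoC (INR (S n)) * (- h / t) ^ n * / t ^ 2).
{ intros n. rewrite Cpow_add_r. unfold Cdiv. rewrite Cpow_mult_l, Cpow_inv by auto.
  replace (- h) with (RtoC (-1) * h) by ring. rewrite Cpow_mult_l, RtoC_mult, RtoC_pow.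
  field. split; auto. now apply Cpow_nz. }
set (x := - h / t) in *.
assert (Ex : / (t + h) ^ 2 = / t ^ 2 * / (1 - x) ^ 2).
{ unfold x. field. split; auto. intros E0. apply Hth. rewrite <- E0. ring. }
assert (Hx : 1 - x <> 0).
{ intros E0. apply Hth. replace (t + h) with (t * (1 - x)) by (unfold x; field; auto). rewrite E0. ring. }
unfold Cdiv. rewrite Ex.
induction N as [|N IH].
- rewrite Csum_0, E. cbn [INR Cpow]. rewrite RtoC_plus. field. split; auto.
- rewrite Csum_S, E.
  set (s := Csum _ N) in *.
  replace (/ t ^ 2 * / (1 - x) ^ 2 - (s + RtoC (INR (S (S N))) * x ^ S N * / t ^ 2))
    with ((/ t ^ 2 * / (1 - x) ^ 2 - s) - RtoC (INR (S (S N))) * x ^ S N * / t ^ 2) by ring.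
  rewrite IH. rewrite !Cpow_S, (S_INR (S (S N))), (S_INR (S N)), !RtoC_plus. field. split; auto.
Qed.

Lemma inv_sq_remainder_bound (t h : C) (d : R) N :
  (0 < d)%R -> (d <= Cmod t)%R -> (Cmod h < d)%R ->
  (Cmod (/ (t + h) ^ 2 - Csum (fun n => RtoC ((-1) ^ n * INR (S n)) * / t ^ (n + 2) * h ^ n) N)%C
   <= (2 * INR N + 3) * (Cmod h / d) ^ N * (Cmod h / (1 - Cmod h / d) ^ 2) * / Cmod t ^ 3)%R.
Proof.
intros Hd Ht Hh. pose proof (Cmod_ge_0 h) as Hh0.
set (theta := (Cmod h / d)%R).
assert (Hth : (0 <= theta < 1)%R).
{ unfold theta. split; [apply Rmult_le_pos; [lra|left; now apply Rinv_0_lt_compat]|].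
  apply Rmult_lt_reg_r with d; auto. unfold Rdiv. rewrite Rmult_assoc, Rinv_l by lra. lra. }
assert (Et : (Cmod h = theta * d)%R) by (unfold theta; field; lra).
assert (Hlow : ((1 - theta) * Cmod t <= Cmod (t + h))%R).
{ pose proof (Cmod_triangle (t + h) (- h)) as T. rewrite Cmod_opp in T.
  replace (t + h + - h) with t in T by ring. nra. }
assert (Hpos : (0 < (1 - theta) * Cmod t)%R) by nra.
assert (Ht0 : t <> 0) by (apply Cmod_gt_0; lra).
assert (Hth0 : t + h <> 0) by (apply Cmod_gt_0; lra).
rewrite inv_sq_remainder by auto. set (x := - h / t).
assert (Hx : Cmod x = (Cmod h / Cmod t)%R) by (unfold x; rewrite Cmod_div, Cmod_opp; auto).
assert (Hx1 : (0 <= Cmod x <= theta)%R).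
{ split; [apply Cmod_ge_0|]. rewrite Hx. apply Rmult_le_reg_r with (Cmod t); [lra|].
  unfold Rdiv. rewrite Rmult_assoc, Rinv_l by lra. nra. }
rewrite Cmod_div by now apply Cpow_nz. rewrite Cmod_mult, !Cmod_pow. cbn [pow].
assert (Hn : (Cmod (RtoC (INR (S (S N))) - RtoC (INR (S N)) * x) <= 2 * INR N + 3)%R).
{ eapply Rle_trans; [apply Cmod_triangle|].
  rewrite Cmod_opp, Cmod_mult, !Cmod_R, !Rabs_pos_eq by apply pos_INR.
  rewrite !S_INR. pose proof (pos_INR N). nra. }
assert (Hxn : (0 <= Cmod x ^ N <= theta ^ N)%R) by (split; [apply pow_le; lra|apply pow_incr; lra]).
pose proof (pos_INR N) as HN0.
assert (Hnum : (Cmod x * Cmod x ^ N * Cmod (RtoC (INR (S (S N))) - RtoC (INR (S N)) * x)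
   <= Cmod h / Cmod t * theta ^ N * (2 * INR N + 3))%R).
{ rewrite <- Hx. apply Rmult_le_compat; auto; [nra|apply Cmod_ge_0|]. apply Rmult_le_compat_l; lra. }
assert (Hden : (((1 - theta) * Cmod t) * ((1 - theta) * Cmod t) <= Cmod (t + h) * Cmod (t + h))%R) by nra.
apply Rle_trans with (Cmod h / Cmod t * theta ^ N * (2 * INR N + 3)
   * / (((1 - theta) * Cmod t) * ((1 - theta) * Cmod t)))%R.
- unfold Rdiv at 1. rewrite Rmult_1_r. apply Rmult_le_compat; auto.
  + apply Rmult_le_pos; [nra|apply Cmod_ge_0].
  + left. apply Rinv_0_lt_compat. nra.
  + apply Rinv_le_contravar; nra.
- apply Req_le. field. split; [lra|]. lra.
Qed.

Lemma linear_geometric_lim t eps : (0 <= t < 1)%R -> (0 < eps)%R ->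
  exists N, forall n, (N <= n)%nat -> ((2 * INR n + 3) * t ^ n < eps)%R.
Proof.
intros Ht He. destruct (linear_geometric t Ht) as (K & phi & HK & Hp & H).
set (m := Rmax t phi). assert (Hm : (0 <= m < 1)%R).
{ unfold m. split; [eapply Rle_trans; [apply Ht|apply Rmax_l]|apply Rmax_lub_lt; lra]. }
destruct (pow_lt_1_zero m ltac:(rewrite Rabs_pos_eq; lra) (eps / (2 * K + 4))%R) as (N & HN).
{ apply Rdiv_lt_0_compat; lra. }
exists N. intros n Hn. specialize (HN n Hn). rewrite Rabs_pos_eq in HN by (apply pow_le; lra).
assert (phi ^ n <= m ^ n)%R by (apply pow_incr; split; [lra|apply Rmax_r]).
assert (t ^ n <= m ^ n)%R by (apply pow_incr; split; [lra|apply Rmax_l]).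
specialize (H n). assert (0 <= m ^ n)%R by (apply pow_le; lra).
assert ((2 * K + 4) * m ^ n < eps)%R.
{ apply (Rmult_lt_compat_l (2 * K + 4)) in HN; [|lra].
  replace ((2 * K + 4) * (eps / (2 * K + 4)))%R with eps in HN by (field; lra). lra. }
nra.
Qed.

Lemma is_sum_over_Csum T (c : nat -> C -> C) b (h : C) N :
  (forall n, is_sum_over T (c n) (b n)) ->
  is_sum_over T (fun w => Csum (fun n => c n w * h ^ n) N) (Csum (fun n => b n * h ^ n) N).
Proof.
intros H. induction N as [|N IH].
- rewrite Csum_0. rewrite Cmult_comm. eapply is_sum_over_ext; [|apply is_sum_over_scal, (H 0%nat)].
  intros w _. rewrite Csum_0. cbv beta. ring.
- rewrite Csum_S. eapply is_sum_over_ext.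
  2:{ apply is_sum_over_plus; [exact IH|]. rewrite Cmult_comm. apply is_sum_over_scal, (H (S N)). }
  intros w _. cbv beta. rewrite Csum_S. ring.
Qed.

(** Summing the closed remainder over the lattice bounds the remainder of the
    summed series, so no interchange of limits is needed. *)
Lemma wp_sum_has_ps (T : C -> Prop) (F : C -> C) z0 d M b :
  (0 < d)%R -> (forall w, T w -> (d <= Cmod (z0 - w))%R) ->
  bounded_sums T (fun w => (/ Cmod (z0 - w) ^ 3)%R) M ->
  (forall h, (Cmod h < d)%R -> is_sum_over T (wp_term (z0 + h)) (F (z0 + h))) ->
  (forall n, is_sum_over T (wp_coef z0 n) (b n)) ->
  has_ps F z0 b d.
Proof.
intros Hd HS HM HF Hb. split; auto. intros h Hh.
set (theta := (Cmod h / d)%R). pose proof (Cmod_ge_0 h) as Hh0.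
assert (Hth : (0 <= theta < 1)%R).
{ unfold theta. split; [apply Rmult_le_pos; [lra|left; now apply Rinv_0_lt_compat]|].
  apply Rmult_lt_reg_r with d; auto. unfold Rdiv. rewrite Rmult_assoc, Rinv_l by lra. lra. }
set (B := (Cmod h / (1 - theta) ^ 2)%R).
assert (HB : (0 <= B)%R) by (apply Rmult_le_pos; [lra|left; apply Rinv_0_lt_compat, pow_lt; lra]).
assert (Hrem : forall N, (Cmod (F (z0 + h)%C - Csum (fun n => b n * h ^ n)%C N)
   <= (2 * INR N + 3) * theta ^ N * B * M)%R).
{ intros N.
  apply (is_sum_over_bound T
    (fun w => wp_term (z0 + h) w - Csum (fun n => wp_coef z0 n w * h ^ n) N)
    (fun w => ((2 * INR N + 3) * theta ^ N * B * / Cmod (z0 - w) ^ 3)%R)).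
  - intros w Hw.
    replace (wp_term (z0 + h) w - Csum (fun n => wp_coef z0 n w * h ^ n) N)
      with (/ ((z0 - w) + h) ^ 2 - Csum (fun n => RtoC ((-1) ^ n * INR (S n)) * / (z0 - w) ^ (n + 2) * h ^ n) N).
    + apply inv_sq_remainder_bound; auto.
    + unfold wp_term. replace (z0 + h - w) with (z0 - w + h) by ring.
      assert (E : Csum (fun n => wp_coef z0 n w * h ^ n) N =
        Csum (fun n => RtoC ((-1) ^ n * INR (S n)) * / (z0 - w) ^ (n + 2) * h ^ n) N - / w ^ 2).
      { induction N as [|N IH]; [rewrite !Csum_0; unfold wp_coef; cbn [Cpow]; ring|].
        rewrite !Csum_S, IH. unfold wp_coef at 1. ring. }
      rewrite E. ring.
  - apply bounded_sums_le with (fun w => (/ Cmod (z0 - w) ^ 3)%R); [|intros; lra|auto].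
    apply Rmult_le_pos; auto. apply Rmult_le_pos; [pose proof (pos_INR N); lra|apply pow_le; lra].
  - apply is_sum_over_minus; [now apply HF|]. now apply is_sum_over_Csum. }
assert (HM0 : (0 <= M)%R) by (specialize (HM nil (NoDup_nil _) (Forall_nil _)); exact HM).
apply Cseries_eps. intros eps He.
destruct (linear_geometric_lim theta (eps / (B * M + 1))%R) as (N & HN); auto.
{ apply Rdiv_lt_0_compat; nra. }
exists N. intros n Hn. rewrite Cmod_minus_sym. eapply Rle_lt_trans; [apply Hrem|].
specialize (HN n Hn).
assert (H0 : (0 <= (2 * INR n + 3) * theta ^ n)%R).
{ apply Rmult_le_pos; [pose proof (pos_INR n); lra|apply pow_le; lra]. }
assert (HBM : (0 <= B * M)%R) by now apply Rmult_le_pos.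
assert ((B * M + 1) * (eps / (B * M + 1)) = eps)%R by (field; lra).
rewrite Rmult_assoc. nra.
Qed.

Lemma Cinv_0 : / RtoC 0 = 0.
Proof. unfold Cinv, RtoC; cbn. apply f_equal2; unfold Rdiv; ring. Qed.

(** The part of [wp] that is regular at the origin. *)
Definition wp_reg (z : C) : C := sum_over hex_star (wp_term z).

Lemma wp_eq z : wp hex_lattice z = / z ^ 2 + wp_reg z.
Proof. reflexivity. Qed.

Lemma wp_reg_is_sum z d :
  (0 < d)%R -> (forall w, hex_star w -> (d <= Cmod (z - w))%R) ->
  is_sum_over hex_star (wp_term z) (wp_reg z).
Proof.
intros Hd HS. destruct (hex_comparison hex_star z d Hd HS) as (eta & He & Hc).
pose proof (Cmod_ge_0 z) as Hz0.
destruct (abs_sum_exists hex_star (wp_term z)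
  (fun w => (Cmod z * (2 + Cmod z) / eta ^ 2 * / Cmod w ^ 3)%R)
  (Cmod z * (2 + Cmod z) / eta ^ 2 * (500 * 4))) as [s Hs].
- intros w Hw. pose proof (hex_lattice_norm_ge_1 w (proj1 Hw) (proj2 Hw)) as H1.
  specialize (Hc w Hw). specialize (HS w Hw).
  assert (Hzw : z - w <> 0) by (apply Cmod_gt_0; lra).
  unfold wp_term. replace (/ (z - w) ^ 2 - / w ^ 2) with (z * (2 * w - z) / ((z - w) ^ 2 * w ^ 2))
    by (field; split; [apply Hw|exact Hzw]).
  rewrite Cmod_div by (apply Cmult_neq_0; apply Cpow_nz; [exact Hzw|apply Hw]).
  rewrite !Cmod_mult, !Cmod_pow.
  assert (Hnum : (Cmod (2 * w - z) <= (2 + Cmod z) * Cmod w)%R).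
  { eapply Rle_trans; [apply Cmod_triangle|].
    rewrite Cmod_opp, Cmod_mult, Cmod_R, Rabs_pos_eq by lra. nra. }
  assert (Hden : (eta ^ 2 * Cmod w ^ 2 <= Cmod (z - w) ^ 2)%R).
  { rewrite <- Rpow_mult_distr. apply pow_incr. split; [nra|auto]. }
  assert (He2 : (0 < eta ^ 2)%R) by now apply pow_lt.
  assert (Hw2 : (0 < Cmod w ^ 2)%R) by (apply pow_lt; lra).
  apply Rle_trans with (Cmod z * ((2 + Cmod z) * Cmod w) / (eta ^ 2 * Cmod w ^ 2 * Cmod w ^ 2))%R.
  + apply Rmult_le_compat.
    * apply Rmult_le_pos; apply Cmod_ge_0.
    * left. apply Rinv_0_lt_compat. apply Rmult_lt_0_compat; nra.
    * apply Rmult_le_compat_l; auto.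
    * apply Rinv_le_contravar; [apply Rmult_lt_0_compat; [now apply Rmult_lt_0_compat|auto]|]. apply Rmult_le_compat_r; lra.
  + apply Req_le. field. split; lra.
- apply bounded_sums_le with (fun w => (/ Cmod w ^ 3)%R); [|intros; lra|exact hex_inv_cube_bounded].
  apply Rmult_le_pos; [nra|]. left. now apply Rinv_0_lt_compat, pow_lt.
- unfold wp_reg. now rewrite (sum_over_unique _ _ _ Hs).
Qed.

Lemma wp_is_sum z : ~ hex_lattice z -> is_sum_over hex_lattice (wp_term z) (wp hex_lattice z).
Proof.
intros Hz. destruct (hex_lattice_gap z Hz) as (d & Hd & H).
rewrite wp_eq. replace (/ z ^ 2) with (wp_term z 0).
- apply is_sum_over_add_point; [exact hex_lattice_0|].
  apply (wp_reg_is_sum z d Hd). intros w [Hw _]. now apply H.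
- unfold wp_term. replace (RtoC 0 ^ 2) with (RtoC 0) by (cbn; ring). rewrite Cinv_0.
  replace (z - 0) with z by ring. ring.
Qed.

Definition inv_pow_sum (T : C -> Prop) (z : C) (k : nat) : C := sum_over T (fun w => / (z - w) ^ k).

Lemma inv_pow_is_sum T z d k :
  (forall w, T w -> hex_lattice w) -> (0 < d)%R -> (forall w, T w -> (d <= Cmod (z - w))%R) ->
  is_sum_over T (fun w => / (z - w) ^ (k + 3)) (inv_pow_sum T z (k + 3)).
Proof.
intros HL Hd HS. destruct (hex_inv_cube_bounded_at T z d HL Hd HS) as (M & HM).
destruct (abs_sum_exists T (fun w => / (z - w) ^ (k + 3))
  (fun w => (/ d ^ k * / Cmod (z - w) ^ 3)%R) (/ d ^ k * M)) as [s Hs].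
- intros w Hw. specialize (HS w Hw).
  assert (Hzw : z - w <> 0) by (apply Cmod_gt_0; lra).
  rewrite Cmod_inv by now apply Cpow_nz. rewrite Cmod_pow, pow_add, Rinv_mult.
  apply Rmult_le_compat_r; [left; apply Rinv_0_lt_compat, pow_lt; lra|].
  apply Rinv_le_contravar; [now apply pow_lt|]. apply pow_incr; lra.
- apply bounded_sums_le with (fun w => (/ Cmod (z - w) ^ 3)%R); [|intros; lra|auto].
  left. now apply Rinv_0_lt_compat, pow_lt.
- unfold inv_pow_sum. now rewrite (sum_over_unique _ _ _ Hs).
Qed.

Definition wp_series (T : C -> Prop) (F : C -> C) (z0 : C) (n : nat) : C :=
  match n with
  | 0%nat => F z0
  | S m => RtoC ((-1) ^ n * INR (S n)) * inv_pow_sum T z0 (m + 3)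
  end.

Lemma wp_family_has_ps (T : C -> Prop) (F : C -> C) z0 d :
  (forall w, T w -> hex_lattice w) -> (0 < d)%R -> (forall w, T w -> (d <= Cmod (z0 - w))%R) ->
  (forall h, (Cmod h < d)%R -> is_sum_over T (wp_term (z0 + h)) (F (z0 + h))) ->
  has_ps F z0 (wp_series T F z0) d.
Proof.
intros HL Hd HS HF. destruct (hex_inv_cube_bounded_at T z0 d HL Hd HS) as (M & HM).
apply (wp_sum_has_ps T F z0 d M); auto.
intros [|n].
- cbn [wp_series]. specialize (HF (RtoC 0)). rewrite Cmod_0 in HF. specialize (HF Hd).
  replace (z0 + RtoC 0) with z0 in HF by ring.
  eapply is_sum_over_ext; [|exact HF]. intros w _. unfold wp_term, wp_coef. cbn [INR pow Nat.add].
  replace ((1 * 1)%R) with 1%R by ring. ring.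
- cbn [wp_series]. eapply is_sum_over_ext;
    [|apply is_sum_over_scal, (inv_pow_is_sum T z0 d n HL Hd HS)].
  intros w _. unfold wp_coef. replace (S n + 2)%nat with (n + 3)%nat by lia. cbv beta. ring.
Qed.

Lemma wp_has_ps z0 d :
  (0 < d)%R -> (forall w, hex_lattice w -> (d <= Cmod (z0 - w))%R) ->
  has_ps (wp hex_lattice) z0 (wp_series hex_lattice (wp hex_lattice) z0) d.
Proof.
intros Hd H. apply wp_family_has_ps; auto. intros h Hh. apply wp_is_sum. intros Hn.
specialize (H _ Hn). replace (z0 - (z0 + h)) with (- h) in H by ring. rewrite Cmod_opp in H. lra.
Qed.

Lemma wp_reg_has_ps : has_ps wp_reg 0 (wp_series hex_star wp_reg 0) 1.
Proof.
assert (H : forall w, hex_star w -> (1 <= Cmod (0 - w))%R).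
{ intros w [Hw H0]. replace (0 - w) with (- w) by ring. rewrite Cmod_opp.
  now apply hex_lattice_norm_ge_1. }
apply wp_family_has_ps; [now intros w []|lra|exact H|].
intros h Hh. apply (wp_reg_is_sum _ (1 - Cmod h)); [lra|].
intros w Hw. specialize (H w Hw).
pose proof (Cmod_triangle3 0 (- h) (w - h)) as Tr. 
replace (0 - (w - h)) with (h - w) in Tr by ring.
replace (0 + h - w) with (h - w) by ring.
pose proof (Cmod_triangle (h - w) (- h)) as Tr'. rewrite Cmod_opp in Tr'.
replace (h - w + - h) with (0 - w) in Tr' by ring. lra.
Qed.

(** The lattice sums of the first two derivatives of [wp]. *)
Definition wp1 (z : C) : C := (-2) * inv_pow_sum hex_lattice z 3.
Definition wp2 (z : C) : C := 6 * inv_pow_sum hex_lattice z 4.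

Lemma wp_Cder z : ~ hex_lattice z -> Cder (wp hex_lattice) z (wp1 z).
Proof.
intros Hz. destruct (hex_lattice_gap z Hz) as (d & Hd & H).
pose proof (has_ps_Cder_center _ _ _ _ (wp_has_ps z d Hd H)) as HD.
cbn [wp_series Nat.add] in HD. unfold wp1.
replace (RtoC (-2)) with (RtoC ((-1) ^ 1 * INR 2)); auto.
f_equal. cbn. ring.
Qed.

Lemma gap_ball z0 d h :
  (forall w, hex_lattice w -> (d <= Cmod (z0 - w))%R) -> (Cmod h < d)%R -> ~ hex_lattice (z0 + h).
Proof.
intros H Hh Hn. specialize (H _ Hn). replace (z0 - (z0 + h)) with (- h) in H by ring.
rewrite Cmod_opp in H. lra.
Qed.

Lemma wp1_has_ps z0 d :
  (0 < d)%R -> (forall w, hex_lattice w -> (d <= Cmod (z0 - w))%R) ->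
  has_ps wp1 z0 (fun n => RtoC (INR (S n)) * wp_series hex_lattice (wp hex_lattice) z0 (S n)) d.
Proof.
intros Hd H. apply (has_ps_Cder (wp hex_lattice)); [now apply wp_has_ps|].
intros h Hh. apply wp_Cder. eapply gap_ball; eauto.
Qed.

Lemma wp1_Cder z : ~ hex_lattice z -> Cder wp1 z (wp2 z).
Proof.
intros Hz. destruct (hex_lattice_gap z Hz) as (d & Hd & H).
pose proof (has_ps_Cder_center _ _ _ _ (wp1_has_ps z d Hd H)) as HD.
cbn [wp_series Nat.add] in HD. unfold wp2.
replace (6 * inv_pow_sum hex_lattice z 4) with
  (RtoC (INR 2) * (RtoC ((-1) ^ 2 * INR 3) * inv_pow_sum hex_lattice z 4)); auto.
rewrite Cmult_assoc, <- RtoC_mult. f_equal. f_equal. cbn. ring.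
Qed.

Lemma wp2_has_ps z0 d :
  (0 < d)%R -> (forall w, hex_lattice w -> (d <= Cmod (z0 - w))%R) ->
  exists a, has_ps wp2 z0 a d.
Proof.
intros Hd H. eexists. apply (has_ps_Cder wp1); [now apply wp1_has_ps|].
intros h Hh. apply wp1_Cder. eapply gap_ball; eauto.
Qed.

(** * Connectedness and compactness in the plane *)

(** Cousin's lemma, by a supremum argument: the compactness of an interval in a
    form that serves connectedness, boundedness and the existence of maxima. *)
Lemma cousin (a b : R) (P : R -> R -> Prop) :
  (a <= b)%R ->
  (forall u v w, (a <= u <= v)%R -> (v <= w <= b)%R -> P u v -> P v w -> P u w) ->
  (forall x, (a <= x <= b)%R -> exists d, (0 < d)%R /\
     forall u v, (a <= u <= x)%R -> (x <= v <= b)%R -> (x - d < u)%R -> (v < x + d)%R -> P u v) ->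
  P a b.
Proof.
intros Hab Hadd Hloc.
destruct (completeness (fun t => (a <= t <= b)%R /\ P a t)) as (s & Hub & Hlub).
- exists b. intros t [Ht _]. lra.
- exists a. split; [lra|]. destruct (Hloc a) as (d & Hd & H); [lra|]. apply H; lra.
- assert (Haa : P a a). { destruct (Hloc a) as (d & Hd & H); [lra|]. apply H; lra. }
  assert (Hs1 : (a <= s)%R) by (apply Hub; split; [lra|auto]).
  assert (Hs2 : (s <= b)%R) by (apply Hlub; intros t [Ht _]; lra).
  destruct (Hloc s) as (d & Hd & H); [lra|].
  assert (Ht : exists t, (a <= t <= b)%R /\ P a t /\ (s - d < t)%R).
  { apply NNPP. intros Hn. assert (s <= s - d)%R; [|lra]. apply Hlub. intros t [Ht HP].
    apply Rnot_lt_le. intros Hlt. apply Hn. now exists t. }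
  destruct Ht as (t & Ht & HP & Hst).
  assert (Hts : (t <= s)%R) by (apply Hub; now split).
  set (v := Rmin b (s + d / 2)%R).
  assert (Hv : (s <= v <= b)%R) by (unfold v; split; [apply Rmin_glb; lra|apply Rmin_l]).
  assert (Hv' : (v < s + d)%R) by (pose proof (Rmin_r b (s + d / 2)); unfold v; lra).
  assert (HPv : P a v) by (apply (Hadd a t v); try lra; auto; apply H; lra).
  assert (v <= s)%R by (apply Hub; split; [lra|auto]).
  replace b with v; auto. unfold v in *. destruct (Rle_dec b (s + d / 2)); [now apply Rmin_left|].
  rewrite Rmin_right in * by lra. lra.
Qed.

Lemma locally_C_iff (z : C) (P : C -> Prop) :
  locally (T := C_UniformSpace) z P <->
  exists r, (0 < r)%R /\ forall w, (Cmod (w - z) < r)%R -> P w.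
Proof.
split.
- intros [e He]. exists e. split; [apply cond_pos|]. intros w Hw. apply He. split.
  + change (Rabs (Re w - Re z) < e)%R. pose proof (re_le_Cmod (w - z)) as H.
    unfold Cminus in *. rewrite re_plus, re_opp in H. unfold Rminus. lra.
  + change (Rabs (Im w - Im z) < e)%R. pose proof (Im_le_Cmod (w - z)) as H.
    unfold Cminus in *. rewrite im_plus, im_opp in H. unfold Rminus. lra.
- intros (r & Hr & H). assert (Hr2 : (0 < r / 2)%R) by lra.
  exists (mkposreal _ Hr2). intros w [H1 H2]. apply H.
  change (Rabs (Re w - Re z) < r / 2)%R in H1. change (Rabs (Im w - Im z) < r / 2)%R in H2.
  eapply Rle_lt_trans; [apply Cmod_le_Re_Im|].
  unfold Cminus. rewrite re_plus, re_opp, im_plus, im_opp. unfold Rminus in *. lra.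
Qed.

Lemma segment_meets (A B : C -> Prop) (a b : C) :
  open (T := C_UniformSpace) A -> open (T := C_UniformSpace) B ->
  (forall t, (0 <= t <= 1)%R -> A (a + RtoC t * (b - a)) \/ B (a + RtoC t * (b - a))) ->
  A a -> B b -> exists t, (0 <= t <= 1)%R /\ A (a + RtoC t * (b - a)) /\ B (a + RtoC t * (b - a)).
Proof.
intros HA HB Hcov Ha Hb. apply NNPP. intros Hn.
set (g := fun t : R => a + RtoC t * (b - a)) in *.
assert (Hg : forall x r, (0 < r)%R -> exists d, (0 < d)%R /\ forall t, (Rabs (t - x) < d)%R -> (Cmod (g t - g x) < r)%R).
{ intros x r Hr. pose proof (Cmod_ge_0 (b - a)) as H0. exists (r / (Cmod (b - a) + 1))%R.
  split; [apply Rdiv_lt_0_compat; lra|]. intros t Ht.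
  replace (g t - g x) with (RtoC (t - x) * (b - a)) by (unfold g; rewrite RtoC_minus; ring).
  rewrite Cmod_mult, Cmod_R.
  apply (Rmult_lt_compat_r (Cmod (b - a) + 1)) in Ht; [|lra].
  replace (r / (Cmod (b - a) + 1) * (Cmod (b - a) + 1))%R with r in Ht by (field; lra).
  pose proof (Rabs_pos (t - x)). nra. }
assert (H : A (g 0%R) <-> A (g 1%R)).
{ apply (cousin 0 1 (fun u v => A (g u) <-> A (g v))); [lra|tauto|].
  intros x Hx. destruct (Hcov x Hx) as [H|H].
  - destruct (proj1 (locally_C_iff _ _) (HA _ H)) as (r & Hr & HAr).
    destruct (Hg x r Hr) as (d & Hd & Hgd). exists d. split; auto.
    intros u v Hu Hv Hu' Hv'. split; intros _; apply HAr, Hgd; apply Rabs_def1; lra.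
  - destruct (proj1 (locally_C_iff _ _) (HB _ H)) as (r & Hr & HBr).
    destruct (Hg x r Hr) as (d & Hd & Hgd). exists d. split; auto.
    intros u v Hu Hv Hu' Hv'.
    assert (HN : forall t, (0 <= t <= 1)%R -> (Rabs (t - x) < d)%R -> ~ A (g t)).
    { intros t Ht Htx HAt. apply Hn. exists t. repeat split; try lra; auto. apply HBr, Hgd, Htx. }
    split; intros HX; exfalso; revert HX; apply HN; try lra; apply Rabs_def1; lra. }
apply Hn. exists 1%R. split; [lra|].
replace (a + RtoC 1 * (b - a)) with b by ring. split; auto.
replace b with (g 1%R) by (unfold g; ring). apply H. unfold g.
replace (a + RtoC 0 * (b - a)) with a by ring. exact Ha.
Qed.

Lemma generic_real (s x eps : R) : (0 < s)%R -> (0 < eps)%R ->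
  exists y, (x < y < x + eps)%R /\ forall k : Z, (y <> s * IZR k)%R.
Proof.
intros Hs He. destruct (archimed (x / s)) as [H1 H2].
set (u := up (x / s)) in *.
assert (E1 : (x < s * IZR u)%R).
{ apply (Rmult_gt_compat_l s) in H1; auto. replace (s * (x / s))%R with x in H1 by (field; lra). lra. }
assert (E2 : (s * IZR u - s <= x)%R).
{ apply (Rmult_le_compat_l s) in H2; [|lra].
  replace (s * (IZR u - x / s))%R with (s * IZR u - x)%R in H2 by (field; lra). lra. }
(* [s * IZR u] is the next multiple of [s] after [x]; stop halfway to it. *)
set (m := Rmin eps (s * IZR u - x)).
assert (Hm : (0 < m)%R) by (apply Rmin_glb_lt; lra).
pose proof (Rmin_l eps (s * IZR u - x)). pose proof (Rmin_r eps (s * IZR u - x)). fold m in H, H0.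
exists (x + m / 2)%R. split; [lra|]. intros k Ek.
assert (K1 : (s * IZR k < s * IZR u)%R) by lra.
assert (K2 : (s * (IZR u - 1) < s * IZR k)%R) by lra.
apply Rmult_lt_reg_l in K1; auto. apply Rmult_lt_reg_l in K2; auto.
apply lt_IZR in K1. replace (IZR u - 1)%R with (IZR (u - 1)) in K2 by (rewrite minus_IZR; ring).
apply lt_IZR in K2. lia.
Qed.

Lemma not_hex_of_Re (z : C) : (forall k : Z, (Re z <> sqrt 3 / 2 * IZR k)%R) -> ~ hex_lattice z.
Proof.
intros H Hz. apply hex_lattice_iff in Hz. destruct Hz as (m & n & ->).
apply (H (m + n)%Z). rewrite plus_IZR. reflexivity.
Qed.

Lemma not_hex_of_Im (z : C) : (forall k : Z, (Im z <> 1 / 2 * IZR k)%R) -> ~ hex_lattice z.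
Proof.
intros H Hz. apply hex_lattice_iff in Hz. destruct Hz as (m & n & ->).
apply (H (m - n)%Z). rewrite minus_IZR. unfold hexpt, Im; cbn [snd]. field.
Qed.

(** Lattice points lie on a grid of horizontal and vertical lines; a horizontal
    and a vertical segment off the grid join any two points off the grid. *)
Lemma hex_complement_connected : connected (fun z => ~ hex_lattice z).
Proof.
intros A B HA HB Hcov (a & Ha & HAa) (b & Hb & HBb).
assert (Hgen : forall (D : C -> Prop) z, open (T := C_UniformSpace) D -> D z ->
  exists w, D w /\ (forall k : Z, (Re w <> sqrt 3 / 2 * IZR k)%R) /\ (forall k : Z, (Im w <> 1 / 2 * IZR k)%R)).
{ intros D z HD Hz. destruct (proj1 (locally_C_iff _ _) (HD z Hz)) as (r & Hr & H).
  pose proof sqrt3_pos.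
  destruct (generic_real (sqrt 3 / 2) (Re z) (r / 2)) as (x & Hx & Hxk); [lra|lra|].
  destruct (generic_real (1 / 2) (Im z) (r / 2)) as (y & Hy & Hyk); [lra|lra|].
  exists (x, y). split; [|split; auto]. apply H.
  eapply Rle_lt_trans; [apply Cmod_le_Re_Im|].
  unfold Cminus. rewrite re_plus, re_opp, im_plus, im_opp. cbn [Re Im fst snd].
  unfold Re, Im in *; cbn [fst snd] in *. rewrite !Rabs_pos_eq; lra. }
destruct (Hgen A a HA HAa) as (p & HAp & Hp1 & Hp2).
destruct (Hgen B b HB HBb) as (q & HBq & Hq1 & Hq2).
set (m := (Re q, Im p)).
assert (S1 : forall t, ~ hex_lattice (p + RtoC t * (m - p))).
{ intros t. apply not_hex_of_Im. intros k. unfold m, Cminus.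
  rewrite im_plus, im_scal_l, im_plus, im_opp. cbn [Im snd].
  replace (Im p + t * (Im p + - Im p))%R with (Im p) by ring. apply Hp2. }
assert (S2 : forall t, ~ hex_lattice (m + RtoC t * (q - m))).
{ intros t. apply not_hex_of_Re. intros k. unfold m, Cminus.
  rewrite re_plus, re_scal_l, re_plus, re_opp. cbn [Re fst].
  replace (Re q + t * (Re q + - Re q))%R with (Re q) by ring. apply Hq1. }
assert (Hm : ~ hex_lattice m).
{ replace m with (p + RtoC 1 * (m - p)) by ring. apply S1. }
destruct (Hcov m Hm) as [HAm|HBm].
- destruct (segment_meets A B m q HA HB) as (t & Ht & H1 & H2); auto.
  exists (m + RtoC t * (q - m)). auto.
- destruct (segment_meets A B p m HA HB) as (t & Ht & H1 & H2); auto.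
  exists (p + RtoC t * (m - p)). auto.
Qed.

Lemma hex_complement_open (D : C -> Prop) :
  (forall z, ~ hex_lattice z -> D z -> exists r, (0 < r)%R /\ forall h, (Cmod h < r)%R -> D (z + h)) ->
  open (T := C_UniformSpace) (fun z => ~ hex_lattice z /\ D z).
Proof.
intros H z [Hz HDz]. apply locally_C_iff.
destruct (H z Hz HDz) as (r & Hr & HD). destruct (hex_lattice_gap z Hz) as (d & Hd & Hgap).
exists (Rmin r d). split; [now apply Rmin_glb_lt|]. intros w Hw.
destruct (Rlt_Rmin _ _ _ Hw) as [H1 H2].
replace w with (z + (w - z)) by ring. split; [now apply (gap_ball z d)|auto].
Qed.

Lemma locally_constant_off_hex (f : C -> C) :
  (forall z, ~ hex_lattice z -> exists r, (0 < r)%R /\ forall h, (Cmod h < r)%R -> f (z + h) = f z) ->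
  forall z z', ~ hex_lattice z -> ~ hex_lattice z' -> f z = f z'.
Proof.
intros H z z' Hz Hz'. apply NNPP. intros Hne.
destruct (hex_complement_connected
  (fun w => ~ hex_lattice w /\ f w = f z) (fun w => ~ hex_lattice w /\ f w <> f z))
  as (w & _ & [_ H1] & [_ H2]); [| | | | |contradiction].
- apply hex_complement_open. intros w Hw E. destruct (H w Hw) as (r & Hr & Hc).
  exists r. split; auto. intros h Hh. rewrite Hc; auto.
- apply hex_complement_open. intros w Hw E. destruct (H w Hw) as (r & Hr & Hc).
  exists r. split; auto. intros h Hh. rewrite Hc; auto.
- intros w Hw. destruct (classic (f w = f z)); auto.
- exists z. auto.
- exists z'. auto.
Qed.

(** Without a maximum every point has a neighbourhood on which [N] stays below one of
    its values; Cousin's lemma in each coordinate extends this to the whole box, a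
    contradiction at the point where that value is taken. *)
Lemma box_maximum (N : C -> R) (a b c d : R) :
  (a <= b)%R -> (c <= d)%R ->
  (forall z eps, (0 < eps)%R -> exists r, (0 < r)%R /\ forall w, (Cmod (w - z) < r)%R -> (Rabs (N w - N z) < eps)%R) ->
  exists z0, (a <= Re z0 <= b)%R /\ (c <= Im z0 <= d)%R /\
    forall z, (a <= Re z <= b)%R -> (c <= Im z <= d)%R -> (N z <= N z0)%R.
Proof.
intros Hab Hcd HN. apply NNPP. intros Hn.
set (inbox := fun z => (a <= Re z <= b)%R /\ (c <= Im z <= d)%R).
assert (Hup : forall z, inbox z -> exists z', inbox z' /\ (N z < N z')%R).
{ intros z [H1 H2]. apply NNPP. intros Hz. apply Hn. exists z. repeat split; try lra.
  intros w H3 H4. apply Rnot_lt_le. intros Hlt. apply Hz. exists w. repeat split; auto; lra. }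
assert (Hloc : forall z, inbox z -> exists z' r, inbox z' /\ (0 < r)%R /\ forall w, (Cmod (w - z) < r)%R -> (N w < N z')%R).
{ intros z Hz. destruct (Hup z Hz) as (z' & Hz' & Hlt).
  destruct (HN z (N z' - N z)%R) as (r & Hr & H); [lra|]. exists z', r. repeat split; auto; try apply Hz'.
  intros w Hw. specialize (H w Hw). apply Rabs_def2 in H. lra. }
assert (Hmax : forall z1 z2, inbox z1 -> inbox z2 ->
  exists z, inbox z /\ (N z1 <= N z)%R /\ (N z2 <= N z)%R).
{ intros z1 z2 H1 H2. destruct (Rle_dec (N z1) (N z2)); [exists z2|exists z1]; repeat split; try apply H1; try apply H2; lra. }
set (P := fun y1 y2 : R => exists z', inbox z' /\
  forall z, (a <= Re z <= b)%R -> (y1 <= Im z <= y2)%R -> (N z < N z')%R).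
assert (HP : P c d).
{ apply cousin; auto.
  - intros u v w _ _ (z1 & Hz1 & H1) (z2 & Hz2 & H2). destruct (Hmax z1 z2 Hz1 Hz2) as (z & Hz & K1 & K2).
    exists z. split; auto. intros x Hx Hy. destruct (Rle_dec (Im x) v).
    + eapply Rlt_le_trans; [apply H1; auto; lra|auto].
    + eapply Rlt_le_trans; [apply H2; auto; lra|auto].
  - intros y Hy.
    assert (HQ : exists z' r, inbox z' /\ (0 < r)%R /\
      forall z, (a <= Re z <= b)%R -> (Rabs (Im z - y) < r)%R -> (N z < N z')%R).
    { apply (cousin a b (fun u v => exists z' r, inbox z' /\ (0 < r)%R /\
        forall z, (u <= Re z <= v)%R -> (Rabs (Im z - y) < r)%R -> (N z < N z')%R)); auto.
      - intros u v w _ _ (z1 & r1 & Hz1 & Hr1 & H1) (z2 & r2 & Hz2 & Hr2 & H2).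
        destruct (Hmax z1 z2 Hz1 Hz2) as (z & Hz & K1 & K2).
        exists z, (Rmin r1 r2). split; auto. split; [now apply Rmin_glb_lt|]. intros x Hx Hy'.
        destruct (Rle_dec (Re x) v).
        + eapply Rlt_le_trans; [apply H1; try lra; eapply Rlt_le_trans; [exact Hy'|apply Rmin_l]|auto].
        + eapply Rlt_le_trans; [apply H2; try lra; eapply Rlt_le_trans; [exact Hy'|apply Rmin_r]|auto].
      - intros x Hx. destruct (Hloc (x, y)) as (z' & r & Hz' & Hr & H); [split; cbn; lra|].
        exists (r / 2)%R. split; [lra|]. intros u v Hu Hv Hu' Hv'. exists z', (r / 2)%R.
        split; auto. split; [lra|]. intros z Hz1 Hz2. apply H.
        eapply Rle_lt_trans; [apply Cmod_le_Re_Im|].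
        unfold Cminus. rewrite re_plus, re_opp, im_plus, im_opp. cbn [Re Im fst snd].
        assert (Rabs (Re z + - x) < r / 2)%R by (apply Rabs_def1; lra).
        unfold Rminus, Re, Im in *. cbn [fst snd] in *. lra. }
    destruct HQ as (z' & r & Hz' & Hr & H). exists r. split; auto.
    intros u v Hu Hv Hu' Hv'. exists z'. split; auto. intros z Hz1 Hz2. apply H; auto.
    apply Rabs_def1; lra. }
destruct HP as (z' & [H1 H2] & H). specialize (H z' H1 H2). lra.
Qed.

(** * Symmetries of the Weierstrass function *)

Lemma Cinv_mult_l (a b : C) : a <> 0 -> / (a * b) = / a * / b.
Proof.
intros Ha. destruct (Ceq_dec b 0) as [->|Hb]; [|now field].
rewrite Cmult_0_r, Cinv_0. ring.
Qed.

Lemma not_hex_opp z : ~ hex_lattice z -> ~ hex_lattice (- z).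
Proof. intros H Hn. apply H. replace z with (- - z) by ring. now apply hex_lattice_opp. Qed.

Lemma not_hex_plus z v : hex_lattice v -> ~ hex_lattice z -> ~ hex_lattice (z + v).
Proof. intros Hv H Hn. apply H. replace z with (z + v - v) by ring. now apply hex_lattice_minus. Qed.

Lemma not_hex_zeta6 z : ~ hex_lattice z -> ~ hex_lattice (zeta6 * z).
Proof.
intros H Hn. apply H. replace z with ((1 - zeta6) * (zeta6 * z)).
- now apply zeta6_inv_lattice.
- rewrite Cmult_assoc, (Cmult_comm _ zeta6), zeta6_inv. ring.
Qed.

Lemma not_hex_conj z : ~ hex_lattice z -> ~ hex_lattice (Cconj z).
Proof. intros H Hn. apply H. rewrite <- (Cconj_conj z). now apply hex_lattice_conj. Qed.

Lemma wp_even z : ~ hex_lattice z -> wp hex_lattice (- z) = wp hex_lattice z.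
Proof.
intros Hz. apply (is_sum_over_unique hex_lattice (wp_term (- z))); [now apply wp_is_sum, not_hex_opp|].
eapply is_sum_over_ext.
2:{ apply (is_sum_over_reindex hex_lattice hex_lattice Copp Copp); [| |now apply wp_is_sum].
    - intros w Hw. split; [now apply hex_lattice_opp|ring].
    - intros w Hw. split; [now apply hex_lattice_opp|ring]. }
intros w _. unfold wp_term. replace ((- z - w) ^ 2) with ((z - - w) ^ 2) by ring.
replace ((- w) ^ 2) with (w ^ 2) by ring. reflexivity.
Qed.

Lemma wp_zeta6 z : ~ hex_lattice z -> wp hex_lattice (zeta6 * z) = / zeta6 ^ 2 * wp hex_lattice z.
Proof.
intros Hz.
apply (is_sum_over_unique hex_lattice (fun w => wp_term (zeta6 * z) (zeta6 * w))).
- apply (is_sum_over_reindex hex_lattice hex_lattice (fun w => zeta6 * w) (fun w => (1 - zeta6) * w));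
    [| |now apply wp_is_sum, not_hex_zeta6].
  + intros w Hw. split; [now apply zeta6_lattice|].
    rewrite Cmult_assoc, (Cmult_comm _ zeta6), zeta6_inv. ring.
  + intros w Hw. split; [now apply zeta6_inv_lattice|]. rewrite Cmult_assoc, zeta6_inv. ring.
- eapply is_sum_over_ext; [|apply is_sum_over_scal; now apply wp_is_sum].
  intros w _. cbv beta. unfold wp_term.
  replace (zeta6 * z - zeta6 * w) with (zeta6 * (z - w)) by ring.
  rewrite !Cpow_mult_l, !(Cinv_mult_l (zeta6 ^ 2)) by apply Cpow_nz, zeta6_nz. ring.
Qed.

Lemma Cconj_sum_list f l : Cconj (sum_list f l) = sum_list (fun w => Cconj (f w)) l.
Proof.
induction l as [|w l IH]; [unfold sum_list, Cconj; cbn; apply f_equal2; ring|].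
rewrite !sum_list_cons, Cplus_conj, IH. reflexivity.
Qed.

Lemma is_sum_over_conj T f s : is_sum_over T f s -> is_sum_over T (fun w => Cconj (f w)) (Cconj s).
Proof.
intros H eps He. destruct (H eps He) as (l0 & H0 & Hc). exists l0. split; auto.
intros l Hl HS Hi. rewrite <- Cconj_sum_list, <- Cminus_conj, Cmod_conj. now apply Hc.
Qed.

Lemma Cinv_conj_total (c : C) : Cconj (/ c) = / Cconj c.
Proof.
destruct (Ceq_dec c 0) as [->|H]; [|now apply Cinv_conj].
replace (Cconj 0) with (RtoC 0) by (unfold Cconj, RtoC; cbn; apply f_equal2; ring).
rewrite Cinv_0. unfold Cconj, RtoC; cbn; apply f_equal2; ring.
Qed.

Lemma conj_reindex T : (forall w, T w -> T (Cconj w)) -> forall f s,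
  is_sum_over T f s -> is_sum_over T (fun w => f (Cconj w)) s.
Proof.
intros HT f s. apply (is_sum_over_reindex T T Cconj Cconj); intros w Hw; (split; [now apply HT|apply Cconj_conj]).
Qed.

Lemma wp_conj z : ~ hex_lattice z -> wp hex_lattice (Cconj z) = Cconj (wp hex_lattice z).
Proof.
intros Hz. apply (is_sum_over_unique hex_lattice (fun w => wp_term (Cconj z) (Cconj w))).
- apply (conj_reindex _ hex_lattice_conj). now apply wp_is_sum, not_hex_conj.
- eapply is_sum_over_ext; [|apply is_sum_over_conj; now apply wp_is_sum].
  intros w _. unfold wp_term. cbv beta.
  now rewrite Cminus_conj, !Cinv_conj_total, !Cpow_conj, Cminus_conj.
Qed.

Lemma wp1_conj z : ~ hex_lattice z -> wp1 (Cconj z) = Cconj (wp1 z).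
Proof.
intros Hz.
assert (Hs : forall x, ~ hex_lattice x -> is_sum_over hex_lattice (fun w => / (x - w) ^ 3) (inv_pow_sum hex_lattice x 3)).
{ intros x Hx. destruct (hex_lattice_gap x Hx) as (d & Hd & H). now apply (inv_pow_is_sum _ x d 0). }
unfold wp1. rewrite Cmult_conj. f_equal; [unfold Cconj, RtoC; cbn; apply f_equal2; ring|].
apply (is_sum_over_unique hex_lattice (fun w => / (Cconj z - Cconj w) ^ 3)).
- apply (conj_reindex _ hex_lattice_conj (fun w => / (Cconj z - w) ^ 3)). now apply Hs, not_hex_conj.
- eapply is_sum_over_ext; [|apply is_sum_over_conj; now apply Hs].
  intros w _. cbv beta. now rewrite Cinv_conj_total, Cpow_conj, Cminus_conj.
Qed.

Lemma inv_pow_sum_periodic z v k : ~ hex_lattice z -> hex_lattice v ->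
  inv_pow_sum hex_lattice (z + v) (k + 3) = inv_pow_sum hex_lattice z (k + 3).
Proof.
intros Hz Hv.
assert (Hs : forall x, ~ hex_lattice x -> is_sum_over hex_lattice (fun w => / (x - w) ^ (k + 3)) (inv_pow_sum hex_lattice x (k + 3))).
{ intros x Hx. destruct (hex_lattice_gap x Hx) as (d & Hd & H). now apply (inv_pow_is_sum _ x d k). }
apply (is_sum_over_unique hex_lattice (fun w => / (z + v - (w + v)) ^ (k + 3))).
- apply (is_sum_over_reindex hex_lattice hex_lattice (fun w => w + v) (fun w => w - v)
    (fun w => / (z + v - w) ^ (k + 3))); [| |now apply Hs, not_hex_plus].
  + intros w Hw. split; [now apply hex_lattice_plus|ring].
  + intros w Hw. split; [now apply hex_lattice_minus|ring].
- eapply is_sum_over_ext; [|now apply Hs]. intros w _. cbv beta. do 2 f_equal. ring.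
Qed.

Lemma segment_gap z d h t :
  (forall w, hex_lattice w -> (d <= Cmod (z - w))%R) -> (Cmod h < d)%R -> (0 <= t <= 1)%R ->
  ~ hex_lattice (z + RtoC t * h).
Proof.
intros H Hh Ht. apply (gap_ball z d); auto. rewrite Cmod_mult, Cmod_R, Rabs_pos_eq by lra.
pose proof (Cmod_ge_0 h). nra.
Qed.

(** [wp (z + v) - wp z] has derivative zero, hence is constant; since [wp] is even it
    changes sign under [z -> - z - v], hence vanishes. *)
Lemma wp_periodic z v : ~ hex_lattice z -> hex_lattice v -> wp hex_lattice (z + v) = wp hex_lattice z.
Proof.
intros Hz Hv. set (D := fun x => wp hex_lattice (x + v) - wp hex_lattice x).
assert (HD : forall x y, ~ hex_lattice x -> ~ hex_lattice y -> D x = D y).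
{ apply locally_constant_off_hex. intros x Hx. destruct (hex_lattice_gap x Hx) as (d & Hd & Hgap).
  exists d. split; auto. intros h Hh.
  assert (E1 : x + RtoC 1 * h = x + h) by ring.
  assert (E0 : x + RtoC 0 * h = x) by ring. rewrite <- E1. rewrite <- E0 at 2.
  apply (pder_zero_const (fun t => D (x + RtoC t * h))). intros t Ht. unfold D.
  assert (Hn := segment_gap x d h t Hgap Hh Ht).
  eapply pder_eq.
  - apply pder_minus.
    + apply (pder_comp (wp hex_lattice) (fun t => x + RtoC t * h + v) t (wp1 (x + RtoC t * h + v)) h).
      * apply wp_Cder. now apply not_hex_plus.
      * apply (pder_ext (fun t => (x + v) + RtoC t * h)); [intros; ring|]. apply pder_affine.
    + apply (pder_comp (wp hex_lattice) (fun t => x + RtoC t * h) t (wp1 (x + RtoC t * h)) h).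
      * now apply wp_Cder.
      * apply pder_affine.
  - unfold wp1. rewrite (inv_pow_sum_periodic _ v 0); auto. cbn [Nat.add]. ring. }
assert (H1 : D (- z - v) = - D z).
{ unfold D. replace (- z - v + v) with (- z) by ring. replace (- z - v) with (- (z + v)) by ring.
  rewrite !wp_even; auto; [ring|]. now apply not_hex_plus. }
assert (Hzv : ~ hex_lattice (- z - v)).
{ replace (- z - v) with (- (z + v)) by ring. now apply not_hex_opp, not_hex_plus. }
rewrite (HD (- z - v) z Hzv Hz) in H1.
apply Ceq_minus. fold (D z). 
assert (E : 2 * D z = 0). { replace (2 * D z) with (D z - - D z) by ring. rewrite <- H1. ring. }
replace (D z) with (/ 2 * (2 * D z)).
- rewrite E. ring.
- field.
Qed.

Lemma wp2_periodic z v : ~ hex_lattice z -> hex_lattice v -> wp2 (z + v) = wp2 z.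
Proof. intros Hz Hv. exact (f_equal (fun s => 6 * s) (inv_pow_sum_periodic z v 1 Hz Hv)). Qed.

(** * The differential equation *)

Lemma hex_star_gap z w : (Cmod z < 1)%R -> hex_star w -> (1 - Cmod z <= Cmod (z - w))%R.
Proof.
intros Hz [Hw H0]. pose proof (hex_lattice_norm_ge_1 w Hw H0).
pose proof (Cmod_triangle z (- (z - w))) as T. rewrite Cmod_opp in T.
replace (z + - (z - w)) with w in T by ring. lra.
Qed.

(** The derivatives of the regular part at the origin. *)
Definition reg1 (z : C) : C := (-2) * inv_pow_sum hex_star z 3.
Definition reg2 (z : C) : C := 6 * inv_pow_sum hex_star z 4.

Lemma wp_reg_has_ps_at z0 : (Cmod z0 < 1)%R ->
  has_ps wp_reg z0 (wp_series hex_star wp_reg z0) (1 - Cmod z0).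
Proof.
intros Hz. apply wp_family_has_ps; [now intros w []|lra|intros w; now apply hex_star_gap|].
intros h Hh. assert (Cmod (z0 + h) < 1)%R by (eapply Rle_lt_trans; [apply Cmod_triangle|lra]).
apply (wp_reg_is_sum _ (1 - Cmod (z0 + h))); [lra|]. intros w; now apply hex_star_gap.
Qed.

Lemma wp_reg_Cder z : (Cmod z < 1)%R -> Cder wp_reg z (reg1 z).
Proof.
intros Hz. pose proof (has_ps_Cder_center _ _ _ _ (wp_reg_has_ps_at z Hz)) as HD.
cbn [wp_series Nat.add] in HD. unfold reg1.
replace (RtoC (-2)) with (RtoC ((-1) ^ 1 * INR 2)); auto.
f_equal. cbn. ring.
Qed.

Lemma reg1_has_ps z0 : (Cmod z0 < 1)%R ->
  has_ps reg1 z0 (fun n => RtoC (INR (S n)) * wp_series hex_star wp_reg z0 (S n)) (1 - Cmod z0).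
Proof.
intros Hz. apply (has_ps_Cder wp_reg); [now apply wp_reg_has_ps_at|].
intros h Hh. apply wp_reg_Cder. eapply Rle_lt_trans; [apply Cmod_triangle|lra].
Qed.

Lemma reg1_Cder z : (Cmod z < 1)%R -> Cder reg1 z (reg2 z).
Proof.
intros Hz. pose proof (has_ps_Cder_center _ _ _ _ (reg1_has_ps z Hz)) as HD.
cbn [wp_series Nat.add] in HD. unfold reg2.
replace (6 * inv_pow_sum hex_star z 4) with
  (RtoC (INR 2) * (RtoC ((-1) ^ 2 * INR 3) * inv_pow_sum hex_star z 4)); auto.
rewrite Cmult_assoc, <- RtoC_mult. f_equal. f_equal. cbn. ring.
Qed.

Lemma reg2_continuous_0 : Ccont reg2 0.
Proof.
assert (H0 : (Cmod 0 < 1)%R) by (rewrite Cmod_0; lra).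
eapply has_ps_continuous. apply (has_ps_Cder reg1); [apply (reg1_has_ps 0 H0)|].
intros h Hh. apply reg1_Cder. rewrite Cmod_0 in Hh. replace (0 + h) with h by ring. lra.
Qed.

Lemma wp2_eq z : ~ hex_lattice z -> (Cmod z < 1)%R -> wp2 z = 6 * / z ^ 4 + reg2 z.
Proof.
intros Hz Hz1. destruct (hex_lattice_gap z Hz) as (d & Hd & H).
unfold wp2, reg2. replace (6 * / z ^ 4 + 6 * inv_pow_sum hex_star z 4)
  with (6 * (/ z ^ 4 + inv_pow_sum hex_star z 4)) by ring. f_equal.
apply (is_sum_over_unique hex_lattice (fun w => / (z - w) ^ 4)).
- now apply (inv_pow_is_sum hex_lattice z d 1).
- replace (/ z ^ 4) with (/ (z - 0) ^ 4) by (do 2 f_equal; ring).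
  apply (is_sum_over_add_point hex_lattice 0 (fun w => / (z - w) ^ 4)); [exact hex_lattice_0|].
  apply (inv_pow_is_sum hex_star z d 1); auto; [now intros w []|]. intros w [Hw _]. now apply H.
Qed.

(** Reindexing by a rotation of the lattice; the sum vanishes as soon as the power
    of [u] differs from [1]. *)
Lemma eisenstein_rotation (u u' : C) k :
  u * u' = 1 ->
  (forall w, hex_lattice w -> hex_lattice (u * w)) ->
  (forall w, hex_lattice w -> hex_lattice (u' * w)) ->
  inv_pow_sum hex_star 0 (k + 3) = / u ^ (k + 3) * inv_pow_sum hex_star 0 (k + 3).
Proof.
intros Huu Hu Hu'.
assert (Hu0 : u <> 0) by (intros E; apply C1_nz; rewrite <- Huu, E; ring).
assert (Hu'0 : u' <> 0) by (intros E; apply C1_nz; rewrite <- Huu, E; ring).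
assert (Hs : is_sum_over hex_star (fun w => / (0 - w) ^ (k + 3)) (inv_pow_sum hex_star 0 (k + 3))).
{ apply (inv_pow_is_sum hex_star 0 1 k); [now intros w []|lra|]. intros w Hw.
  pose proof (hex_star_gap 0 w) as H. rewrite Cmod_0 in H. specialize (H Rlt_0_1 Hw). lra. }
apply (is_sum_over_unique hex_star (fun w => / (0 - u * w) ^ (k + 3))).
- apply (is_sum_over_reindex hex_star hex_star (fun w => u * w) (fun w => u' * w)
    (fun w => / (0 - w) ^ (k + 3))); auto.
  + intros w [Hw H0]. split; [split; [auto|now apply Cmult_neq_0]|].
    rewrite Cmult_assoc, (Cmult_comm u'), Huu. ring.
  + intros w [Hw H0]. split; [split; [auto|now apply Cmult_neq_0]|]. rewrite Cmult_assoc, Huu. ring.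
- eapply is_sum_over_ext; [|apply is_sum_over_scal, Hs].
  intros w _. cbv beta. replace (0 - u * w) with (u * (0 - w)) by ring.
  rewrite Cpow_mult_l, Cinv_mult_l; [reflexivity|now apply Cpow_nz].
Qed.

Lemma Ceq_0_of_mult (a b : C) : a <> 0 -> a * b = 0 -> b = 0.
Proof.
intros Ha H. replace b with (/ a * (a * b)) by (field; auto). rewrite H. ring.
Qed.

Lemma RtoC_nz (x : R) : x <> 0%R -> RtoC x <> 0.
Proof. intros H E. apply H. now apply RtoC_inj. Qed.

Lemma eisenstein_3 : inv_pow_sum hex_star 0 3 = 0.
Proof.
assert (Hneg : forall w, hex_lattice w -> hex_lattice ((-1) * w)).
{ intros w Hw. replace ((-1) * w) with (- w) by ring. now apply hex_lattice_opp. }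
assert (H := eisenstein_rotation (-1) (-1) 0 ltac:(ring) Hneg Hneg).
cbn [Nat.add] in H. set (s := inv_pow_sum hex_star 0 3) in *.
replace (/ (-1) ^ 3 * s) with (- s) in H by (field; apply RtoC_nz; lra).
apply (Ceq_0_of_mult 2); [apply RtoC_nz; lra|]. replace (2 * s) with (s - - s) by ring. rewrite <- H. ring.
Qed.

Lemma eisenstein_4 : inv_pow_sum hex_star 0 4 = 0.
Proof.
assert (H := eisenstein_rotation zeta6 (1 - zeta6) 1 zeta6_inv zeta6_lattice zeta6_inv_lattice).
cbn [Nat.add] in H. set (s := inv_pow_sum hex_star 0 4) in *.
assert (E : zeta6 ^ 4 = - zeta6).
{ replace (zeta6 ^ 4) with ((zeta6 * zeta6) * (zeta6 * zeta6)) by ring. rewrite zeta6_sq.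
  replace ((zeta6 - 1) * (zeta6 - 1)) with (zeta6 * zeta6 - 2 * zeta6 + 1) by ring. rewrite zeta6_sq. ring. }
rewrite E in H. apply (Ceq_0_of_mult (zeta6 + 1)).
- intros E0. apply (f_equal Re) in E0. cbn in E0. lra.
- replace ((zeta6 + 1) * s) with (zeta6 * s + s) by ring. rewrite H at 1. field. exact zeta6_nz.
Qed.

Lemma wp_reg_0 : wp_reg 0 = 0.
Proof.
assert (Hs : is_sum_over hex_star (wp_term 0) (wp_reg 0)).
{ apply (wp_reg_is_sum 0 1); [lra|]. intros w Hw.
  pose proof (hex_star_gap 0 w) as H. rewrite Cmod_0 in H. specialize (H Rlt_0_1 Hw). lra. }
apply (is_sum_over_unique _ _ _ _ Hs). replace (RtoC 0) with (0 * wp_reg 0) at 2 by ring.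
eapply is_sum_over_ext; [|apply is_sum_over_scal, Hs].
intros w _. cbv beta. unfold wp_term. replace ((0 - w) ^ 2) with (w ^ 2) by ring. ring.
Qed.

Lemma wp_reg_small : exists K r, (0 <= K)%R /\ (0 < r < 1)%R /\
  forall h, (Cmod h < r)%R -> (Cmod (wp_reg h) <= K * Cmod h ^ 3)%R.
Proof.
destruct (has_ps_taylor _ _ _ _ 2 wp_reg_has_ps) as (K & r & HK & Hr & H).
exists K, r. split; auto. split; auto. intros h Hh. specialize (H h Hh).
replace (0 + h) with h in H by ring.
rewrite !Csum_S, Csum_0 in H. cbn [wp_series Nat.add] in H.
rewrite wp_reg_0, eisenstein_3, eisenstein_4 in H.
match type of H with (Cmod ?x <= _)%R => replace x with (wp_reg h) in H by ring end. exact H.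
Qed.

Definition wp_defect (z : C) : C := wp hex_lattice z * wp hex_lattice z - / 6 * wp2 z.

Lemma C6_nz : RtoC 6 <> 0. Proof. apply RtoC_nz. lra. Qed.

Lemma small_not_hex h : (Cmod h < 1)%R -> h <> 0 -> ~ hex_lattice h.
Proof. intros H H0 Hn. pose proof (hex_lattice_norm_ge_1 h Hn H0). lra. Qed.

(** The polar parts of [wp ^ 2] and [wp2 / 6] agree, and the first coefficients
    of the regular part vanish by the hexagonal symmetry. *)
Lemma wp_defect_vanishes_at_0 eps : (0 < eps)%R ->
  exists d, (0 < d <= 1)%R /\ forall h : C, h <> 0 -> (Cmod h < d)%R -> (Cmod (wp_defect h) < eps)%R.
Proof.
intros He. destruct wp_reg_small as (K & r & HK & Hr & HA).
destruct (reg2_continuous_0 (eps)%R) as (d2 & Hd2 & H2); [lra|].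
assert (E2 : reg2 0 = 0) by (unfold reg2; rewrite eisenstein_4; ring).
set (d := Rmin (Rmin r d2) (eps / (2 * (2 * K + K * K + 1)))%R).
assert (HKK : (0 < 2 * K + K * K + 1)%R) by nra.
assert (Hd : (0 < d)%R) by (repeat apply Rmin_glb_lt; try lra; apply Rdiv_lt_0_compat; lra).
pose proof (Rmin_l (Rmin r d2) (eps / (2 * (2 * K + K * K + 1)))) as M1.
pose proof (Rmin_r (Rmin r d2) (eps / (2 * (2 * K + K * K + 1)))) as M2.
pose proof (Rmin_l r d2). pose proof (Rmin_r r d2). fold d in M1, M2.
exists d. split; [lra|]. intros h Hh0 Hh.
assert (Hh1 : (Cmod h < 1)%R) by lra.
assert (Hn := small_not_hex h Hh1 Hh0).
assert (E : wp_defect h = 2 * (wp_reg h / h ^ 2) + wp_reg h * wp_reg h - / 6 * reg2 h).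
{ unfold wp_defect. rewrite wp_eq, (wp2_eq h Hn Hh1). field. exact Hh0. }
rewrite E.
specialize (HA h ltac:(lra)). specialize (H2 h ltac:(lra)).
replace (0 + h) with h in H2 by ring. rewrite E2 in H2. replace (reg2 h - 0) with (reg2 h) in H2 by ring.
assert (Hp := proj1 (Cmod_gt_0 h) Hh0).
assert (A1 : (Cmod (wp_reg h / h ^ 2) <= K * Cmod h)%R).
{ rewrite Cmod_div, Cmod_pow by now apply Cpow_nz.
  apply Rmult_le_reg_r with (Cmod h ^ 2)%R; [now apply pow_lt|].
  unfold Rdiv. rewrite Rmult_assoc, Rinv_l by (apply pow_nonzero; lra). lra. }
assert (A2 : (Cmod (wp_reg h * wp_reg h) <= K * K * Cmod h)%R).
{ rewrite Cmod_mult. pose proof (Cmod_ge_0 (wp_reg h)).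
  assert (Hh3 : (0 <= Cmod h ^ 3 <= Cmod h)%R).
  { split; [apply pow_le; lra|]. replace (Cmod h ^ 3)%R with (Cmod h * (Cmod h * Cmod h))%R by ring. 
    rewrite <- (Rmult_1_r (Cmod h)) at 4. apply Rmult_le_compat_l; nra. }
  apply Rle_trans with ((K * Cmod h ^ 3) * (K * Cmod h ^ 3))%R; [apply Rmult_le_compat; auto|].
  replace ((K * Cmod h ^ 3) * (K * Cmod h ^ 3))%R with (K * K * (Cmod h ^ 3 * Cmod h ^ 3))%R by ring.
  apply Rmult_le_compat_l; nra. }
eapply Rle_lt_trans; [apply Cmod_triangle|]. rewrite Cmod_opp.
eapply Rle_lt_trans; [apply Rplus_le_compat_r, Cmod_triangle|].
rewrite (Cmod_mult 2), (Cmod_mult (/ 6)), Cmod_inv, !Cmod_R, !Rabs_pos_eq by (try exact C6_nz; lra).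
assert (Hlin : ((2 * K + K * K) * Cmod h <= eps / 2)%R).
{ apply Rle_trans with ((2 * K + K * K + 1) * (eps / (2 * (2 * K + K * K + 1))))%R.
  - apply Rmult_le_compat; try lra; nra.
  - apply Req_le. field. lra. }
lra.
Qed.

Lemma wp_defect_has_ps z0 : ~ hex_lattice z0 -> exists a d, has_ps wp_defect z0 a d.
Proof.
intros Hz. destruct (hex_lattice_gap z0 Hz) as (d & Hd & H).
destruct (wp2_has_ps z0 d Hd H) as (b & Hb).
eexists; exists d.
apply (has_ps_ext (fun z => 1 * (wp hex_lattice z * wp hex_lattice z) + (- / 6) * wp2 z)).
- intros h _. unfold wp_defect. ring.
- apply (has_ps_lin (fun z => wp hex_lattice z * wp hex_lattice z) wp2); [|exact Hb].
  apply has_ps_mult; now apply wp_has_ps.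
Qed.

Lemma wp_defect_periodic z v : ~ hex_lattice z -> hex_lattice v -> wp_defect (z + v) = wp_defect z.
Proof. intros Hz Hv. unfold wp_defect. now rewrite wp_periodic, wp2_periodic. Qed.

Lemma hex_rectangle (z : C) : exists v, hex_lattice v /\
  (0 <= Re (z - v) <= sqrt 3)%R /\ (0 <= Im (z - v) <= 1)%R.
Proof.
pose proof sqrt3_pos as H3.
assert (Hfl : forall x, exists k : Z, (0 <= x - IZR k <= 1)%R).
{ intros x. destruct (archimed x) as [H1 H2]. exists (up x - 1)%Z. rewrite minus_IZR. lra. }
destruct (Hfl (Re z / sqrt 3)%R) as (k & Hk). destruct (Hfl (Im z)) as (l & Hl).
exists (hexpt (k + l) (k - l)). split; [apply hex_lattice_iff; eauto|].
unfold Cminus. rewrite re_plus, im_plus, re_opp, im_opp. unfold hexpt, Re, Im in *; cbn [fst snd].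
rewrite !plus_IZR, !minus_IZR. split.
- replace (fst z + - (sqrt 3 / 2 * (IZR k + IZR l + (IZR k - IZR l))))%R
    with (sqrt 3 * (fst z / sqrt 3 - IZR k))%R by (field; lra). nra.
- replace (snd z + - ((IZR k + IZR l - (IZR k - IZR l)) / 2))%R with (snd z - IZR l)%R by field. exact Hl.
Qed.

(** The modulus of the defect with the value [0] at the lattice, its continuous
    extension by [wp_defect_vanishes_at_0]. *)
Definition wp_defect_norm (z : C) : R :=
  if excluded_middle_informative (hex_lattice z) then 0%R else Cmod (wp_defect z).

Lemma wp_defect_norm_off z : ~ hex_lattice z -> wp_defect_norm z = Cmod (wp_defect z).
Proof. intros H. unfold wp_defect_norm. now destruct (excluded_middle_informative _). Qed.

Lemma wp_defect_norm_on z : hex_lattice z -> wp_defect_norm z = 0%R.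
Proof. intros H. unfold wp_defect_norm. now destruct (excluded_middle_informative _). Qed.

Lemma wp_defect_norm_periodic z v : hex_lattice v -> wp_defect_norm (z + v) = wp_defect_norm z.
Proof.
intros Hv. destruct (classic (hex_lattice z)) as [Hz|Hz].
- rewrite !wp_defect_norm_on; auto. now apply hex_lattice_plus.
- rewrite !wp_defect_norm_off; auto; [|now apply not_hex_plus]. now rewrite wp_defect_periodic.
Qed.

Lemma Cmod_lipschitz (x y : C) : (Rabs (Cmod x - Cmod y) <= Cmod (x - y))%R.
Proof.
pose proof (Cmod_triangle (x - y) y) as H1. pose proof (Cmod_triangle (y - x) x) as H2.
replace (x - y + y) with x in H1 by ring. replace (y - x + x) with y in H2 by ring.
rewrite (Cmod_minus_sym y x) in H2. apply Rabs_le. lra.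
Qed.

Lemma wp_defect_norm_continuous z eps : (0 < eps)%R ->
  exists r, (0 < r)%R /\ forall w, (Cmod (w - z) < r)%R ->
    (Rabs (wp_defect_norm w - wp_defect_norm z) < eps)%R.
Proof.
intros He. destruct (classic (hex_lattice z)) as [Hz|Hz].
- destruct (wp_defect_vanishes_at_0 eps He) as (d & Hd & H). exists d. split; [lra|].
  intros w Hw. rewrite (wp_defect_norm_on z Hz), Rminus_0_r.
  replace w with ((w - z) + z) at 1 by ring. rewrite wp_defect_norm_periodic by auto.
  destruct (Ceq_dec (w - z) 0) as [->|Hne].
  + rewrite wp_defect_norm_on by exact hex_lattice_0. rewrite Rabs_R0. exact He.
  + rewrite wp_defect_norm_off by (apply small_not_hex; auto; lra).
    rewrite Rabs_pos_eq by apply Cmod_ge_0. now apply H.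
- destruct (wp_defect_has_ps z Hz) as (a & d & Hps).
  destruct (has_ps_continuous _ _ _ _ Hps eps He) as (r & Hr & H).
  destruct (hex_lattice_gap z Hz) as (g & Hg & Hgap).
  exists (Rmin r g). split; [now apply Rmin_glb_lt|]. intros w Hw.
  destruct (Rlt_Rmin _ _ _ Hw) as [H1 H2].
  replace w with (z + (w - z)) at 1 by ring.
  rewrite !wp_defect_norm_off; auto; [|now apply (gap_ball z g)].
  eapply Rle_lt_trans; [apply Cmod_lipschitz|]. now apply H.
Qed.

(** The defect is doubly periodic and its modulus attains its maximum; by the maximum
    principle it is constant, and it tends to [0] at the lattice. *)
Lemma wp_second_derivative z : ~ hex_lattice z -> wp2 z = 6 * (wp hex_lattice z * wp hex_lattice z).
Proof.
intros Hz. pose proof sqrt3_pos as H3.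
destruct (box_maximum wp_defect_norm 0 (sqrt 3) 0 1) as (z0 & _ & _ & Hmax);
  [lra|lra|exact wp_defect_norm_continuous|].
assert (Hglob : forall w, (wp_defect_norm w <= wp_defect_norm z0)%R).
{ intros w. destruct (hex_rectangle w) as (v & Hv & H1 & H2).
  replace w with ((w - v) + v) by ring. rewrite wp_defect_norm_periodic by auto. now apply Hmax. }
assert (Hzero : wp_defect_norm z0 = 0%R).
{ apply NNPP. intros Hne.
  assert (Hz0 : ~ hex_lattice z0) by (intros H; apply Hne; now apply wp_defect_norm_on).
  assert (Hpos : (0 < wp_defect_norm z0)%R).
  { rewrite wp_defect_norm_off in * by auto. pose proof (Cmod_ge_0 (wp_defect z0)). lra. }
  assert (Hloc : forall w, ~ hex_lattice w -> wp_defect w = wp_defect z0 ->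
    exists r, (0 < r)%R /\ forall h, (Cmod h < r)%R -> wp_defect (w + h) = wp_defect z0).
  { intros w Hw E. destruct (wp_defect_has_ps w Hw) as (a & d & Hps).
    destruct (hex_lattice_gap w Hw) as (g & Hg & Hgap).
    destruct (max_principle _ _ _ _ Hps) as (r & Hr & H).
    - exists g. split; auto. intros h Hh. rewrite E.
      rewrite <- (wp_defect_norm_off z0 Hz0), <- (wp_defect_norm_off (w + h)); [apply Hglob|].
      now apply (gap_ball w g).
    - exists r. split; auto. intros h Hh. now rewrite H. }
  assert (Hall : forall w, ~ hex_lattice w -> wp_defect w = wp_defect z0).
  { intros w Hw. apply NNPP. intros Hne'.
    destruct (hex_complement_connected
      (fun x => ~ hex_lattice x /\ wp_defect x = wp_defect z0)
      (fun x => ~ hex_lattice x /\ wp_defect x <> wp_defect z0)) as (x & _ & [_ H1] & [_ H2]);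
      [| | | | |contradiction].
    - now apply hex_complement_open.
    - apply hex_complement_open. intros x Hx Hxne.
      destruct (wp_defect_has_ps x Hx) as (a & d & Hps).
      assert (Hp : (0 < Cmod (wp_defect x - wp_defect z0))%R) by now apply Cmod_gt_0, Cminus_eq_contra.
      destruct (has_ps_continuous _ _ _ _ Hps _ Hp) as (r & Hr & H).
      exists r. split; auto. intros h Hh E. specialize (H h Hh). rewrite E, Cmod_minus_sym in H. lra.
    - intros x Hx. destruct (classic (wp_defect x = wp_defect z0)); auto.
    - exists z0. auto.
    - exists w. auto. }
  destruct (wp_defect_vanishes_at_0 _ Hpos) as (d & Hd & H).
  assert (Hm : Cmod (RtoC (d / 2)) = (d / 2)%R) by (rewrite Cmod_R; apply Rabs_pos_eq; lra).
  assert (Hd0 : RtoC (d / 2) <> 0) by (apply RtoC_nz; lra).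
  specialize (H (RtoC (d / 2)) Hd0 ltac:(lra)).
  rewrite Hall in H by (apply small_not_hex; auto; lra).
  rewrite wp_defect_norm_off in H by auto. lra. }
specialize (Hglob z). rewrite Hzero, (wp_defect_norm_off z Hz) in Hglob.
assert (E : wp_defect z = 0) by (apply Cmod_eq_0; pose proof (Cmod_ge_0 (wp_defect z)); lra).
unfold wp_defect in E.
replace (wp2 z) with (6 * (wp hex_lattice z * wp hex_lattice z)
  - 6 * (wp hex_lattice z * wp hex_lattice z - / 6 * wp2 z)) by field.
rewrite E. ring.
Qed.

Lemma pder_line (f : C -> C) (f' : C -> C) z h t :
  Cder f (z + RtoC t * h) (f' (z + RtoC t * h)) ->
  pder (fun t => f (z + RtoC t * h)) t (f' (z + RtoC t * h) * h).
Proof. intros H. apply (pder_comp f (fun t => z + RtoC t * h)); [exact H|apply pder_affine]. Qed.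

Definition wp_energy (z : C) : C := wp1 z ^ 2 - 4 * wp hex_lattice z ^ 3.

(** The derivative is [2 wp' (wp'' - 6 wp ^ 2) = 0]. *)
Lemma wp_energy_constant z z' : ~ hex_lattice z -> ~ hex_lattice z' -> wp_energy z = wp_energy z'.
Proof.
apply locally_constant_off_hex. clear z z'. intros z Hz.
destruct (hex_lattice_gap z Hz) as (d & Hd & Hgap). exists d. split; auto. intros h Hh.
assert (E1 : z + RtoC 1 * h = z + h) by ring. assert (E0 : z + RtoC 0 * h = z) by ring.
rewrite <- E1. rewrite <- E0 at 2.
apply (pder_zero_const (fun t => wp_energy (z + RtoC t * h))). intros t Ht.
assert (Hn := segment_gap z d h t Hgap Hh Ht). unfold wp_energy.
eapply pder_eq.
- apply pder_minus; [|apply pder_scal]; apply pder_pow; apply pder_line; [now apply wp1_Cder|now apply wp_Cder].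
- rewrite wp_second_derivative by auto. cbn [INR pred].
  rewrite !RtoC_plus. ring.
Qed.

(** The centre of a lattice triangle is fixed, modulo the lattice, by the rotation
    by [2 pi / 3], which forces a zero of [wp]. *)
Definition centre : R := (/ sqrt 3)%R.

Lemma centre_not_hex : ~ hex_lattice (RtoC centre).
Proof.
intros H. apply hex_lattice_iff in H. destruct H as (m & n & E).
apply (f_equal Re) in E. unfold hexpt, Re, RtoC, centre in E; cbn [fst] in E.
pose proof sqrt3_sq. pose proof sqrt3_pos.
assert (E2 : (2 = 3 * IZR (m + n))%R).
{ rewrite plus_IZR. apply (f_equal (fun x => 2 * sqrt 3 * x)%R) in E.
  replace (2 * sqrt 3 * / sqrt 3)%R with 2%R in E by (field; lra). rewrite E.
  replace (2 * sqrt 3 * (sqrt 3 / 2 * (IZR m + IZR n)))%R with ((sqrt 3 * sqrt 3) * (IZR m + IZR n))%R by field.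
  rewrite sqrt3_sq. reflexivity. }
rewrite <- mult_IZR in E2. apply eq_IZR in E2. lia.
Qed.

Lemma wp_centre : wp hex_lattice (RtoC centre) = 0.
Proof.
assert (Hc := centre_not_hex). set (c := RtoC centre) in *.
assert (Hv : hex_lattice (hexpt 0 (-1))) by (apply hex_lattice_iff; eauto).
assert (E : zeta6 * (zeta6 * c) = c + hexpt 0 (-1)).
{ rewrite Cmult_assoc, zeta6_sq. unfold c, centre, zeta6, hexpt, Cminus, Cmult, Cplus, Copp, RtoC; cbn [fst snd].
  pose proof sqrt3_sq. pose proof sqrt3_pos. apply f_equal2.
  - rewrite Ropp_0. apply (Rmult_eq_reg_r (sqrt 3)); [|lra]. field_simplify; [|lra|lra].
    replace (sqrt 3 ^ 2)%R with 3%R by (cbn; lra). field.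
  - field. lra. }
assert (H : wp hex_lattice c = / zeta6 ^ 2 * (/ zeta6 ^ 2 * wp hex_lattice c)).
{ rewrite <- wp_zeta6, <- wp_zeta6 by (try apply not_hex_zeta6; auto). rewrite E. now rewrite wp_periodic. }
set (x := wp hex_lattice c) in *.
assert (E2 : zeta6 ^ 2 = zeta6 - 1) by (rewrite <- zeta6_sq; ring).
assert (E4 : (zeta6 ^ 2) * (zeta6 ^ 2) = - zeta6).
{ rewrite E2. replace ((zeta6 - 1) * (zeta6 - 1)) with (zeta6 * zeta6 - 2 * zeta6 + 1) by ring. rewrite zeta6_sq. ring. }
assert (H' : - zeta6 * x = x).
{ rewrite <- E4. rewrite H at 1. field. exact zeta6_nz. }
apply (Ceq_0_of_mult (zeta6 + 1)).
- intros E0. apply (f_equal Re) in E0. cbn in E0. lra.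
- replace ((zeta6 + 1) * x) with (x - (- zeta6 * x)) by ring. rewrite H'. ring.
Qed.

(** * Uniqueness for the system [p' = 2 q, q' = 3 p ^ 2] *)

Lemma pder_continuous (g : R -> C) s l eps : pder g s l -> (0 < eps)%R ->
  exists d, (0 < d)%R /\ forall t, (Rabs (t - s) < d)%R -> (Cmod (g t - g s) < eps)%R.
Proof.
intros Hg He. destruct (proj1 (pder_eps g s l) Hg 1%R Rlt_0_1) as (d & Hd & H).
pose proof (Cmod_ge_0 l) as Hl.
exists (Rmin d (eps / (Cmod l + 1)))%R. split; [apply Rmin_glb_lt; auto; apply Rdiv_lt_0_compat; lra|].
intros t Ht.
destruct (Rlt_Rmin _ _ _ Ht) as [H1 H2].
specialize (H (t - s)%R H1). replace (s + (t - s))%R with t in H by ring.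
replace (g t - g s) with ((g t - g s - l * RtoC (t - s)) + l * RtoC (t - s)) by ring.
eapply Rle_lt_trans; [apply Cmod_triangle|]. rewrite Cmod_mult, Cmod_R.
apply (Rmult_lt_compat_l (Cmod l + 1)) in H2; [|lra].
replace ((Cmod l + 1) * (eps / (Cmod l + 1)))%R with eps in H2 by (field; lra). lra.
Qed.

Lemma path_bounded (g : R -> C) :
  (forall s, (0 <= s <= 1)%R -> exists l, pder g s l) ->
  exists M, forall s, (0 <= s <= 1)%R -> (Cmod (g s) <= M)%R.
Proof.
intros H. apply (cousin 0 1 (fun u v => exists M, forall s, (u <= s <= v)%R -> (Cmod (g s) <= M)%R)); [lra| |].
- intros u v w _ _ (M1 & H1) (M2 & H2). exists (Rmax M1 M2). intros s Hs.
  destruct (Rle_dec s v).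
  + eapply Rle_trans; [apply H1; lra|apply Rmax_l].
  + eapply Rle_trans; [apply H2; lra|apply Rmax_r].
- intros x Hx. destruct (H x Hx) as (l & Hl).
  destruct (pder_continuous g x l 1 Hl Rlt_0_1) as (d & Hd & Hc).
  exists d. split; auto. intros u v Hu Hv Hu' Hv'. exists (Cmod (g x) + 1)%R. intros s Hs.
  specialize (Hc s ltac:(apply Rabs_def1; lra)).
  replace (g s) with ((g s - g x) + g x) by ring.
  eapply Rle_trans; [apply Cmod_triangle|]. lra.
Qed.

Lemma is_derive_nonpos_le (f df : R -> R) a b : (a <= b)%R ->
  (forall t, (a <= t <= b)%R -> is_derive f t (df t)) ->
  (forall t, (a <= t <= b)%R -> (df t <= 0)%R) -> (f b <= f a)%R.
Proof.
intros Hab Hf Hd. destruct (MVT_gen f a b df) as (c & Hc & E).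
- intros x Hx. rewrite Rmin_left, Rmax_right in Hx by lra. apply Hf. lra.
- intros x Hx. rewrite Rmin_left, Rmax_right in Hx by lra.
  apply continuity_pt_filterlim, (ex_derive_continuous (V := R_NormedModule)). eexists. apply Hf. lra.
- rewrite Rmin_left, Rmax_right in Hc by lra. specialize (Hd c Hc). nra.
Qed.

Lemma Cmod_sq (c : C) : (Cmod c * Cmod c = Re c * Re c + Im c * Im c)%R.
Proof. pose proof (Cmod2_alt c). lra. Qed.

Lemma Cmod_cauchy_schwarz (c d : C) : (Re c * Re d + Im c * Im d <= Cmod c * Cmod d)%R.
Proof.
replace (Re c * Re d + Im c * Im d)%R with (Re (Cconj c * d)).
- rewrite <- (Cmod_conj c), <- Cmod_mult. eapply Rle_trans; [apply Rle_abs|apply re_le_Cmod].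
- rewrite re_mult, re_conj, im_conj. ring.
Qed.

Lemma is_derive_sq_sum_exp (x1 y1 x2 y2 : R -> R) s a1 b1 a2 b2 L :
  is_derive x1 s a1 -> is_derive y1 s b1 -> is_derive x2 s a2 -> is_derive y2 s b2 ->
  is_derive (fun s => ((x1 s * x1 s + y1 s * y1 s + (x2 s * x2 s + y2 s * y2 s)) * exp (- L * s))%R) s
    ((2 * (x1 s * a1 + y1 s * b1) + 2 * (x2 s * a2 + y2 s * b2)
      - L * (x1 s * x1 s + y1 s * y1 s + (x2 s * x2 s + y2 s * y2 s))) * exp (- L * s))%R.
Proof.
intros A1 A2 A3 A4. auto_derive.
- repeat split; eexists; eassumption.
- assert (E1 : Derive (fun x : R => x1 x) s = a1) by exact (is_derive_unique _ _ _ A1).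
  assert (E2 : Derive (fun x : R => y1 x) s = b1) by exact (is_derive_unique _ _ _ A2).
  assert (E3 : Derive (fun x : R => x2 x) s = a2) by exact (is_derive_unique _ _ _ A3).
  assert (E4 : Derive (fun x : R => y2 x) s = b2) by exact (is_derive_unique _ _ _ A4).
  rewrite E1, E2, E3, E4. ring.
Qed.

(** Gronwall's argument, for the squared distance of two solutions; the common
    factor [lam] allows for a change of time along the path. *)
Lemma ode_unique (p q P Q lam : R -> C) :
  (forall s, (0 <= s <= 1)%R -> pder p s (2 * q s * lam s)) ->
  (forall s, (0 <= s <= 1)%R -> pder q s (3 * p s ^ 2 * lam s)) ->
  (forall s, (0 <= s <= 1)%R -> pder P s (2 * Q s * lam s)) ->
  (forall s, (0 <= s <= 1)%R -> pder Q s (3 * P s ^ 2 * lam s)) ->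
  (forall s, (0 <= s <= 1)%R -> exists l, pder lam s l) ->
  p 0%R = P 0%R -> q 0%R = Q 0%R ->
  p 1%R = P 1%R /\ q 1%R = Q 1%R.
Proof.
intros Hp Hq HP HQ Hlam Ep Eq.
destruct (path_bounded lam Hlam) as (M1 & B1).
destruct (path_bounded p) as (M2 & B2); [intros; eexists; now apply Hp|].
destruct (path_bounded P) as (M3 & B3); [intros; eexists; now apply HP|].
set (M := Rmax M1 (Rmax M2 M3)).
assert (BM : forall s, (0 <= s <= 1)%R -> (Cmod (lam s) <= M /\ Cmod (p s) <= M /\ Cmod (P s) <= M)%R).
{ intros s Hs. unfold M. pose proof (Rmax_l M1 (Rmax M2 M3)). pose proof (Rmax_r M1 (Rmax M2 M3)).
  pose proof (Rmax_l M2 M3). pose proof (Rmax_r M2 M3).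
  specialize (B1 s Hs). specialize (B2 s Hs). specialize (B3 s Hs). lra. }
set (d1 := fun s => p s - P s). set (d2 := fun s => q s - Q s).
set (d1' := fun s => 2 * d2 s * lam s). set (d2' := fun s => 3 * (p s + P s) * d1 s * lam s).
assert (D1 : forall s, (0 <= s <= 1)%R -> pder d1 s (d1' s)).
{ intros s Hs. eapply pder_eq; [apply pder_minus; [now apply Hp|now apply HP]|]. unfold d1', d2. ring. }
assert (D2 : forall s, (0 <= s <= 1)%R -> pder d2 s (d2' s)).
{ intros s Hs. eapply pder_eq; [apply pder_minus; [now apply Hq|now apply HQ]|]. unfold d2', d1. ring. }
set (E := fun s => (Re (d1 s) * Re (d1 s) + Im (d1 s) * Im (d1 s)
  + (Re (d2 s) * Re (d2 s) + Im (d2 s) * Im (d2 s)))%R).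
set (L := (2 * M + 6 * M * M)%R).
set (G := fun s => (E s * exp (- L * s))%R).
set (G' := fun s => ((2 * (Re (d1 s) * Re (d1' s) + Im (d1 s) * Im (d1' s))
  + 2 * (Re (d2 s) * Re (d2' s) + Im (d2 s) * Im (d2' s)) - L * E s) * exp (- L * s))%R).
assert (HG : (G 1 <= G 0)%R).
{ apply (is_derive_nonpos_le G G'); [lra| |].
  - intros s Hs. destruct (D1 s Hs) as [A1 A2]. destruct (D2 s Hs) as [A3 A4].
    eapply is_derive_eq;
      [exact (is_derive_sq_sum_exp _ _ _ _ s _ _ _ _ L A1 A2 A3 A4)|].
    unfold G', E. ring.
  - intros s Hs. unfold G'. pose proof (exp_pos (- L * s)) as Hexp.
    destruct (BM s Hs) as (K1 & K2 & K3).
    pose proof (Cmod_cauchy_schwarz (d1 s) (d1' s)) as C1.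
    pose proof (Cmod_cauchy_schwarz (d2 s) (d2' s)) as C2.
    pose proof (Cmod_ge_0 (d1 s)) as N1. pose proof (Cmod_ge_0 (d2 s)) as N2.
    pose proof (Cmod_ge_0 (lam s)) as N3. pose proof (Cmod_ge_0 (p s)) as N4.
    assert (S1 : (Cmod (d1' s) <= 2 * M * Cmod (d2 s))%R).
    { unfold d1'. rewrite !Cmod_mult, Cmod_R, Rabs_pos_eq by lra. nra. }
    assert (S2 : (Cmod (d2' s) <= 6 * M * M * Cmod (d1 s))%R).
    { unfold d2'. rewrite !Cmod_mult, Cmod_R, Rabs_pos_eq by lra.
      assert (Cmod (p s + P s) <= 2 * M)%R by (eapply Rle_trans; [apply Cmod_triangle|lra]).
      pose proof (Cmod_ge_0 (p s + P s)).
      assert (Cmod (p s + P s) * Cmod (lam s) <= 2 * M * M)%R by (apply Rmult_le_compat; auto).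
      replace (3 * Cmod (p s + P s) * Cmod (d1 s) * Cmod (lam s))%R
        with (3 * (Cmod (p s + P s) * Cmod (lam s)) * Cmod (d1 s))%R by ring.
      apply Rmult_le_compat_r; lra. }
    assert (HE : E s = (Cmod (d1 s) * Cmod (d1 s) + Cmod (d2 s) * Cmod (d2 s))%R) by (unfold E; now rewrite !Cmod_sq).
    set (x := Cmod (d1 s)) in *. set (y := Cmod (d2 s)) in *.
    assert (T1 : (x * Cmod (d1' s) <= x * (2 * M * y))%R) by (apply Rmult_le_compat_l; auto).
    assert (T2 : (y * Cmod (d2' s) <= y * (6 * M * M * x))%R) by (apply Rmult_le_compat_l; auto).
    assert (HM : (0 <= M)%R) by lra.
    assert (T3 : (2 * (x * y) <= x * x + y * y)%R) by (pose proof (pow2_ge_0 (x - y)); nra).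
    assert (HL : (0 <= L)%R) by (unfold L; nra).
    assert (T4 : (L * (2 * (x * y)) <= L * (x * x + y * y))%R) by (apply Rmult_le_compat_l; auto).
    rewrite HE.
    match goal with |- (?A * _ <= 0)%R => assert (HA : (A <= 0)%R) end;
      [|rewrite <- (Rmult_0_l (exp (- L * s))); apply Rmult_le_compat_r; lra].
    replace (L * (2 * (x * y)))%R with (2 * (x * (2 * M * y)) + 2 * (y * (6 * M * M * x)))%R in T4
      by (unfold L; ring). lra. }
unfold G in HG. replace (exp (- L * 0)) with 1%R in HG by (rewrite Rmult_0_r, exp_0; reflexivity).
rewrite (Rmult_1_r (E 0%R)) in HG.
assert (E0 : E 0%R = 0%R).
{ unfold E, d1, d2. rewrite Ep, Eq. unfold Cminus. rewrite !Cplus_opp_r. cbn. ring. }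
rewrite E0 in HG. pose proof (exp_pos (- L * 1)) as Hexp.
assert (HE1 : (E 1 <= 0)%R).
{ apply Rmult_le_reg_r with (exp (- L * 1)); [exact Hexp|]. rewrite Rmult_0_l. exact HG. }
unfold E in HE1. rewrite <- !Cmod_sq in HE1.
pose proof (Cmod_ge_0 (d1 1%R)). pose proof (Cmod_ge_0 (d2 1%R)).
split; apply Ceq_minus, Cmod_eq_0; [fold (d1 1%R)|fold (d2 1%R)]; nra.
Qed.

(** * The Weierstrass function on the real axis *)

Lemma real_not_hex t : (0 < t < sqrt 3)%R -> ~ hex_lattice (RtoC t).
Proof.
intros Ht H. apply hex_lattice_iff in H. destruct H as (m & n & E). pose proof sqrt3_pos.
assert (E1 := f_equal Re E). assert (E2 := f_equal Im E). clear E.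
unfold hexpt, Re, Im, RtoC in *; cbn [fst snd] in *.
assert (IZR m = IZR n) as Emn by lra. rewrite Emn in E1.
replace (sqrt 3 / 2 * (IZR n + IZR n))%R with (sqrt 3 * IZR n)%R in E1 by field.
assert (0 < IZR n < 1)%R as [Hn1 Hn2] by (split; nra).
apply lt_IZR in Hn1. apply lt_IZR in Hn2. lia.
Qed.

Definition wpR (t : R) : R := Re (wp hex_lattice (RtoC t)).
Definition wpR1 (t : R) : R := Re (wp1 (RtoC t)).

Lemma real_of_conj (c : C) : Cconj c = c -> c = RtoC (Re c).
Proof.
intros H. apply (f_equal Im) in H. rewrite im_conj in H. destruct c as [x y].
unfold Re, Im, RtoC in *; cbn in *. f_equal. lra.
Qed.

Lemma Cconj_R (t : R) : Cconj (RtoC t) = RtoC t.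
Proof. unfold Cconj, RtoC; cbn. f_equal. ring. Qed.

Lemma wp_real t : (0 < t < sqrt 3)%R -> wp hex_lattice (RtoC t) = RtoC (wpR t).
Proof. intros Ht. apply real_of_conj. rewrite <- wp_conj by now apply real_not_hex. now rewrite Cconj_R. Qed.

Lemma wp1_real t : (0 < t < sqrt 3)%R -> wp1 (RtoC t) = RtoC (wpR1 t).
Proof. intros Ht. apply real_of_conj. rewrite <- wp1_conj by now apply real_not_hex. now rewrite Cconj_R. Qed.

Lemma pder_real (f : C -> C) t l : Cder f (RtoC t) l -> pder (fun t => f (RtoC t)) t l.
Proof.
intros H. eapply pder_eq; [apply (pder_comp f RtoC t l 1 H)|ring].
apply (pder_ext (fun t => 0 + RtoC t * 1)); [intros; ring|apply pder_affine].
Qed.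

Lemma wpR_derive t : (0 < t < sqrt 3)%R -> is_derive wpR t (wpR1 t).
Proof. intros Ht. apply (pder_real (wp hex_lattice)), wp_Cder, real_not_hex, Ht. Qed.

Lemma wpR1_derive t : (0 < t < sqrt 3)%R -> is_derive wpR1 t (6 * (wpR t * wpR t))%R.
Proof.
intros Ht. eapply is_derive_eq; [apply (pder_real wp1), wp1_Cder, real_not_hex, Ht|].
rewrite wp_second_derivative by now apply real_not_hex. rewrite wp_real by auto.
rewrite <- !RtoC_mult. reflexivity.
Qed.

Definition wp_k : R := (wpR1 centre * wpR1 centre)%R.

Lemma centre_bounds : (0 < centre < sqrt 3 / 2)%R.
Proof.
unfold centre. pose proof sqrt3_pos as H. pose proof sqrt3_sq as H2. split; [now apply Rinv_0_lt_compat|].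
apply Rmult_lt_reg_r with (sqrt 3); auto. rewrite Rinv_l by lra. lra.
Qed.

Lemma wpR_energy t : (0 < t < sqrt 3)%R -> (wpR1 t * wpR1 t = 4 * (wpR t * wpR t * wpR t) + wp_k)%R.
Proof.
intros Ht. pose proof centre_bounds as Hc.
assert (E := wp_energy_constant (RtoC t) (RtoC centre) (real_not_hex t Ht) centre_not_hex).
unfold wp_energy in E. rewrite wp_centre, wp_real, !wp1_real in E by lra.
replace (4 * RtoC 0 ^ 3) with (RtoC 0) in E by ring.
rewrite <- !RtoC_pow, <- !RtoC_mult, <- !RtoC_minus in E.
apply RtoC_inj in E. unfold wp_k. lra.
Qed.

Lemma wpR_symmetric t : (0 < t < sqrt 3)%R -> wpR (sqrt 3 - t) = wpR t.
Proof.
intros Ht. unfold wpR. f_equal. rewrite RtoC_minus.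
replace (RtoC (sqrt 3) - RtoC t) with (- RtoC t + RtoC (sqrt 3)) by ring.
rewrite wp_periodic.
- apply wp_even. now apply real_not_hex.
- apply not_hex_opp. now apply real_not_hex.
- apply hex_lattice_iff. exists 1%Z, 1%Z. unfold hexpt, RtoC. apply f_equal2; field.
Qed.

(** The reflection [t -> sqrt 3 - t] preserves [wp]. *)
Lemma wpR1_half : wpR1 (sqrt 3 / 2) = 0%R.
Proof.
pose proof sqrt3_pos as H3. set (h := (sqrt 3 / 2)%R). assert (Hh : (0 < h < sqrt 3)%R) by (unfold h; lra).
assert (H := wpR_derive h Hh).
assert (H' : is_derive (fun t => wpR (sqrt 3 - t)) h (- wpR1 h)%R).
{ eapply is_derive_eq.
  - apply (is_derive_comp wpR (fun t => sqrt 3 - t)%R h (wpR1 h) (-1)%R).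
    + replace (sqrt 3 - h)%R with h by (unfold h; field). exact H.
    + auto_derive; auto; ring.
  - change (-1 * wpR1 h = - wpR1 h)%R. ring. }
assert (H'' : is_derive wpR h (- wpR1 h)%R).
{ eapply is_derive_ext_loc; [|exact H'].
  assert (Hd : (0 < h)%R) by lra. exists (mkposreal h Hd). intros y Hy. apply wpR_symmetric.
  apply Rabs_def2 in Hy. unfold minus, plus, opp in Hy; cbn in Hy. unfold h in *. lra. }
apply is_derive_unique in H, H''. lra.
Qed.

Lemma wpR1_nonpos t : (0 < t <= sqrt 3 / 2)%R -> (wpR1 t <= 0)%R.
Proof.
intros Ht. pose proof sqrt3_pos. rewrite <- wpR1_half.
apply Ropp_le_cancel.
apply (is_derive_nonpos_le (fun x => - wpR1 x)%R (fun x => - (6 * (wpR x * wpR x)))%R); [lra| |].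
- intros x Hx. apply (is_derive_opp (V := R_NormedModule)). apply wpR1_derive. lra.
- intros x Hx. nra.
Qed.

(** Near its pole [wp t] is [1 / t^2] up to a bounded term. *)
Lemma wpR_unbounded X b : (0 < b)%R -> exists t, (0 < t < b)%R /\ (t < sqrt 3)%R /\ (X < wpR t)%R.
Proof.
intros Hb. pose proof sqrt3_pos as H3. destruct wp_reg_small as (K & r & HK & Hr & HA).
set (Y := (Rabs X + K + 1)%R). assert (HY : (1 <= Y)%R) by (unfold Y; pose proof (Rabs_pos X); lra).
set (t := (Rmin (Rmin (b / 2) (r / 2)) (/ Y) * (1 / 2))%R).
assert (Hp : (0 < Rmin (Rmin (b / 2) (r / 2)) (/ Y))%R).
{ repeat apply Rmin_glb_lt; try lra. apply Rinv_0_lt_compat. lra. }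
pose proof (Rmin_l (Rmin (b / 2) (r / 2)) (/ Y)). pose proof (Rmin_r (Rmin (b / 2) (r / 2)) (/ Y)).
pose proof (Rmin_l (b / 2) (r / 2)). pose proof (Rmin_r (b / 2) (r / 2)).
assert (HY1 : (/ Y <= 1)%R) by (rewrite <- Rinv_1; apply Rinv_le_contravar; lra).
assert (Ht : (0 < t)%R) by (unfold t; lra).
assert (Htr : (t < r)%R) by (unfold t; lra).
assert (Ht1 : (t < 1)%R) by lra.
assert (HtY : (t < / Y)%R) by (unfold t; lra).
assert (Hs3 : (1 < sqrt 3)%R) by (rewrite <- sqrt_1; apply sqrt_lt_1; lra).
exists t. split; [unfold t in *; lra|]. split; [lra|].
assert (Hm : Cmod (RtoC t) = t) by (rewrite Cmod_R; apply Rabs_pos_eq; lra).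
specialize (HA (RtoC t) ltac:(lra)). rewrite Hm in HA.
unfold wpR. rewrite wp_eq, re_plus.
replace (Re (/ RtoC t ^ 2)) with (/ t ^ 2)%R by (rewrite <- RtoC_pow, <- RtoC_inv by (apply pow_nonzero; lra); reflexivity).
pose proof (re_le_Cmod (wp_reg (RtoC t))) as Hre. apply Rabs_le_between in Hre.
assert (Ht3 : (t ^ 3 <= 1)%R) by (rewrite <- (pow1 3); apply pow_incr; lra).
assert (HKt : (K * t ^ 3 <= K)%R) by (rewrite <- (Rmult_1_r K) at 2; apply Rmult_le_compat_l; auto).
assert (HYt : (Y < / t ^ 2)%R).
{ apply Rlt_le_trans with (/ t)%R.
  - rewrite <- (Rinv_inv Y). apply Rinv_lt_contravar; auto. apply Rmult_lt_0_compat; auto.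
    apply Rinv_0_lt_compat; lra.
  - apply Rinv_le_contravar; [now apply pow_lt|]. nra. }
unfold Y in HYt. pose proof (Rle_abs X). lra.
Qed.

(** Otherwise [wp] and [wp'] both vanish at [centre], and uniqueness of solutions
    gives [wp = 0] near the pole. *)
Lemma wp_k_pos : (0 < wp_k)%R.
Proof.
assert (H0 : (0 <= wp_k)%R) by (unfold wp_k; nra).
destruct H0 as [H0|H0]; [exact H0|exfalso].
assert (Hw1 : wpR1 centre = 0%R) by (unfold wp_k in H0; nra).
pose proof centre_bounds as Hc. pose proof sqrt3_pos.
destruct (wpR_unbounded 0 centre) as (t & Ht & _ & Hpos); [lra|].
assert (Hin : forall s, (0 <= s <= 1)%R -> (0 < centre + s * (t - centre) < sqrt 3)%R).
{ intros s Hs. split; nra. }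
assert (Ew : wpR centre = 0%R) by (unfold wpR; rewrite wp_centre; reflexivity).
assert (Epath : forall s, RtoC centre + RtoC s * RtoC (t - centre) = RtoC (centre + s * (t - centre))).
{ intros s. now rewrite RtoC_plus, RtoC_mult. }
destruct (ode_unique
  (fun s => wp hex_lattice (RtoC centre + RtoC s * RtoC (t - centre)))
  (fun s => / 2 * wp1 (RtoC centre + RtoC s * RtoC (t - centre)))
  (fun _ => RtoC 0) (fun _ => RtoC 0) (fun _ => RtoC (t - centre))) as [E _].
- intros s Hs. eapply pder_eq; [apply pder_line; apply wp_Cder; rewrite Epath; apply real_not_hex, Hin, Hs|].
  cbv beta. field.
- intros s Hs. assert (Hn : ~ hex_lattice (RtoC centre + RtoC s * RtoC (t - centre))) by (rewrite Epath; apply real_not_hex, Hin, Hs).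
  eapply pder_eq; [apply pder_scal, pder_line; now apply wp1_Cder|].
  cbv beta. rewrite wp_second_derivative by auto. field.
- intros s Hs. eapply pder_eq; [apply pder_const|ring].
- intros s Hs. eapply pder_eq; [apply pder_const|ring].
- intros s Hs. eexists. apply pder_const.
- rewrite Epath, Rmult_0_l, Rplus_0_r. apply wp_centre.
- rewrite Epath, Rmult_0_l, Rplus_0_r, wp1_real by lra. rewrite Hw1. ring.
- rewrite Epath in E. replace (centre + 1 * (t - centre))%R with t in E by ring.
  rewrite wp_real in E by lra. apply RtoC_inj in E. lra.
Qed.

Lemma wpR1_neg t : (0 < t <= centre)%R -> (wpR1 t < 0)%R.
Proof.
intros Ht. pose proof centre_bounds as Hc. pose proof sqrt3_pos. pose proof wp_k_pos as Hk.
assert (Hle : (wpR1 t <= wpR1 centre)%R).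
{ apply Ropp_le_cancel.
  apply (is_derive_nonpos_le (fun x => - wpR1 x)%R (fun x => - (6 * (wpR x * wpR x)))%R); [lra| |].
  - intros x Hx. apply (is_derive_opp (V := R_NormedModule)). apply wpR1_derive. lra.
  - intros x Hx. nra. }
pose proof (wpR1_nonpos centre ltac:(lra)). unfold wp_k in Hk. nra.
Qed.

Lemma wpR_centre : wpR centre = 0%R.
Proof. unfold wpR. now rewrite wp_centre. Qed.

Lemma wpR_decreasing s t : (0 < s < t)%R -> (t <= centre)%R -> (wpR t < wpR s)%R.
Proof.
intros Hs Ht. pose proof centre_bounds. pose proof sqrt3_pos.
destruct (MVT_gen wpR s t wpR1) as (c & Hc & E).
- intros x Hx. rewrite Rmin_left, Rmax_right in Hx by lra. apply wpR_derive. lra.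
- intros x Hx. rewrite Rmin_left, Rmax_right in Hx by lra.
  apply continuity_pt_filterlim, (ex_derive_continuous (V := R_NormedModule)). eexists. apply wpR_derive. lra.
- rewrite Rmin_left, Rmax_right in Hc by lra. pose proof (wpR1_neg c ltac:(lra)). nra.
Qed.

(** * Gamma and beta integrals *)

Local Open Scope R_scope.

Definition gamma_density (p t : R) : R := Rpower t (p - 1) * exp (- t).

Definition gamma_part (p a b : R) : R := RInt (gamma_density p) a b.

Definition beta_density (a b x : R) : R := Rpower x (a - 1) * Rpower (1 + x) (- (a + b)).

Lemma gamma_density_continuous p t : 0 < t -> continuous (gamma_density p) t.
Proof.
intros Ht. apply (ex_derive_continuous (V := R_NormedModule)).
unfold gamma_density, Rpower. auto_derive. exact Ht.
Qed.

Lemma beta_density_continuous a b x : 0 < x -> continuous (beta_density a b) x.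
Proof.
intros Hx. apply (ex_derive_continuous (V := R_NormedModule)).
unfold beta_density, Rpower. auto_derive. repeat split; lra.
Qed.

Lemma gamma_density_pos p t : 0 < gamma_density p t.
Proof. apply Rmult_lt_0_compat; apply exp_pos. Qed.

Lemma beta_density_pos a b x : 0 < beta_density a b x.
Proof. apply Rmult_lt_0_compat; apply exp_pos. Qed.

Lemma ex_RInt_pos (f : R -> R) a b :
  (forall x, 0 < x -> continuous f x) -> 0 < a -> 0 < b -> ex_RInt f a b.
Proof.
intros Hf Ha Hb. apply (ex_RInt_continuous (V := R_CompleteNormedModule)). intros z [Hz _].
apply Hf. eapply Rlt_le_trans; [|exact Hz]. now apply Rmin_glb_lt.
Qed.

Lemma RInt_Chasles_R (f : R -> R) a b c :
  ex_RInt f a b -> ex_RInt f b c -> RInt f a b + RInt f b c = RInt f a c.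
Proof. exact (RInt_Chasles f a b c). Qed.

Lemma RInt_widen (f : R -> R) a a' b' b :
  (forall x, 0 < x -> continuous f x) -> (forall x, 0 <= f x) ->
  0 < a -> a <= a' -> a' <= b' -> b' <= b -> RInt f a' b' <= RInt f a b.
Proof.
intros Hc Hp Ha H1 H2 H3.
assert (E : forall u v, 0 < u -> 0 < v -> ex_RInt f u v) by (intros; now apply ex_RInt_pos).
assert (C1 := RInt_Chasles_R f a a' b (E a a' ltac:(lra) ltac:(lra)) (E a' b ltac:(lra) ltac:(lra))).
assert (C2 := RInt_Chasles_R f a' b' b (E a' b' ltac:(lra) ltac:(lra)) (E b' b ltac:(lra) ltac:(lra))).
assert (0 <= RInt f a a') by (apply RInt_ge_0; auto; apply E; lra).
assert (0 <= RInt f b' b) by (apply RInt_ge_0; auto; apply E; lra).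
lra.
Qed.

Lemma gamma_part_widen p a a' b' b :
  0 < a -> a <= a' -> a' <= b' -> b' <= b -> gamma_part p a' b' <= gamma_part p a b.
Proof.
intros. apply RInt_widen; auto.
- apply gamma_density_continuous.
- intros x. left. apply gamma_density_pos.
Qed.

Lemma gamma_part_Chasles p a b c : 0 < a -> 0 < b -> 0 < c ->
  gamma_part p a b + gamma_part p b c = gamma_part p a c.
Proof.
intros. apply RInt_Chasles_R; apply ex_RInt_pos; auto; apply gamma_density_continuous.
Qed.

Lemma gamma_part_nonneg p a b : 0 < a -> a <= b -> 0 <= gamma_part p a b.
Proof.
intros Ha Hab. apply RInt_ge_0; auto.
- apply ex_RInt_pos; [apply gamma_density_continuous|lra|lra].
- intros x _. left. apply gamma_density_pos.
Qed.

(** On [(0, 1]] the density is at most [t^(p-1)], on [[1, oo)] at most [exp (- t)]. *)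
Lemma gamma_part_bounded p a b : 0 < p <= 1 -> 0 < a -> a <= b -> gamma_part p a b <= / p + 1.
Proof.
intros Hp Ha Hab.
assert (H1 : 0 < Rmin a 1) by (apply Rmin_glb_lt; lra).
assert (H2 : Rmin a 1 <= 1) by apply Rmin_r. assert (H3 : 1 <= Rmax b 1) by apply Rmax_r.
eapply Rle_trans; [apply (gamma_part_widen p (Rmin a 1) a b (Rmax b 1)); auto; [apply Rmin_l|apply Rmax_l]|].
set (u := Rmin a 1) in *. set (v := Rmax b 1) in *.
assert (E : forall x y, 0 < x -> 0 < y -> ex_RInt (gamma_density p) x y)
  by (intros; apply ex_RInt_pos; auto; apply gamma_density_continuous).
unfold gamma_part.
rewrite <- (RInt_Chasles_R (gamma_density p) u 1 v (E u 1 ltac:(lra) ltac:(lra)) (E 1 v ltac:(lra) ltac:(lra))).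
apply Rplus_le_compat.
- assert (I1 : is_RInt (fun t => Rpower t (p - 1)) u 1 (minus (Rpower 1 p / p) (Rpower u p / p))).
  { apply (is_RInt_derive (fun t => Rpower t p / p)).
    - intros x Hx. rewrite Rmin_left, Rmax_right in Hx by lra.
      assert (Ep : Rpower x (p - 1) = exp (p * ln x) * / x).
      { unfold Rpower. replace ((p - 1) * ln x) with (p * ln x + - ln x) by ring.
        rewrite exp_plus, exp_Ropp, exp_ln by lra. reflexivity. }
      rewrite Ep. unfold Rpower. auto_derive; [lra|]. field. lra.
    - intros x Hx. rewrite Rmin_left, Rmax_right in Hx by lra.
      apply (ex_derive_continuous (V := R_NormedModule)). unfold Rpower. auto_derive. lra. }
  apply Rle_trans with (minus (Rpower 1 p / p) (Rpower u p / p)).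
  + rewrite <- (is_RInt_unique _ _ _ _ I1). apply RInt_le; [lra|apply E; lra|eexists; exact I1|].
    intros x Hx. unfold gamma_density. rewrite <- (Rmult_1_r (Rpower x (p - 1))) at 2.
    apply Rmult_le_compat_l; [left; apply exp_pos|]. rewrite <- exp_0. left. apply exp_increasing. lra.
  + unfold minus, plus, opp; cbn. unfold Rpower at 1. rewrite ln_1, Rmult_0_r, exp_0.
    assert (0 < Rpower u p / p) by (apply Rdiv_lt_0_compat; [apply exp_pos|lra]).
    unfold Rdiv in *. lra.
- assert (I2 : is_RInt (fun t => exp (- t)) 1 v (minus (- exp (- v)) (- exp (- 1)))).
  { apply (is_RInt_derive (fun t => - exp (- t))).
    - intros x _. auto_derive; auto. ring.
    - intros x _. apply (ex_derive_continuous (V := R_NormedModule)). auto_derive. auto. }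
  apply Rle_trans with (minus (- exp (- v)) (- exp (- 1))).
  + rewrite <- (is_RInt_unique _ _ _ _ I2). apply RInt_le; [lra|apply E; lra|eexists; exact I2|].
    intros x Hx. unfold gamma_density. rewrite <- (Rmult_1_l (exp (- x))) at 2.
    apply Rmult_le_compat_r; [left; apply exp_pos|].
    unfold Rpower. apply Rle_trans with (exp 0); [|rewrite exp_0; lra].
    assert (0 <= ln x) by (rewrite <- ln_1; apply Rlt_le, ln_increasing; lra).
    destruct (Req_dec ((p - 1) * ln x) 0) as [->|Hne]; [lra|]. left. apply exp_increasing. nra.
  + unfold minus, plus, opp; cbn. pose proof (exp_pos (- v)).
    assert (exp (- 1) < exp 0) by (apply exp_increasing; lra). rewrite exp_0 in *. lra.
Qed.

(** The density is positive, so its integrals over compact intervals increase to a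
    supremum, and this is the limit along the two filters of the improper integral. *)
Lemma Gamma_sup p : 0 < p <= 1 ->
  (forall a b, 0 < a -> a <= b -> gamma_part p a b <= Gamma p) /\
  (forall eps, 0 < eps -> exists a b, 0 < a /\ a <= b /\ Gamma p - eps < gamma_part p a b).
Proof.
intros Hp.
destruct (completeness (fun x => exists a b, 0 < a /\ a <= b /\ x = gamma_part p a b)) as (l & Hub & Hlub).
- exists (/ p + 1). intros x (a & b & Ha & Hab & ->). now apply gamma_part_bounded.
- exists (gamma_part p 1 1), 1, 1. lra.
- assert (Hap : forall eps, 0 < eps -> exists a b, 0 < a /\ a <= b /\ l - eps < gamma_part p a b).
  { intros eps He. apply NNPP. intros Hn. assert (l <= l - eps); [|lra].
    apply Hlub. intros x (a & b & Ha & Hab & ->). apply Rnot_lt_le. intros Hlt. apply Hn. eauto. }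
  assert (HG : Gamma p = l).
  { unfold Gamma.
    apply (is_RInt_gen_unique (V := R_CompleteNormedModule) (Fa := at_right 0) (Fb := Rbar_locally p_infty)).
    intros P [eps HP]. destruct (Hap eps (cond_pos eps)) as (a0 & b0 & Ha0 & Hab0 & Hl0).
    apply (Filter_prod _ _ _ (fun a => 0 < a < a0) (fun b => b0 < b)).
    + exists (mkposreal a0 Ha0). intros y Hy Hy0. apply Rabs_def2 in Hy.
      unfold minus, plus, opp in Hy; cbn in Hy. lra.
    + exists b0. auto.
    + intros a b Ha Hb. exists (gamma_part p a b). split.
      * cbn [fst snd]. apply (RInt_correct (V := R_CompleteNormedModule)).
        apply ex_RInt_pos; [apply gamma_density_continuous|lra|lra].
      * apply HP. change (Rabs (gamma_part p a b - l) < eps).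
        assert (gamma_part p a0 b0 <= gamma_part p a b) by (apply gamma_part_widen; lra).
        assert (gamma_part p a b <= l) by (apply Hub; exists a, b; repeat split; lra).
        apply Rabs_def1; lra. }
  rewrite HG. split; [|exact Hap]. intros a b Ha Hab. apply Hub. eauto.
Qed.

Lemma gamma_part_scale p s u v : 0 < s -> 0 < u -> 0 < v ->
  RInt (fun x => s * gamma_density p (s * x)) u v = gamma_part p (s * u) (s * v).
Proof.
intros Hs Hu Hv. unfold gamma_part.
replace (s * u) with (s * u + 0) by ring. replace (s * v) with (s * v + 0) by ring.
rewrite <- (RInt_comp_lin (V := R_CompleteNormedModule)).
- apply RInt_ext. intros x _. rewrite Rplus_0_r. reflexivity.
- apply ex_RInt_pos; [apply gamma_density_continuous| |]; nra.
Qed.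

(** The integrand of the double integral behind [gamma_beta]. *)
Definition gamma_kernel (a b s x : R) : R :=
  Rpower s (a + b - 1) * Rpower x (a - 1) * exp (- (s * (1 + x))).

Lemma gamma_kernel_in_x a b s x : 0 < s -> 0 < x ->
  gamma_kernel a b s x = gamma_density b s * (s * gamma_density a (s * x)).
Proof.
intros Hs Hx. unfold gamma_kernel, gamma_density.
rewrite <- Rpower_mult_distr by auto.
replace (exp (- (s * (1 + x)))) with (exp (- s) * exp (- (s * x))) by (rewrite <- exp_plus; f_equal; ring).
assert (E : Rpower s (a + b - 1) = Rpower s (b - 1) * (s * Rpower s (a - 1))).
{ transitivity (Rpower s (b - 1) * (Rpower s 1 * Rpower s (a - 1))); [|now rewrite Rpower_1].
  rewrite <- !Rpower_plus. f_equal. ring. }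
rewrite E. ring.
Qed.

Lemma gamma_kernel_in_s a b s x : 0 < s -> 0 < x ->
  gamma_kernel a b s x = beta_density a b x * ((1 + x) * gamma_density (a + b) ((1 + x) * s)).
Proof.
intros Hs Hx. unfold gamma_kernel, gamma_density, beta_density.
rewrite <- Rpower_mult_distr by lra.
replace (exp (- (s * (1 + x)))) with (exp (- ((1 + x) * s))) by (apply (f_equal exp); ring).
assert (E : Rpower (1 + x) (- (a + b)) * (1 + x) * Rpower (1 + x) (a + b - 1) = 1).
{ transitivity (Rpower (1 + x) (- (a + b)) * Rpower (1 + x) 1 * Rpower (1 + x) (a + b - 1));
    [rewrite Rpower_1 by lra; reflexivity|].
  rewrite <- !Rpower_plus. replace (- (a + b) + 1 + (a + b - 1)) with 0 by ring. apply Rpower_O. lra. }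
transitivity (Rpower s (a + b - 1) * Rpower x (a - 1) * exp (- ((1 + x) * s)) *
  (Rpower (1 + x) (- (a + b)) * (1 + x) * Rpower (1 + x) (a + b - 1))); [rewrite E|]; ring.
Qed.

Lemma gamma_kernel_continuous_2d a b s x : 0 < s -> 0 < x ->
  continuity_2d_pt (gamma_kernel a b) s x.
Proof.
intros Hs Hx. unfold gamma_kernel.
assert (HRp : forall c y, 0 < y -> continuity_pt (fun t => Rpower t c) y).
{ intros c y Hy. apply continuity_pt_filterlim, (ex_derive_continuous (V := R_NormedModule) (fun t => Rpower t c)).
  unfold Rpower. auto_derive. exact Hy. }
apply continuity_2d_pt_mult; [apply continuity_2d_pt_mult|].
- apply (continuity_1d_2d_pt_comp (fun t => Rpower t (a + b - 1)) (fun u _ => u)); [now apply HRp|].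
  apply continuity_2d_pt_id1.
- apply (continuity_1d_2d_pt_comp (fun t => Rpower t (a - 1)) (fun _ v => v)); [now apply HRp|].
  apply continuity_2d_pt_id2.
- apply (continuity_1d_2d_pt_comp exp (fun u v => - (u * (1 + v)))).
  + apply continuity_pt_filterlim, (ex_derive_continuous (V := R_NormedModule) exp). auto_derive. auto.
  + apply continuity_2d_pt_opp, continuity_2d_pt_mult; [apply continuity_2d_pt_id1|].
    apply continuity_2d_pt_plus; [apply continuity_2d_pt_const|apply continuity_2d_pt_id2].
Qed.

Lemma gamma_part_derive p u v : 0 < u -> 0 < v -> is_derive (gamma_part p u) v (gamma_density p v).
Proof.
intros Hu Hv. apply (is_derive_RInt (V := R_CompleteNormedModule) (gamma_density p) _ u).
- exists (mkposreal v Hv). intros y Hy. apply Rabs_def2 in Hy. unfold minus, plus, opp in Hy; cbn in Hy.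
  apply (RInt_correct (V := R_CompleteNormedModule)). apply ex_RInt_pos; [apply gamma_density_continuous|lra|lra].
- now apply gamma_density_continuous.
Qed.

Lemma gamma_part_scaled_continuous p d X u : 0 < d -> 0 < X -> 0 < u ->
continuous (fun s => gamma_part p (s * d) (s * X)) u.
Proof.
intros Hd HX Hu.
apply (continuous_ext_loc _ (fun s => gamma_part p 1 (s * X) - gamma_part p 1 (s * d))).
- exists (mkposreal u Hu). intros y Hy. apply Rabs_def2 in Hy. unfold minus, plus, opp in Hy; cbn in Hy.
  assert (0 < y * d) by nra. assert (0 < y * X) by nra.
  assert (HC := gamma_part_Chasles p 1 (y * d) (y * X) Rlt_0_1 H H0).
  cut (gamma_part p 1 (y * X) - gamma_part p 1 (y * d) = gamma_part p (y * d) (y * X)); [intros <-; reflexivity|lra].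
- apply (continuous_minus (V := R_NormedModule));
    (apply (continuous_comp (fun s => s * _) (gamma_part p 1));
     [apply (ex_derive_continuous (V := R_NormedModule)); auto_derive; auto
     |apply (ex_derive_continuous (V := R_NormedModule)); eexists; apply gamma_part_derive; nra]).
Qed.

Lemma gamma_part_shifted_continuous p e T x : 0 < e -> 0 < T -> 0 < x ->
  continuous (fun x => gamma_part p ((1 + x) * e) ((1 + x) * T)) x.
Proof.
intros He HT Hx.
apply (continuous_comp (fun x => 1 + x) (fun s => gamma_part p (s * e) (s * T))).
- apply (ex_derive_continuous (V := R_NormedModule)). auto_derive. auto.
- apply gamma_part_scaled_continuous; lra.
Qed.

(** The two sides are the iterated integrals of the kernel over a rectangle: they
    vanish at [T = e] and have the same derivative in [T]. *)
Lemma gamma_kernel_fubini a b e T d X :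
  0 < e -> e <= T -> 0 < d -> d <= X ->
  RInt (fun s => gamma_density b s * gamma_part a (s * d) (s * X)) e T
  = RInt (fun x => beta_density a b x * gamma_part (a + b) ((1 + x) * e) ((1 + x) * T)) d X.
Proof.
intros He HT Hd HX.
set (f := fun (T x : R) => beta_density a b x * gamma_part (a + b) ((1 + x) * e) ((1 + x) * T)).
set (g := fun s => gamma_density b s * gamma_part a (s * d) (s * X)).
assert (Hf : forall u v, 0 < u -> 0 < v -> is_derive (fun z => f z v) u (gamma_kernel a b u v)).
{ intros u v Hu Hv. unfold f. rewrite gamma_kernel_in_s by auto.
  apply (is_derive_scal (fun z => gamma_part (a + b) ((1 + v) * e) ((1 + v) * z))).
  apply (is_derive_comp (gamma_part (a + b) ((1 + v) * e)) (fun z => (1 + v) * z)).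
  - apply gamma_part_derive; nra.
  - auto_derive; auto; ring. }
assert (HK : forall u, 0 < u -> RInt (gamma_kernel a b u) d X = g u).
{ intros u Hu. unfold g. rewrite <- gamma_part_scale by lra.
  rewrite <- (RInt_scal (V := R_CompleteNormedModule)).
  - apply RInt_ext. intros x Hx. rewrite Rmin_left, Rmax_right in Hx by lra. apply gamma_kernel_in_x; lra.
  - apply ex_RInt_pos; [|lra|lra]. intros x Hx. apply (continuous_mult (K := R_AbsRing)); [apply continuous_const|].
    apply (continuous_comp (fun x => u * x) (gamma_density a)).
    + apply (ex_derive_continuous (V := R_NormedModule)). auto_derive. auto.
    + apply gamma_density_continuous. nra. }
assert (Hfc : forall u v, 0 < u -> 0 < v -> continuous (f u) v).
{ intros u v Hu Hv. apply (continuous_mult (K := R_AbsRing)); [now apply beta_density_continuous|].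
  apply gamma_part_shifted_continuous; lra. }
assert (Hphi : forall u, 0 < u -> is_derive (fun u => RInt (f u) d X) u (g u)).
{ intros u Hu. rewrite <- (HK u Hu).
  replace (RInt (gamma_kernel a b u) d X) with (RInt (fun v => Derive (fun z => f z v) u) d X).
  2:{ apply RInt_ext. intros x Hx. rewrite Rmin_left, Rmax_right in Hx by lra. apply is_derive_unique, Hf; lra. }
  apply (is_derive_RInt_param f d X u).
  - exists (mkposreal u Hu). intros y Hy t Ht. rewrite Rmin_left, Rmax_right in Ht by lra.
    apply Rabs_def2 in Hy. unfold minus, plus, opp in Hy; cbn in Hy. eexists. apply Hf; lra.
  - intros t Ht. rewrite Rmin_left, Rmax_right in Ht by lra.
    apply (continuity_2d_pt_ext_loc (gamma_kernel a b)).
    + assert (Hm : 0 < Rmin u t) by (apply Rmin_glb_lt; lra).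
      exists (mkposreal _ Hm). intros y z Hy Hz. cbn in Hy, Hz. apply Rabs_def2 in Hy, Hz.
      pose proof (Rmin_l u t). pose proof (Rmin_r u t). symmetry. apply is_derive_unique, Hf; lra.
    + apply gamma_kernel_continuous_2d; lra.
  - exists (mkposreal u Hu). intros y Hy. apply Rabs_def2 in Hy. unfold minus, plus, opp in Hy; cbn in Hy.
    apply ex_RInt_pos; [|lra|lra]. intros x Hx. apply Hfc; lra. }
assert (Hg : forall u, 0 < u -> continuous g u).
{ intros u Hu. apply (continuous_mult (K := R_AbsRing)); [now apply gamma_density_continuous|].
  apply gamma_part_scaled_continuous; lra. }
assert (I : is_RInt g e T (minus (RInt (f T) d X) (RInt (f e) d X))).
{ apply (is_RInt_derive (fun u => RInt (f u) d X)); intros x Hx; rewrite Rmin_left, Rmax_right in Hx by lra.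
  - apply Hphi. lra.
  - apply Hg. lra. }
rewrite (is_RInt_unique _ _ _ _ I).
replace (RInt (f e) d X) with 0.
- unfold minus, plus, opp; cbn. rewrite Ropp_0, Rplus_0_r. reflexivity.
- symmetry. rewrite (RInt_ext _ (fun _ => 0)).
  + rewrite RInt_const. apply Rmult_0_r.
  + intros x _. unfold f, gamma_part. rewrite RInt_point. apply Rmult_0_r.
Qed.

Lemma mult_sup_le (G y C : R) : 0 <= y ->
  (forall eps, 0 < eps -> exists g, G - eps < g /\ g * y <= C) -> G * y <= C.
Proof.
intros Hy H. apply le_epsilon. intros eps He.
destruct (H (eps / (y + 1))) as (g & Hg & HC); [apply Rdiv_lt_0_compat; lra|].
assert (E : (y + 1) * (eps / (y + 1)) = eps) by (field; lra).
assert (0 < eps / (y + 1)) by (apply Rdiv_lt_0_compat; lra). nra.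
Qed.

(** Euler's relation between the gamma and beta integrals.  Every rectangle
    integral of the kernel is squeezed between products of partial integrals,
    in either order of integration. *)
Lemma gamma_beta a b B :
  0 < a -> 0 < b -> a + b <= 1 ->
  (forall d X, 0 < d -> d <= X -> RInt (beta_density a b) d X <= B) ->
  (forall eps, 0 < eps -> exists d X, 0 < d /\ d <= X /\ B - eps < RInt (beta_density a b) d X) ->
  Gamma a * Gamma b = Gamma (a + b) * B.
Proof.
intros Ha Hb Hab HB1 HB2.
destruct (Gamma_sup a) as [Ga1 Ga2]; [lra|]. destruct (Gamma_sup b) as [Gb1 Gb2]; [lra|].
destruct (Gamma_sup (a + b)) as [Gc1 Gc2]; [lra|].
assert (Eb : forall u v, 0 < u -> 0 < v -> ex_RInt (gamma_density b) u v)
  by (intros; apply ex_RInt_pos; auto; apply gamma_density_continuous).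
assert (Ebeta : forall u v, 0 < u -> 0 < v -> ex_RInt (beta_density a b) u v)
  by (intros; apply ex_RInt_pos; auto; apply beta_density_continuous).
assert (E1 : forall e T d X, 0 < e -> e <= T -> 0 < d -> d <= X ->
  ex_RInt (fun s => gamma_density b s * gamma_part a (s * d) (s * X)) e T).
{ intros e T d X He HT Hd HX. apply ex_RInt_pos; [|lra|lra]. intros x Hx.
  apply (continuous_mult (K := R_AbsRing)); [now apply gamma_density_continuous|apply gamma_part_scaled_continuous; lra]. }
assert (E2 : forall e T d X, 0 < e -> e <= T -> 0 < d -> d <= X ->
  ex_RInt (fun x => beta_density a b x * gamma_part (a + b) ((1 + x) * e) ((1 + x) * T)) d X).
{ intros e T d X He HT Hd HX. apply ex_RInt_pos; [|lra|lra]. intros x Hx.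
  apply (continuous_mult (K := R_AbsRing)); [now apply beta_density_continuous|apply gamma_part_shifted_continuous; lra]. }
assert (Hscal : forall (f : R -> R) c u v, ex_RInt f u v -> RInt (fun x => f x * c) u v = RInt f u v * c).
{ intros f c u v Hf. transitivity (RInt (fun x => scal c (f x)) u v).
  - apply RInt_ext. intros x _. apply Rmult_comm.
  - etransitivity; [exact (RInt_scal (V := R_CompleteNormedModule) f u v c Hf)|apply Rmult_comm]. }
assert (Escal : forall (f : R -> R) c u v, ex_RInt f u v -> ex_RInt (fun x => f x * c) u v).
{ intros f c u v Hf. apply (ex_RInt_ext (fun x => scal c (f x))); [intros; apply Rmult_comm|].
  now apply (ex_RInt_scal (V := R_NormedModule)). }
assert (Gbn : 0 <= Gamma b) by (eapply Rle_trans; [apply (gamma_part_nonneg b 1 1); lra|apply Gb1; lra]).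
assert (Gcn : 0 <= Gamma (a + b)) by (eapply Rle_trans; [apply (gamma_part_nonneg (a + b) 1 1); lra|apply Gc1; lra]).
assert (Gan : 0 <= Gamma a) by (eapply Rle_trans; [apply (gamma_part_nonneg a 1 1); lra|apply Ga1; lra]).
assert (BN : 0 <= B).
{ eapply Rle_trans; [|apply (HB1 1 1); lra]. apply RInt_ge_0; [lra|apply Ebeta; lra|].
  intros; left; apply beta_density_pos. }
apply Rle_antisym.
- apply mult_sup_le; auto. intros eps He. destruct (Ga2 eps He) as (u & v & Hu & Huv & Hg).
  exists (gamma_part a u v). split; auto. rewrite Rmult_comm.
  apply mult_sup_le; [now apply gamma_part_nonneg|]. intros eps' He'.
  destruct (Gb2 eps' He') as (e & T & He0 & HeT & Hg'). exists (gamma_part b e T). split; auto.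
  set (d := u / T). set (X := v / e).
  assert (Hd : 0 < d) by (apply Rdiv_lt_0_compat; lra).
  assert (HTd : T * d = u) by (unfold d; field; lra).
  assert (HeX : e * X = v) by (unfold X; field; lra).
  assert (HX : d <= X) by (apply Rmult_le_reg_l with e; [lra|]; rewrite HeX; nra).
  apply Rle_trans with (RInt (fun s => gamma_density b s * gamma_part a (s * d) (s * X)) e T).
  + unfold gamma_part at 1. rewrite <- (Hscal (gamma_density b)) by (apply Eb; lra).
    apply RInt_le; [lra|apply Escal, Eb; lra|apply E1; lra|].
    intros s Hs. apply Rmult_le_compat_l; [left; apply gamma_density_pos|].
    apply gamma_part_widen; nra.
  + rewrite gamma_kernel_fubini by lra.
    apply Rle_trans with (RInt (beta_density a b) d X * Gamma (a + b)).
    * rewrite <- Hscal by (apply Ebeta; lra).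
      apply RInt_le; [lra|apply E2; lra|apply Escal, Ebeta; lra|].
      intros x Hx. apply Rmult_le_compat_l; [left; apply beta_density_pos|]. apply Gc1; nra.
    * rewrite Rmult_comm. apply Rmult_le_compat_l; [exact Gcn|apply HB1; lra].
- apply mult_sup_le; auto. intros eps He. destruct (Gc2 eps He) as (u & v & Hu & Huv & Hg).
  exists (gamma_part (a + b) u v). split; auto. rewrite Rmult_comm.
  apply mult_sup_le; [now apply gamma_part_nonneg|]. intros eps' He'.
  destruct (HB2 eps' He') as (d & X & Hd & HX & HB). exists (RInt (beta_density a b) d X). split; auto.
  set (e := u / (1 + X)). set (T := v / (1 + d)).
  assert (He0 : 0 < e) by (apply Rdiv_lt_0_compat; lra).
  assert (HeX : (1 + X) * e = u) by (unfold e; field; lra).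
  assert (HTd : (1 + d) * T = v) by (unfold T; field; lra).
  assert (HeT : e <= T) by (apply Rmult_le_reg_l with (1 + d); [lra|]; rewrite HTd; nra).
  apply Rle_trans with (RInt (fun x => beta_density a b x * gamma_part (a + b) ((1 + x) * e) ((1 + x) * T)) d X).
  + rewrite <- Hscal by (apply Ebeta; lra).
    apply RInt_le; [lra|apply Escal, Ebeta; lra|apply E2; lra|].
    intros x Hx. apply Rmult_le_compat_l; [left; apply beta_density_pos|].
    apply gamma_part_widen; nra.
  + rewrite <- gamma_kernel_fubini by lra.
    apply Rle_trans with (gamma_part b e T * Gamma a).
    * unfold gamma_part at 2. rewrite <- (Hscal (gamma_density b)) by (apply Eb; lra).
      apply RInt_le; [lra|apply E1; lra|apply Escal, Eb; lra|].
      intros s Hs. apply Rmult_le_compat_l; [left; apply gamma_density_pos|]. apply Ga1; nra.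
    * rewrite Rmult_comm. apply Rmult_le_compat_l; [exact Gan|apply Gb1; lra].
Qed.

Lemma Gamma_pos p : 0 < p <= 1 -> 0 < Gamma p.
Proof.
intros Hp. eapply Rlt_le_trans; [|apply (proj1 (Gamma_sup p Hp) 1 2); lra].
apply RInt_gt_0; [lra|intros; apply gamma_density_pos|].
intros x Hx. apply gamma_density_continuous. lra.
Qed.

(** * The real period *)

(** Rescaling [wp] by [kappa] turns its equation into [psi' ^ 2 = 4 psi ^ 3 + 4]. *)
Definition kappa : R := Rpower (wp_k / 4) (1 / 6).

Lemma kappa_pos : 0 < kappa.
Proof. apply exp_pos. Qed.

Lemma kappa_pow6 : wp_k = 4 * kappa ^ 6.
Proof.
unfold kappa. rewrite <- Rpower_pow by apply exp_pos. rewrite Rpower_mult.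
replace (1 / 6 * INR 6) with 1 by (cbn; field). rewrite Rpower_1; [field|].
pose proof wp_k_pos. lra.
Qed.

(** The substitution under which the beta integrand becomes constant in [t]. *)
Definition beta_time (t : R) : R := (wpR t / kappa ^ 2) ^ 3.

Lemma wpR_pos t : 0 < t < centre -> 0 < wpR t.
Proof. intros Ht. rewrite <- wpR_centre. apply wpR_decreasing; lra. Qed.

Lemma beta_time_integrand t : 0 < t < centre ->
  3 * (wpR t / kappa ^ 2) ^ 2 * (wpR1 t / kappa ^ 2) * beta_density (1 / 3) (1 / 6) (beta_time t) = - (6 * kappa).
Proof.
intros Ht. pose proof kappa_pos as Hk. pose proof centre_bounds as Hc. pose proof sqrt3_pos.
pose proof (wpR_pos t Ht) as Hw. pose proof (wpR1_neg t ltac:(lra)) as Hw1.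
assert (Hen := wpR_energy t ltac:(lra)). rewrite kappa_pow6 in Hen.
assert (Hk2 : 0 < kappa ^ 2) by now apply pow_lt. assert (Hk3 : 0 < kappa ^ 3) by now apply pow_lt.
set (y := wpR t / kappa ^ 2). assert (Hy : 0 < y) by now apply Rdiv_lt_0_compat.
set (z := - wpR1 t / (2 * kappa ^ 3)). assert (Hz : 0 < z) by (apply Rdiv_lt_0_compat; lra).
unfold beta_density, beta_time. fold y.
assert (E1 : Rpower (y ^ 3) (1 / 3 - 1) = / y ^ 2).
{ rewrite <- (Rpower_pow 3) by auto. rewrite Rpower_mult.
  replace (INR 3 * (1 / 3 - 1)) with (- INR 2) by (cbn; field). rewrite Rpower_Ropp, Rpower_pow; auto. }
assert (Ez : 1 + y ^ 3 = z ^ 2).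
{ unfold y, z. 
  replace ((- wpR1 t / (2 * kappa ^ 3)) ^ 2) with (wpR1 t * wpR1 t / (4 * kappa ^ 6)) by (field; lra).
  rewrite Hen. field. lra. }
assert (E2 : Rpower (1 + y ^ 3) (- (1 / 3 + 1 / 6)) = / z).
{ rewrite Ez, <- (Rpower_pow 2) by auto. rewrite Rpower_mult.
  replace (INR 2 * - (1 / 3 + 1 / 6)) with (- (1)) by (cbn; field). rewrite Rpower_Ropp, Rpower_1; auto. }
rewrite E1, E2. unfold z. field. repeat split; lra.
Qed.

Lemma beta_time_derive t : 0 < t < sqrt 3 ->
  is_derive beta_time t (3 * (wpR t / kappa ^ 2) ^ 2 * (wpR1 t / kappa ^ 2)).
Proof.
intros Ht. pose proof kappa_pos. pose proof (wpR_derive t Ht) as H'.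
unfold beta_time. auto_derive.
- eexists. exact H'.
- assert (E : Derive (fun x : R => wpR x) t = wpR1 t) by exact (is_derive_unique _ _ _ H').
  rewrite E. field. lra.
Qed.

Lemma beta_time_integral t1 t2 : 0 < t1 -> t1 <= t2 -> t2 < centre ->
  RInt (beta_density (1 / 3) (1 / 6)) (beta_time t2) (beta_time t1) = 6 * kappa * (t2 - t1).
Proof.
intros H1 H12 H2. pose proof centre_bounds as Hc. pose proof sqrt3_pos. pose proof kappa_pos as Hk.
rewrite <- (opp_RInt_swap (V := R_CompleteNormedModule)).
2:{ apply ex_RInt_pos; [apply beta_density_continuous| |]; apply pow_lt, Rdiv_lt_0_compat;
    try (apply wpR_pos; lra); now apply pow_lt. }
rewrite <- (RInt_comp (beta_density (1 / 3) (1 / 6)) beta_time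
  (fun t => 3 * (wpR t / kappa ^ 2) ^ 2 * (wpR1 t / kappa ^ 2))).
- rewrite (RInt_ext _ (fun _ => - (6 * kappa))).
  + rewrite RInt_const. unfold opp, scal, mult; cbn. unfold mult; cbn. ring.
  + intros x Hx. rewrite Rmin_left, Rmax_right in Hx by lra. apply beta_time_integrand. lra.
- intros x Hx. rewrite Rmin_left, Rmax_right in Hx by lra. apply beta_density_continuous.
  apply pow_lt, Rdiv_lt_0_compat; [apply wpR_pos; lra|now apply pow_lt].
- intros x Hx. rewrite Rmin_left, Rmax_right in Hx by lra. split; [apply beta_time_derive; lra|].
  apply (ex_derive_continuous (V := R_NormedModule)).
  auto_derive. split; [|split; auto]; eexists; [apply wpR_derive|apply wpR1_derive]; lra.
Qed.

Lemma beta_time_large Y b : 0 < b -> exists t, 0 < t < b /\ t < centre /\ Y < beta_time t.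
Proof.
intros Hb. pose proof kappa_pos as Hk. pose proof centre_bounds as Hc.
set (Z := Rabs Y + 1). assert (HZ : 1 <= Z) by (unfold Z; pose proof (Rabs_pos Y); lra).
destruct (wpR_unbounded (kappa ^ 2 * Z) (Rmin b centre)) as (t & Ht & Ht3 & Hw); [apply Rmin_glb_lt; lra|].
pose proof (Rmin_l b centre). pose proof (Rmin_r b centre).
exists t. split; [lra|]. split; [lra|]. unfold beta_time.
assert (Hk2 : 0 < kappa ^ 2) by now apply pow_lt.
assert (Hy : Z < wpR t / kappa ^ 2).
{ apply Rmult_lt_reg_r with (kappa ^ 2); auto. unfold Rdiv. rewrite Rmult_assoc, Rinv_l by lra. lra. }
set (y := wpR t / kappa ^ 2) in *. pose proof (Rle_abs Y).
assert (y * 1 <= y ^ 3) by (cbn; apply Rmult_le_compat_l; nra). unfold Z in *. lra.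
Qed.

Lemma beta_time_small d b : 0 < d -> b < centre -> exists t, 0 < t /\ b < t < centre /\ beta_time t < d.
Proof.
intros Hd Hb. pose proof kappa_pos as Hk. pose proof centre_bounds as Hc. pose proof sqrt3_pos.
assert (Hcont : continuous beta_time centre).
{ apply (ex_derive_continuous (V := R_NormedModule)). eexists. apply beta_time_derive. lra. }
assert (E0 : beta_time centre = 0) by (unfold beta_time; rewrite wpR_centre; unfold Rdiv; ring).
destruct (proj1 (filterlim_locally _ _) Hcont (mkposreal d Hd)) as [r Hr].
set (m := Rmax (Rmax b (centre - r)) 0). 
assert (Hm : m < centre) by (unfold m; repeat apply Rmax_lub_lt; try lra; pose proof (cond_pos r); lra).
pose proof (Rmax_l (Rmax b (centre - r)) 0). pose proof (Rmax_r (Rmax b (centre - r)) 0).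
pose proof (Rmax_l b (centre - r)). pose proof (Rmax_r b (centre - r)). fold m in H0, H1.
exists ((m + centre) / 2). split; [lra|]. split; [lra|].
assert (Hball : ball centre r ((m + centre) / 2)).
{ apply Rabs_def1; unfold minus, plus, opp; cbn; lra. }
specialize (Hr _ Hball). change (Rabs (beta_time ((m + centre) / 2) - beta_time centre) < d) in Hr.
rewrite E0 in Hr. apply Rabs_def2 in Hr. lra.
Qed.

(** Up to the factor [6 kappa], the beta integral is the time [centre] that [wp] takes
    to descend from its pole to its zero. *)
Lemma rho_eq : rho * sqrt 3 = kappa.
Proof.
pose proof kappa_pos as Hk. pose proof centre_bounds as Hc. pose proof sqrt3_pos as H3.
assert (E : Gamma (1 / 3) * Gamma (1 / 6) = Gamma (1 / 3 + 1 / 6) * (6 * kappa * centre)).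
{ apply gamma_beta; try lra.
  - intros d X Hd HX.
    destruct (beta_time_small d 0 Hd) as (t2 & Ht2 & Ht2' & Hs); [lra|].
    destruct (beta_time_large X t2 Ht2) as (t1 & Ht1 & Ht1' & Hl).
    apply Rle_trans with (RInt (beta_density (1 / 3) (1 / 6)) (beta_time t2) (beta_time t1)).
    + apply RInt_widen; try lra; [apply beta_density_continuous|intros; left; apply beta_density_pos|].
      apply pow_lt, Rdiv_lt_0_compat; [apply wpR_pos; lra|now apply pow_lt].
    + rewrite beta_time_integral by lra. apply Rmult_le_compat_l; lra.
  - intros eps He. set (m := Rmin (eps / (24 * kappa)) (centre / 4)).
    assert (Hm : 0 < m) by (apply Rmin_glb_lt; [apply Rdiv_lt_0_compat; lra|lra]).
    pose proof (Rmin_l (eps / (24 * kappa)) (centre / 4)). pose proof (Rmin_r (eps / (24 * kappa)) (centre / 4)).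
    fold m in H, H0. exists (beta_time (centre - m)), (beta_time m).
    split; [apply pow_lt, Rdiv_lt_0_compat; [apply wpR_pos; lra|now apply pow_lt]|].
    split.
    + apply pow_incr. split.
      * apply Rmult_le_pos; [left; apply wpR_pos; lra|left; apply Rinv_0_lt_compat; now apply pow_lt].
      * apply Rmult_le_compat_r; [left; apply Rinv_0_lt_compat; now apply pow_lt|].
        left. apply wpR_decreasing; lra.
    + rewrite beta_time_integral by lra.
      assert (24 * kappa * (eps / (24 * kappa)) = eps) by (field; lra).
      assert (24 * kappa * m <= 24 * kappa * (eps / (24 * kappa))) by (apply Rmult_le_compat_l; lra).
      nra. }
replace (1 / 3 + 1 / 6) with (1 / 2) in E by field.
pose proof (Gamma_pos (1 / 2) ltac:(lra)) as HG.
unfold rho. rewrite E. unfold centre. field. split; lra.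
Qed.

Local Open Scope C_scope.

(** * The parametrisation of the germ *)

Lemma sqrt_sum_sq_pos (a b : R) : (0 < a)%R -> (0 < sqrt (a ^ 2 + b ^ 2))%R.
Proof. intros Ha. apply sqrt_lt_R0. nra. Qed.

Lemma sqrt_one_plus_div (a b : R) : (0 < a)%R -> (sqrt (1 + (b / a)²) = sqrt (a ^ 2 + b ^ 2) / a)%R.
Proof.
intros Ha. replace (1 + (b / a)²)%R with ((a ^ 2 + b ^ 2) / a ^ 2)%R by (unfold Rsqr; field; lra).
rewrite sqrt_div_alt by nra. f_equal. rewrite <- Rsqr_pow2. apply sqrt_Rsqr. lra.
Qed.

(** Unlike [acos], which is singular at [1], this form is differentiable on the whole
    right half-plane. *)
Lemma Carg_atan (w : C) : (0 < Re w)%R -> Carg w = atan (Im w / Re w).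
Proof.
intros Hw. destruct w as [a b]. unfold Carg, Re, Im in *; cbn [fst snd] in *.
assert (E : (a / Cmod (a, b) = cos (atan (b / a)))%R).
{ pose proof (sqrt_sum_sq_pos a b Hw). rewrite cos_atan, sqrt_one_plus_div by auto.
  unfold Cmod; cbn [fst snd]. field. split; lra. }
rewrite E. pose proof (atan_bound (b / a)). pose proof PI_RGT_0.
destruct (Rle_dec 0 b) as [Hb|Hb].
- apply acos_cos. split; [|lra]. rewrite <- atan_0.
  destruct (Rle_lt_or_eq_dec 0 (b / a)) as [Hl|<-]; [apply Rmult_le_pos; [lra|left; now apply Rinv_0_lt_compat]| |lra].
  left. now apply atan_increasing.
- rewrite <- cos_neg. rewrite acos_cos; [ring|]. split; [|lra].
  assert (b / a < 0)%R by (apply Rmult_neg_pos; [lra|now apply Rinv_0_lt_compat]).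
  apply Ropp_le_cancel. rewrite Ropp_0, Ropp_involutive, <- atan_0. left. now apply atan_increasing.
Qed.

Lemma Cpower_polar (w : C) x : (0 < Re w)%R ->
  Cpower w x = ((exp (x * (ln (Re w * Re w + Im w * Im w) / 2)) * cos (x * atan (Im w / Re w)))%R,
                (exp (x * (ln (Re w * Re w + Im w * Im w) / 2)) * sin (x * atan (Im w / Re w)))%R).
Proof.
intros Hw. unfold Cpower. rewrite Carg_atan by auto.
assert (Hm : (0 < Cmod w)%R) by (pose proof (re_le_Cmod w); pose proof (Rle_abs (Re w)); lra).
assert (E : (ln (Re w * Re w + Im w * Im w) = 2 * ln (Cmod w))%R).
{ rewrite <- Cmod_sq, ln_mult by auto. ring. }
rewrite E. unfold Rpower, cis, RtoC, Cmult; cbn [fst snd].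
replace (2 * ln (Cmod w) / 2)%R with (ln (Cmod w)) by field. apply f_equal2; ring.
Qed.

Lemma cis_Carg (w : C) : (0 < Re w)%R -> RtoC (Cmod w) * cis (Carg w) = w.
Proof.
intros Hw. rewrite Carg_atan by auto. destruct w as [a b]. unfold Re, Im in *; cbn [fst snd] in *.
pose proof (sqrt_sum_sq_pos a b Hw). unfold cis, Cmod, RtoC, Cmult; cbn [fst snd].
rewrite cos_atan, sin_atan, sqrt_one_plus_div by auto. apply f_equal2; field; lra.
Qed.

Lemma delta_pow6 (u : C) : (0 < Re (1 - u ^ 6)%C)%R -> delta u ^ 6 = 1 - u ^ 6.
Proof.
intros H. unfold delta. set (w := 1 - u ^ 6) in *. unfold Cpower.
assert (Hm : (0 < Cmod w)%R) by (pose proof (re_le_Cmod w); pose proof (Rle_abs (Re w)); lra).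
rewrite Cpow_mult_l, cis_pow, <- RtoC_pow, <- Rpower_pow by apply exp_pos. rewrite Rpower_mult.
replace (1 / 6 * INR 6)%R with 1%R by (cbn; field). rewrite Rpower_1 by auto.
replace (INR 6 * (1 / 6 * Carg w))%R with (Carg w) by (cbn; field). now apply cis_Carg.
Qed.

Lemma delta_0 : delta 0 = 1.
Proof.
unfold delta. replace (1 - 0 ^ 6) with (RtoC 1) by ring. unfold Cpower.
rewrite Carg_atan by (cbn; lra). cbn [Re Im RtoC fst snd].
replace (0 / 1)%R with 0%R by field. rewrite atan_0, Rmult_0_r, cis_0, Cmod_1.
unfold Rpower. rewrite ln_1, Rmult_0_r, exp_0. ring.
Qed.

Lemma is_derive_polar (A B : R -> R) s a b x (trig trig' : R -> R) :
  (forall y, is_derive trig y (trig' y)) ->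
  (0 < A s)%R -> is_derive A s a -> is_derive B s b ->
  is_derive (fun t => (exp (x * (ln (A t * A t + B t * B t) / 2)) * trig (x * atan (B t / A t)))%R) s
    (x * exp (x * (ln (A s * A s + B s * B s) / 2)) *
      ((A s * a + B s * b) / (A s * A s + B s * B s) * trig (x * atan (B s / A s))
       + (A s * b - B s * a) / (A s * A s + B s * B s) * trig' (x * atan (B s / A s))))%R.
Proof.
intros Htrig HA Ha Hb.
assert (Ht : forall y, ex_derive trig y) by (intros y; eexists; apply Htrig).
assert (Hn : (0 < A s * A s + B s * B s)%R) by nra.
auto_derive.
- repeat split; auto; try (eexists; eassumption); lra.
- assert (E1 : Derive (fun x : R => A x) s = a) by exact (is_derive_unique _ _ _ Ha).
  assert (E2 : Derive (fun x : R => B x) s = b) by exact (is_derive_unique _ _ _ Hb).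
  assert (E3 : forall y, Derive (fun x : R => trig x) y = trig' y) by (intros y; exact (is_derive_unique _ _ _ (Htrig y))).
  rewrite E1, E2, E3. unfold Rdiv. field. repeat split; try lra; nra.
Qed.

Lemma pder_Cpower (X : R -> C) s l x :
  (0 < Re (X s))%R -> pder X s l ->
  pder (fun t => Cpower (X t) x) s (RtoC x * (Cpower (X s) x / X s) * l).
Proof.
intros HX Hl.
apply (pder_ext_loc (fun t =>
  ((exp (x * (ln (Re (X t) * Re (X t) + Im (X t) * Im (X t)) / 2)) * cos (x * atan (Im (X t) / Re (X t))))%R,
   (exp (x * (ln (Re (X t) * Re (X t) + Im (X t) * Im (X t)) / 2)) * sin (x * atan (Im (X t) / Re (X t))))%R) : C)).
- destruct (pder_continuous X s l (Re (X s)) Hl HX) as (d & Hd & H).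
  exists (mkposreal d Hd). intros t Ht. symmetry. apply Cpower_polar.
  specialize (H t Ht). pose proof (re_le_Cmod (X t - X s)) as Hr.
  unfold Cminus in *. rewrite re_plus, re_opp in Hr. apply Rabs_le_between in Hr. lra.
- rewrite (Cpower_polar (X s)) by auto.
  set (n := (Re (X s) * Re (X s) + Im (X s) * Im (X s))%R).
  assert (Hn : (0 < n)%R) by (unfold n; nra).
  set (r := exp (x * (ln n / 2))). set (th := (x * atan (Im (X s) / Re (X s)))%R).
  assert (Einv : / X s = ((Re (X s) / n)%R, (- Im (X s) / n)%R)).
  { unfold Cinv, n, Re, Im. apply f_equal2; f_equal; ring. }
  split.
  + eapply is_derive_eq.
    * exact (is_derive_polar (fun t => Re (X t)) (fun t => Im (X t)) s (Re l) (Im l) x cos (fun y => (- sin y)%R)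
        (fun y => is_derive_cos y) HX (proj1 Hl) (proj2 Hl)).
    * cbv beta. fold n r th. unfold Cdiv. rewrite Einv.
      rewrite re_mult, re_scal_l, im_scal_l, re_mult, im_mult.
      unfold Re, Im. cbn [fst snd]. field. lra.
  + eapply is_derive_eq.
    * exact (is_derive_polar (fun t => Re (X t)) (fun t => Im (X t)) s (Re l) (Im l) x sin cos
        (fun y => is_derive_sin y) HX (proj1 Hl) (proj2 Hl)).
    * cbv beta. fold n r th. unfold Cdiv. rewrite Einv.
      rewrite im_mult, re_scal_l, im_scal_l, re_mult, im_mult.
      unfold Re, Im. cbn [fst snd]. field. lra.
Qed.

Lemma Re_one_minus_pow6 (w : C) : (Cmod w <= 1 / 2)%R -> (63 / 64 <= Re (1 - w ^ 6)%C)%R.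
Proof.
intros H. unfold Cminus. rewrite re_plus, re_opp, re_RtoC.
assert (Hc : (Cmod (w ^ 6) <= (1 / 2) ^ 6)%R) by (rewrite Cmod_pow; apply pow_incr; split; [apply Cmod_ge_0|auto]).
pose proof (re_le_Cmod (w ^ 6)) as Hr. apply Rabs_le_between in Hr. lra.
Qed.

Lemma delta_lower (w : C) : (Cmod w <= 1 / 2)%R -> (1 / 2 <= Cmod (delta w))%R.
Proof.
intros H. pose proof (Re_one_minus_pow6 w H) as HR.
apply Rnot_lt_le. intros Hlt.
assert (E : (Cmod (delta w) ^ 6 = Cmod (1 - w ^ 6)%C)%R) by (rewrite <- Cmod_pow, delta_pow6 by lra; reflexivity).
assert ((Cmod (delta w) ^ 6 <= (1 / 2) ^ 6)%R) by (apply pow_incr; split; [apply Cmod_ge_0|lra]).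
pose proof (re_le_Cmod (1 - w ^ 6)) as Hr. apply Rabs_le_between in Hr. lra.
Qed.

Lemma delta_nz (w : C) : (Cmod w <= 1 / 2)%R -> delta w <> 0.
Proof. intros H. apply Cmod_gt_0. pose proof (delta_lower w H). lra. Qed.

(** The derivative of [s -> Iu (s u)]. *)
Definition ray_speed (u : C) (s : R) : C := u * (RtoC s * u / delta (RtoC s * u) ^ 5).

Lemma ray_bound (u : C) s : (Cmod u < 1 / 4)%R -> (-2 <= s <= 2)%R -> (Cmod (RtoC s * u) <= 1 / 2)%R.
Proof.
intros Hu Hs. rewrite Cmod_mult, Cmod_R. assert (Rabs s <= 2)%R by (apply Rabs_le; lra).
pose proof (Rabs_pos s). pose proof (Cmod_ge_0 u). nra.
Qed.

Lemma pder_ray (u : C) s : pder (fun t => RtoC t * u) s u.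
Proof. apply (pder_ext (fun t => 0 + RtoC t * u)); [intros; ring|apply pder_affine]. Qed.

Lemma pder_delta_ray (u : C) s : (Cmod (RtoC s * u) <= 1 / 2)%R ->
  pder (fun t => delta (RtoC t * u)) s (- (delta (RtoC s * u) / delta (RtoC s * u) ^ 6 * (RtoC s * u) ^ 5 * u)).
Proof.
intros Hs. pose proof (Re_one_minus_pow6 _ Hs) as HR. unfold delta at 1.
assert (Hx : 1 - (RtoC s * u) ^ 6 <> 0) by (intros E; rewrite E in HR; cbn in HR; lra).
eapply pder_eq.
- apply (pder_Cpower (fun t => 1 - (RtoC t * u) ^ 6)); [lra|].
  apply pder_minus; [apply pder_const|]. apply pder_pow, pder_ray.
- fold (delta (RtoC s * u)). rewrite delta_pow6 by lra. cbn [pred INR].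
  replace (RtoC (1 / 6)) with (/ 6) by (rewrite RtoC_div by lra; field; apply RtoC_nz; lra).
  rewrite !RtoC_plus. set (w := RtoC s * u) in *.
  assert (H6 : RtoC 1 + RtoC 1 + RtoC 1 + RtoC 1 + RtoC 1 + RtoC 1 = 6).
  { rewrite <- !RtoC_plus. f_equal. ring. }
  rewrite H6. field. exact Hx.
Qed.

Lemma pder_ray_speed (u : C) s : (Cmod (RtoC s * u) <= 1 / 2)%R -> exists l, pder (ray_speed u) s l.
Proof.
intros Hs. eexists. unfold ray_speed. apply pder_scal. unfold Cdiv.
apply pder_mult; [apply pder_ray|]. apply pder_inv.
- apply Cpow_nz. now apply delta_nz.
- apply pder_pow. now apply pder_delta_ray.
Qed.

Lemma pder_Re_continuous (g : R -> C) s l : pder g s l -> continuous (fun t => Re (g t)) s.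
Proof. intros [H _]. apply (ex_derive_continuous (V := R_NormedModule)). now exists (Re l). Qed.

Lemma pder_Im_continuous (g : R -> C) s l : pder g s l -> continuous (fun t => Im (g t)) s.
Proof. intros [_ H]. apply (ex_derive_continuous (V := R_NormedModule)). now exists (Im l). Qed.

Lemma ray_speed_continuous (u : C) s : (Cmod u < 1 / 4)%R -> (-2 <= s <= 2)%R ->
  continuous (fun t => Re (ray_speed u t)) s /\ continuous (fun t => Im (ray_speed u t)) s.
Proof.
intros Hu Hs. destruct (pder_ray_speed u s (ray_bound u s Hu Hs)) as (l & Hl).
split; [now apply pder_Re_continuous with l|now apply pder_Im_continuous with l].
Qed.

(** Rescaling the segment turns [Iu] at [s u] into the integral of the speed up to [s]. *)
Lemma Iu_ray (u : C) s : (Cmod u < 1 / 4)%R -> (-2 <= s <= 2)%R ->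
  Iu (RtoC s * u) = (RInt (fun t => Re (ray_speed u t)) 0 s, RInt (fun t => Im (ray_speed u t)) 0 s).
Proof.
intros Hu Hs.
assert (HI : forall t, (Rmin 0 s <= t <= Rmax 0 s)%R -> (-2 <= t <= 2)%R).
{ intros t Ht. destruct (Rle_dec 0 s); [rewrite Rmin_left, Rmax_right in Ht by lra|rewrite Rmin_right, Rmax_left in Ht by lra]; lra. }
assert (I1 : is_RInt (fun t => Re (ray_speed u t)) 0 s (RInt (fun t => Re (ray_speed u t)) 0 s)).
{ apply (RInt_correct (V := R_CompleteNormedModule)), (ex_RInt_continuous (V := R_CompleteNormedModule)).
  intros z Hz. exact (proj1 (ray_speed_continuous u z Hu (HI z Hz))). }
assert (I2 : is_RInt (fun t => Im (ray_speed u t)) 0 s (RInt (fun t => Im (ray_speed u t)) 0 s)).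
{ apply (RInt_correct (V := R_CompleteNormedModule)), (ex_RInt_continuous (V := R_CompleteNormedModule)).
  intros z Hz. exact (proj2 (ray_speed_continuous u z Hu (HI z Hz))). }
assert (I : is_RInt (V := C_R_NormedModule) (ray_speed u) 0 s
  (RInt (fun t => Re (ray_speed u t)) 0 s, RInt (fun t => Im (ray_speed u t)) 0 s)).
{ exact (is_RInt_fct_extend_pair (U := R_NormedModule) (V := R_NormedModule) (ray_speed u) 0 s _ _ I1 I2). }
unfold Iu. apply (is_RInt_unique (V := C_R_CompleteNormedModule)).
apply (is_RInt_ext (V := C_R_NormedModule) (fun x => scal s (ray_speed u (s * x + 0)))).
- intros x _. rewrite scal_R_Cmult. unfold ray_speed. rewrite Rplus_0_r, RtoC_mult.
  replace (RtoC x * (RtoC s * u)) with (RtoC s * RtoC x * u) by ring. unfold Cdiv.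
  match goal with |- ?a = ?b => change (@eq C a b) end. ring.
- apply (is_RInt_comp_lin (V := C_R_NormedModule)).
  replace (s * 0 + 0)%R with 0%R by ring. replace (s * 1 + 0)%R with s by ring. exact I.
Qed.

Lemma pder_Iu_ray (u : C) s : (Cmod u < 1 / 4)%R -> (0 <= s <= 1)%R ->
  pder (fun t => Iu (RtoC t * u)) s (ray_speed u s).
Proof.
intros Hu Hs.
apply (pder_ext_loc (fun t => (RInt (fun x => Re (ray_speed u x)) 0 t, RInt (fun x => Im (ray_speed u x)) 0 t) : C)).
- exists (mkposreal 1 Rlt_0_1). intros t Ht. apply Rabs_def2 in Ht. unfold minus, plus, opp in Ht; cbn in Ht.
  symmetry. apply Iu_ray; auto. lra.
- assert (HI : forall t x, (Rabs (t - s) < 1)%R -> (Rmin 0 t <= x <= Rmax 0 t)%R -> (-2 <= x <= 2)%R).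
  { intros t x Ht Hx. apply Rabs_def2 in Ht.
    destruct (Rle_dec 0 t); [rewrite Rmin_left, Rmax_right in Hx by lra|rewrite Rmin_right, Rmax_left in Hx by lra]; lra. }
  split; cbn [Re Im fst snd].
  + apply (is_derive_RInt (V := R_CompleteNormedModule) (fun x => Re (ray_speed u x)) (fun t => RInt (fun x => Re (ray_speed u x)) 0 t) 0).
    * exists (mkposreal 1 Rlt_0_1). intros t Ht.
      apply (RInt_correct (V := R_CompleteNormedModule)), (ex_RInt_continuous (V := R_CompleteNormedModule)).
      intros x Hx. exact (proj1 (ray_speed_continuous u x Hu (HI t x Ht Hx))).
    * exact (proj1 (ray_speed_continuous u s Hu ltac:(lra))).
  + apply (is_derive_RInt (V := R_CompleteNormedModule) (fun x => Im (ray_speed u x)) (fun t => RInt (fun x => Im (ray_speed u x)) 0 t) 0).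
    * exists (mkposreal 1 Rlt_0_1). intros t Ht.
      apply (RInt_correct (V := R_CompleteNormedModule)), (ex_RInt_continuous (V := R_CompleteNormedModule)).
      intros x Hx. exact (proj2 (ray_speed_continuous u x Hu (HI t x Ht Hx))).
    * exact (proj2 (ray_speed_continuous u s Hu ltac:(lra))).
Qed.

Lemma ray_speed_bound (u : C) s : (Cmod u < 1 / 4)%R -> (0 <= s <= 1)%R ->
  (Cmod (ray_speed u s) <= 32 * Cmod u ^ 2)%R.
Proof.
intros Hu Hs. assert (Hb := ray_bound u s Hu ltac:(lra)).
pose proof (delta_lower _ Hb) as Hd. unfold ray_speed.
rewrite Cmod_mult, Cmod_div by now apply Cpow_nz, delta_nz.
rewrite Cmod_mult, Cmod_pow, Cmod_R, Rabs_pos_eq by lra. pose proof (Cmod_ge_0 u).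
assert (H5 : ((1 / 2) ^ 5 <= Cmod (delta (RtoC s * u)) ^ 5)%R) by (apply pow_incr; lra).
assert (Hi : (/ Cmod (delta (RtoC s * u)) ^ 5 <= 32)%R).
{ replace 32%R with (/ ((1 / 2) ^ 5))%R by field. apply Rinv_le_contravar; lra. }
assert (Hi0 : (0 < / Cmod (delta (RtoC s * u)) ^ 5)%R) by (apply Rinv_0_lt_compat; lra).
unfold Rdiv. set (y := (/ Cmod (delta (RtoC s * u)) ^ 5)%R) in *.
assert (s * Cmod u * y <= Cmod u * 32)%R by (apply Rmult_le_compat; nra). nra.
Qed.

Lemma Iu_bound (u : C) : (Cmod u < 1 / 4)%R -> (Cmod (Iu u) <= 64 * Cmod u ^ 2)%R.
Proof.
intros Hu. replace u with (RtoC 1 * u) at 1 by ring. rewrite Iu_ray by (auto; lra).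
eapply Rle_trans; [apply Cmod_le_Re_Im|]. cbn [Re Im fst snd].
assert (HR : forall f : R -> R, (forall s, (0 <= s <= 1)%R -> continuous f s) ->
  (forall s, (0 <= s <= 1)%R -> (Rabs (f s) <= 32 * Cmod u ^ 2)%R) -> (Rabs (RInt f 0 1) <= 32 * Cmod u ^ 2)%R).
{ intros f Hc Hb. replace (32 * Cmod u ^ 2)%R with ((1 - 0) * (32 * Cmod u ^ 2))%R by ring.
  apply abs_RInt_le_const; [lra| |exact Hb].
  apply (ex_RInt_continuous (V := R_CompleteNormedModule)). intros z Hz.
  rewrite Rmin_left, Rmax_right in Hz by lra. now apply Hc. }
assert (H1 := HR (fun t => Re (ray_speed u t))). assert (H2 := HR (fun t => Im (ray_speed u t))).
unfold Re, Im in *.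
enough (Rabs (RInt (fun t => fst (ray_speed u t)) 0 1) <= 32 * Cmod u ^ 2
  /\ Rabs (RInt (fun t => snd (ray_speed u t)) 0 1) <= 32 * Cmod u ^ 2)%R by lra.
split.
- apply H1; intros s Hs; [exact (proj1 (ray_speed_continuous u s Hu ltac:(lra)))|].
  eapply Rle_trans; [apply re_le_Cmod|now apply ray_speed_bound].
- apply H2; intros s Hs; [exact (proj2 (ray_speed_continuous u s Hu ltac:(lra)))|].
  eapply Rle_trans; [apply Im_le_Cmod|now apply ray_speed_bound].
Qed.

(** Along every ray, [u^2 / delta^2] and [1 / delta^3] satisfy the differential
    system of [psi] and [psi' / 2] in the time [Iu]; uniqueness identifies them. *)
Lemma germ_along_Iu (f g : C -> C) (r : R) :
  (0 < r)%R ->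
  (forall z, (Cmod z < r)%R -> Cder f z (2 * g z)) ->
  (forall z, (Cmod z < r)%R -> Cder g z (3 * f z ^ 2)) ->
  f 0 = 0 -> g 0 = 1 ->
  forall u, (Cmod u < 1 / 4)%R -> (64 * Cmod u ^ 2 < r)%R ->
    f (Iu u) = u ^ 2 / delta u ^ 2 /\ g (Iu u) = / delta u ^ 3.
Proof.
intros Hr Hf Hg Hf0 Hg0 u Hu Hur. pose proof (Cmod_ge_0 u) as Hu0.
assert (Hsmall : forall s, (0 <= s <= 1)%R -> (Cmod (Iu (RtoC s * u)) < r)%R).
{ intros s Hs. assert (E : (Cmod (RtoC s * u) <= Cmod u)%R) by (rewrite Cmod_mult, Cmod_R, Rabs_pos_eq by lra; nra).
  eapply Rle_lt_trans; [apply Iu_bound; lra|]. 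
  pose proof (Cmod_ge_0 (RtoC s * u)). nra. }
assert (HI0 : Iu 0 = 0).
{ apply Cmod_eq_0. assert (H := Iu_bound 0 ltac:(rewrite Cmod_0; lra)). rewrite Cmod_0 in H.
  pose proof (Cmod_ge_0 (Iu 0)). lra. }
destruct (ode_unique (fun s => f (Iu (RtoC s * u))) (fun s => g (Iu (RtoC s * u)))
  (fun s => (RtoC s * u) ^ 2 / delta (RtoC s * u) ^ 2) (fun s => / delta (RtoC s * u) ^ 3) (ray_speed u)) as [E1 E2].
- intros s Hs. apply (pder_comp f (fun t => Iu (RtoC t * u))); [now apply Hf, Hsmall|now apply pder_Iu_ray].
- intros s Hs. apply (pder_comp g (fun t => Iu (RtoC t * u))); [now apply Hg, Hsmall|now apply pder_Iu_ray].
- intros s Hs. assert (Hb := ray_bound u s Hu ltac:(lra)). assert (Hd := delta_nz _ Hb).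
  assert (H6 := delta_pow6 (RtoC s * u) ltac:(pose proof (Re_one_minus_pow6 _ Hb); lra)).
  eapply pder_eq.
  + unfold Cdiv. apply pder_mult; [apply pder_pow, pder_ray|].
    apply pder_inv; [now apply Cpow_nz|]. now apply pder_pow, pder_delta_ray.
  + unfold ray_speed. set (w := RtoC s * u) in *. set (D := delta w) in *. cbn [pred INR].
    replace (RtoC (1 + 1)) with (RtoC 2) by (f_equal; ring).
    assert (E : 2 * w * u * D ^ 6 + 2 * w * u * w ^ 6 = 2 * w * u) by (rewrite H6; ring).
    transitivity ((2 * w * u * D ^ 6 + 2 * w * u * w ^ 6) / D ^ 8); [field; auto|]. rewrite E. field; auto.
- intros s Hs. assert (Hb := ray_bound u s Hu ltac:(lra)). assert (Hd := delta_nz _ Hb).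
  eapply pder_eq.
  + apply pder_inv; [now apply Cpow_nz|]. now apply pder_pow, pder_delta_ray.
  + unfold ray_speed. set (w := RtoC s * u) in *. set (D := delta w) in *. cbn [pred INR].
    replace (RtoC (1 + 1 + 1)) with (RtoC 3) by (f_equal; ring). field; auto.
- intros s Hs. apply pder_ray_speed, ray_bound; auto. lra.
- replace (RtoC 0 * u) with (RtoC 0) by ring. rewrite HI0, Hf0. unfold Cdiv. ring.
- replace (RtoC 0 * u) with (RtoC 0) by ring. rewrite HI0, Hg0, delta_0. field. 
- replace (RtoC 1 * u) with u in E1, E2 by ring. now split.
Qed.

(** * Histories as iterated derivatives *)

(** The sum of [p^a' q^b'] over the histories of length [n] leading from
    [(2 a, 3 b)] to [(2 a', 3 b')]. *)
Fixpoint history_poly (n a b : nat) (p q : C) : C :=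
  match n with
  | 0%nat => p ^ a * q ^ b
  | S n => RtoC (INR (2 * a)) * history_poly n (a - 1) (b + 1) p q
           + RtoC (INR (3 * b)) * history_poly n (a + 2) (b - 1) p q
  end.

(** The system [p' = 2 q, q' = 3 p ^ 2] differentiates a monomial exactly as one
    draw transforms a state. *)
Lemma history_poly_derive n a b (p q : R -> C) s :
  pder p s (2 * q s) -> pder q s (3 * p s ^ 2) ->
  pder (fun t => history_poly n a b (p t) (q t)) s (history_poly (S n) a b (p s) (q s)).
Proof.
intros Hp Hq. revert a b. induction n as [|n IH]; intros a b.
- eapply pder_eq.
  + apply pder_mult; [apply pder_pow, Hp|apply pder_pow, Hq].
  + cbn [history_poly]. rewrite !mult_INR, !RtoC_mult.
    replace (INR 2) with 2%R by (cbn; ring). replace (INR 3) with 3%R by (cbn; ring).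
    destruct a as [|a], b as [|b]; cbn [pred INR Nat.sub]; rewrite ?Nat.sub_0_r, ?Cpow_add_r;
      cbn [Cpow]; ring.
- cbn [history_poly].
  apply (pder_plus (fun t => RtoC (INR (2 * a)) * history_poly n (a - 1) (b + 1) (p t) (q t))
    (fun t => RtoC (INR (3 * b)) * history_poly n (a + 2) (b - 1) (p t) (q t)));
    apply pder_scal, IH.
Qed.

Fixpoint history_weight (n a b : nat) (u : C) : C :=
  match n with
  | 0%nat => u ^ (2 * a)
  | S n => RtoC (INR (2 * a)) * history_weight n (a - 1) (b + 1) u
           + RtoC (INR (3 * b)) * history_weight n (a + 2) (b - 1) u
  end.

(** Each draw adds one ball, so every final state has [n + 2 a + 3 b] balls, and with
    [p = u^2 / D^2], [q = 1 / D^3] the powers of [D] are the same in all weights. *)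
Lemma history_weight_homogeneous n a b (u D : C) : D <> 0 ->
  history_weight n a b u = D ^ (n + 2 * a + 3 * b) * history_poly n a b (u ^ 2 / D ^ 2) (/ D ^ 3).
Proof.
intros HD. revert a b. induction n as [|n IH]; intros a b; cbn [history_weight history_poly].
- cbn [Nat.add]. unfold Cdiv. rewrite Cpow_mult_l, !Cpow_inv by now apply Cpow_nz.
  rewrite <- !Cpow_mult_r, Cpow_add_r. field. split; now apply Cpow_nz.
- rewrite !IH, Cmult_plus_distr_l. f_equal.
  + destruct a as [|a]; [change (INR (2 * 0)) with 0%R; rewrite !Cmult_0_l, Cmult_0_r; reflexivity|].
    replace (n + 2 * (S a - 1) + 3 * (b + 1))%nat with (S n + 2 * S a + 3 * b)%nat by lia. ring.
  + destruct b as [|b]; [change (INR (3 * 0)) with 0%R; rewrite !Cmult_0_l, Cmult_0_r; reflexivity|].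
    replace (n + 2 * (a + 2) + 3 * (S b - 1))%nat with (S n + 2 * a + 3 * S b)%nat by lia. ring.
Qed.

Fixpoint Lsum {A : Type} (F : A -> C) (l : list A) : C :=
  match l with nil => RtoC 0 | x :: l => F x + Lsum F l end.

Lemma Lsum_app {A} (F : A -> C) l l' : Lsum F (l ++ l') = Lsum F l + Lsum F l'.
Proof. induction l as [|x l IH]; cbn [app Lsum]; [|rewrite IH]; ring. Qed.

Lemma Lsum_flat_map {A B} (F : B -> C) (phi : A -> list B) l :
  Lsum F (flat_map phi l) = Lsum (fun x => Lsum F (phi x)) l.
Proof. induction l as [|x l IH]; cbn [flat_map Lsum]; [|rewrite Lsum_app, IH]; reflexivity. Qed.

Lemma Lsum_map {A B} (F : B -> C) (phi : A -> B) l : Lsum F (map phi l) = Lsum (fun x => F (phi x)) l.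
Proof. induction l as [|x l IH]; cbn [map Lsum]; [|rewrite IH]; reflexivity. Qed.

Lemma Lsum_const {A} (F : A -> C) c l :
  (forall x, In x l -> F x = c) -> Lsum F l = RtoC (INR (length l)) * c.
Proof.
induction l as [|x l IH]; intros H; cbn [Lsum length]; [cbn [INR]; ring|].
rewrite H by now left. rewrite IH by (intros; apply H; now right).
rewrite S_INR, RtoC_plus. ring.
Qed.

Definition final_power (s : state) (u : C) (h : list Z) : C := u ^ Z.to_nat (fst (final T23 s h)).

Definition st (a b : nat) : state := ((2 * Z.of_nat a)%Z, (3 * Z.of_nat b)%Z).


Lemma draw_first a b i : (0 <= i < 2 * Z.of_nat a)%Z -> draw T23 (st a b) i = st (a - 1) (b + 1).
Proof.
intros Hi. unfold draw, st, T23. cbn [fst snd].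
destruct (Z.ltb_spec i (2 * Z.of_nat a)) as [H|H]; [|lia]. cbn [fst snd]. f_equal; lia.
Qed.

Lemma draw_second a b i : (2 * Z.of_nat a <= i < 2 * Z.of_nat a + 3 * Z.of_nat b)%Z ->
  draw T23 (st a b) i = st (a + 2) (b - 1).
Proof.
intros Hi. unfold draw, st, T23. cbn [fst snd].
destruct (Z.ltb_spec i (2 * Z.of_nat a)) as [H|H]; [lia|]. cbn [fst snd]. f_equal; lia.
Qed.

Lemma histories_weight n a b u :
  Lsum (final_power (st a b) u) (histories T23 n (st a b)) = history_weight n a b u.
Proof.
revert a b. induction n as [|n IH]; intros a b.
- cbn [histories Lsum history_weight]. unfold final_power, final, st. cbn [fold_left fst].
  replace (Z.to_nat (2 * Z.of_nat a)) with (2 * a)%nat by lia. ring.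
- cbn [histories history_weight]. rewrite Lsum_flat_map.
  assert (Hstep : forall i, Lsum (final_power (st a b) u) (map (cons i) (histories T23 n (draw T23 (st a b) i)))
    = Lsum (final_power (draw T23 (st a b) i) u) (histories T23 n (draw T23 (st a b) i)))
    by (intros i; now rewrite Lsum_map).
  unfold balls. rewrite Lsum_map.
  replace (Z.to_nat (fst (st a b) + snd (st a b))) with (2 * a + 3 * b)%nat by (unfold st; cbn [fst snd]; lia).
  rewrite seq_app, Lsum_app. cbn [Nat.add]. f_equal.
  + rewrite (Lsum_const _ (history_weight n (a - 1) (b + 1) u)); [now rewrite length_seq|].
    intros i Hi. apply in_seq in Hi. rewrite Hstep, draw_first by lia. apply IH.
  + rewrite (Lsum_const _ (history_weight n (a + 2) (b - 1) u)); [now rewrite length_seq|].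
    intros i Hi. apply in_seq in Hi. rewrite Hstep, draw_second by lia. apply IH.
Qed.

Lemma Csum_indicator (u : C) (m N : nat) : (m <= N)%nat ->
  Csum (fun k => if (Z.of_nat m =? Z.of_nat k)%Z then u ^ k else 0) N = u ^ m.
Proof.
intros Hm. induction N as [|N IH].
- replace m with 0%nat by lia. rewrite Csum_0. reflexivity.
- rewrite Csum_S. destruct (Nat.eq_dec m (S N)) as [->|Hne].
  + rewrite Z.eqb_refl. rewrite Csum_zero; [ring|]. intros j Hj.
    destruct (Z.eqb_spec (Z.of_nat (S N)) (Z.of_nat j)); [lia|reflexivity].
  + rewrite IH by lia. destruct (Z.eqb_spec (Z.of_nat m) (Z.of_nat (S N))); [lia|ring].
Qed.

Lemma Csum_plus (u v : nat -> C) N : Csum (fun k => u k + v k) N = Csum u N + Csum v N.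
Proof. induction N as [|N IH]; [now rewrite !Csum_0|]. rewrite !Csum_S, IH. ring. Qed.

Lemma Csum_ext (u v : nat -> C) N : (forall k, u k = v k) -> Csum u N = Csum v N.
Proof. intros H. induction N as [|N IH]; [now rewrite !Csum_0|]. now rewrite !Csum_S, IH, H. Qed.

Lemma counting_sum {A} (m : A -> Z) (u : C) N (l : list A) :
  (forall h, In h l -> (0 <= m h <= Z.of_nat N)%Z) ->
  Csum (fun k => RtoC (INR (length (filter (fun h => (m h =? Z.of_nat k)%Z) l))) * u ^ k) N
  = Lsum (fun h => u ^ Z.to_nat (m h)) l.
Proof.
induction l as [|x l IH]; intros H.
- cbn [filter length Lsum INR]. apply Csum_zero. intros; ring.
- cbn [Lsum]. rewrite <- IH by (intros; apply H; now right).
  rewrite <- (Csum_indicator u (Z.to_nat (m x)) N) by (specialize (H x (or_introl eq_refl)); lia).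
  rewrite <- Csum_plus. apply Csum_ext. intros k. cbn [filter].
  rewrite Z2Nat.id by (specialize (H x (or_introl eq_refl)); lia).
  destruct (Z.eqb_spec (m x) (Z.of_nat k)); [|ring].
  cbn [length]. rewrite S_INR, RtoC_plus. ring.
Qed.

Lemma h_poly_eq n u : h_poly n u = history_weight n 1 0 u.
Proof.
rewrite <- histories_weight.
transitivity (Csum (fun k => RtoC (INR (length (filter (fun h => (fst (final T23 T23_start h) =? Z.of_nat k)%Z)
  (histories T23 n T23_start)))) * u ^ k) (n + 2)); [reflexivity|].
rewrite counting_sum; [reflexivity|].
intros h Hh. pose proof (T23_final n h Hh) as H. cbv zeta in H. lia.
Qed.

Lemma has_ps_pder (f g : C -> C) z0 a r :
  has_ps f z0 a r ->
  (forall h, (Cmod h < r)%R -> pder (fun t => f (z0 + h + RtoC t)) 0 (g (z0 + h))) ->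
  has_ps g z0 (fun n => RtoC (INR (S n)) * a (S n)) r.
Proof.
intros Hf Hg. split; [apply Hf|]. intros h Hh.
destruct (has_ps_derive f z0 a r h Hf Hh) as (D & HD & H).
replace (g (z0 + h)) with D; auto.
apply (pder_unique _ _ _ _) with (2 := Hg h Hh).
eapply pder_eq; [apply (pder_comp f (fun t => z0 + h + RtoC t) 0 D 1)|ring].
- now replace (z0 + h + RtoC 0) with (z0 + h) by ring.
- apply (pder_ext (fun t => (z0 + h) + RtoC t * 1)); [intros; ring|apply pder_affine].
Qed.

Lemma taylor_coefficients (F : nat -> C -> C) z0 a r n :
  has_ps (F 0%nat) z0 a r ->
  (forall k h, (Cmod h < r)%R -> pder (fun t => F k (z0 + h + RtoC t)) 0 (F (S k) (z0 + h))) ->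
  RtoC (INR (fact n)) * a n = F n z0.
Proof.
revert F a. induction n as [|n IH]; intros F a HF HD.
- rewrite <- (has_ps_center _ _ _ _ HF). cbn. ring.
- rewrite <- (IH (fun k => F (S k)) (fun n => RtoC (INR (S n)) * a (S n))).
  + change (fact (S n)) with (S n * fact n)%nat. rewrite mult_INR, RtoC_mult. ring.
  + apply (has_ps_pder (F 0%nat)); [exact HF|intros h Hh; now apply HD].
  + intros k h Hh. now apply HD.
Qed.

(** The Taylor expansion of [psi] at [Iu u] is the generating function, since
    [n!] times its coefficients are sums over histories. *)
Lemma urn_series (f g : C -> C) (z0 u D : C) a r :
  has_ps f z0 a r ->
  (forall h, (Cmod h < r)%R -> Cder f (z0 + h) (2 * g (z0 + h))) ->
  (forall h, (Cmod h < r)%R -> Cder g (z0 + h) (3 * f (z0 + h) ^ 2)) ->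
  D <> 0 -> f z0 = u ^ 2 / D ^ 2 -> g z0 = / D ^ 3 ->
  forall z, (Cmod (z * D) < r)%R -> is_H z u (D ^ 2 * f (z * D + z0)).
Proof.
intros Hf HDf HDg HD Ef Eg z Hz.
assert (Hco : forall n, RtoC (INR (fact n)) * a n = history_poly n 1 0 (f z0) (g z0)).
{ intros n. apply (taylor_coefficients (fun n x => history_poly n 1 0 (f x) (g x)) z0 a r).
  - apply (has_ps_ext f); [|exact Hf]. intros h _. cbn [history_poly Cpow]. ring.
  - intros k h Hh.
    assert (Hline : pder (fun t => z0 + h + RtoC t) 0 1).
    { apply (pder_ext (fun t => (z0 + h) + RtoC t * 1)); [intros; ring|apply pder_affine]. }
    assert (E0 : z0 + h + RtoC 0 = z0 + h) by ring.
    pose proof (history_poly_derive k 1 0 (fun t => f (z0 + h + RtoC t)) (fun t => g (z0 + h + RtoC t)) 0) as H.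
    cbv beta in H. rewrite E0 in H. apply H.
    + eapply pder_eq; [apply (pder_comp f (fun t => z0 + h + RtoC t) 0 (2 * g (z0 + h)) 1); auto; rewrite E0; now apply HDf|ring].
    + eapply pder_eq; [apply (pder_comp g (fun t => z0 + h + RtoC t) 0 (3 * f (z0 + h) ^ 2) 1); auto; rewrite E0; now apply HDg|ring]. }
unfold is_H. rewrite (Cplus_comm (z * D)).
apply (Cseries_ext (fun n => D ^ 2 * (a n * (z * D) ^ n))).
- intros n. rewrite h_poly_eq, (history_weight_homogeneous n 1 0 u D HD), <- Ef, <- Eg, <- Hco.
  rewrite Cpow_mult_l. replace (n + 2 * 1 + 3 * 0)%nat with (n + 2)%nat by lia. rewrite Cpow_add_r.
  field. apply RtoC_nz. apply INR_fact_neq_0.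
- apply Cseries_scal. now apply Hf.
Qed.

(** * The function psi of the urn *)

Lemma Cder_comp_affine (f : C -> C) (m a b z l : C) :
  a <> 0 -> Cder f (a * z + b) l -> Cder (fun x => m * f (a * x + b)) z (m * (a * l)).
Proof.
intros Ha H eps He. assert (Hp := proj1 (Cmod_gt_0 a) Ha).
set (A := ((Cmod m + 1) * Cmod a)%R).
assert (HA : (0 < A)%R) by (unfold A; pose proof (Cmod_ge_0 m); nra).
destruct (H (eps / A)%R) as (d & Hd & Hf); [now apply Rdiv_lt_0_compat|].
exists (d / Cmod a)%R. split; [now apply Rdiv_lt_0_compat|]. intros h Hh.
assert (Hah : (Cmod (a * h) < d)%R).
{ rewrite Cmod_mult. apply (Rmult_lt_compat_l (Cmod a)) in Hh; auto.
  replace (Cmod a * (d / Cmod a))%R with d in Hh by (field; lra). exact Hh. }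
specialize (Hf (a * h) Hah).
replace (m * f (a * (z + h) + b) - m * f (a * z + b) - m * (a * l) * h)
  with (m * (f (a * z + b + a * h) - f (a * z + b) - l * (a * h))).
2:{ replace (a * (z + h) + b) with (a * z + b + a * h) by ring. ring. }
rewrite Cmod_mult. rewrite Cmod_mult in Hf.
pose proof (Cmod_ge_0 m). pose proof (Cmod_ge_0 h).
apply Rle_trans with (Cmod m * (eps / A * (Cmod a * Cmod h)))%R; [now apply Rmult_le_compat_l|].
apply Rle_trans with ((Cmod m + 1) * (eps / A * (Cmod a * Cmod h)))%R.
- apply Rmult_le_compat_r; [|lra]. apply Rmult_le_pos; [left; now apply Rdiv_lt_0_compat|nra].
- apply Req_le. unfold A. field. lra.
Qed.

Lemma wp_blowup B : exists r, (0 < r <= 1)%R /\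
  forall k : C, k <> 0 -> (Cmod k < r)%R -> (B < Cmod (wp hex_lattice k))%R.
Proof.
destruct wp_reg_small as (K & r & HK & Hr & HA).
set (Y := (Rabs B + K + 1)%R). assert (HY : (1 <= Y)%R) by (unfold Y; pose proof (Rabs_pos B); lra).
assert (HiY : (0 < / Y)%R) by (apply Rinv_0_lt_compat; lra).
exists (Rmin r (/ Y)). split.
{ split; [apply Rmin_glb_lt; lra|]. eapply Rle_trans; [apply Rmin_l|lra]. }
intros k Hk Hkr.
destruct (Rlt_Rmin _ _ _ Hkr) as [H1 H2].
assert (Hp := proj1 (Cmod_gt_0 k) Hk).
specialize (HA k H1).
assert (Hreg : (Cmod (wp_reg k) <= K)%R).
{ eapply Rle_trans; [exact HA|]. rewrite <- (Rmult_1_r K) at 2. apply Rmult_le_compat_l; auto.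
  rewrite <- (pow1 3). apply pow_incr. lra. }
assert (Hinv : (Y < / Cmod k ^ 2)%R).
{ apply Rlt_le_trans with (/ Cmod k)%R.
  - rewrite <- (Rinv_inv Y). apply Rinv_lt_contravar; auto. nra.
  - apply Rinv_le_contravar; [now apply pow_lt|]. nra. }
pose proof (Cmod_triangle (wp hex_lattice k) (- wp_reg k)) as T.
rewrite Cmod_opp, wp_eq in T. replace (/ k ^ 2 + wp_reg k + - wp_reg k) with (/ k ^ 2) in T by ring.
rewrite Cmod_inv, Cmod_pow in T by now apply Cpow_nz. rewrite wp_eq.
pose proof (Rle_abs B). unfold Y in Hinv. lra.
Qed.

Lemma wp_near_pole (v k : C) : hex_lattice v -> k <> 0 -> (Cmod k < 1)%R -> wp hex_lattice (v + k) = wp hex_lattice k.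
Proof. intros Hv Hk Hk1. rewrite Cplus_comm. apply wp_periodic; auto. now apply small_not_hex. Qed.

Lemma wp_not_analytic_at_lattice v : hex_lattice v -> ~ analytic_at (wp hex_lattice) v.
Proof.
intros Hv H. apply analytic_at_iff in H. destruct H as (a & r & H).
destruct (has_ps_continuous _ _ _ _ H 1%R Rlt_0_1) as (d & Hd & Hc).
destruct (wp_blowup (Cmod (wp hex_lattice v) + 1)) as (s & Hs & Hb).
set (t := (Rmin d s / 2)%R). assert (0 < Rmin d s)%R by (apply Rmin_glb_lt; lra).
pose proof (Rmin_l d s). pose proof (Rmin_r d s).
assert (Ht : Cmod (RtoC t) = t) by (rewrite Cmod_R; apply Rabs_pos_eq; unfold t; lra).
assert (Ht0 : RtoC t <> 0) by (apply RtoC_nz; unfold t; lra).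
specialize (Hc (RtoC t) ltac:(unfold t in *; lra)). specialize (Hb (RtoC t) Ht0 ltac:(unfold t in *; lra)).
rewrite (wp_near_pole v (RtoC t) Hv Ht0) in Hc by (rewrite Ht; unfold t; lra).
pose proof (Cmod_triangle (wp hex_lattice (RtoC t) - wp hex_lattice v) (wp hex_lattice v)) as T.
replace (wp hex_lattice (RtoC t) - wp hex_lattice v + wp hex_lattice v) with (wp hex_lattice (RtoC t)) in T by ring. lra.
Qed.

Lemma analytic_at_const_one z0 : analytic_at (fun _ => RtoC 1) z0.
Proof.
apply analytic_at_iff. exists (fun n => 0 * 0 + match n with 0%nat => 1 | _ => RtoC 0 end), 1%R.
split; [lra|]. intros h _.
replace (RtoC 1) with ((0 * 0 + 1) * h ^ 0) at 1 by (cbn; ring).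
apply (Cseries_single (fun n => (0 * 0 + match n with 0%nat => 1 | _ => RtoC 0 end) * h ^ n)). intros n. ring.
Qed.

Lemma wp_elliptic : elliptic (wp hex_lattice).
Proof.
split.
- intros z0. destruct (classic (hex_lattice z0)) as [Hz|Hz].
  + exists (fun z => 1 * 1 + 1 * ((1 * z + - z0) * ((1 * z + - z0) * wp_reg (1 * z + - z0)))), 2%nat, 1%R.
    split; [|split; [lra|]].
    * apply (analytic_at_lin (fun _ => 1) (fun z => (1 * z + - z0) * ((1 * z + - z0) * wp_reg (1 * z + - z0)))).
      -- apply analytic_at_const_one.
      -- apply analytic_at_mult; [apply analytic_at_affine|].
         apply analytic_at_mult; [apply analytic_at_affine|].
         apply analytic_at_iff. eexists; eexists. apply (has_ps_comp_affine wp_reg); [exact C1_nz|].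
         replace (1 * z0 + - z0) with (RtoC 0) by ring. exact wp_reg_has_ps.
    * intros z Hne Hr. assert (Hk : z - z0 <> 0) by now apply Cminus_eq_contra.
      replace z with (z0 + (z - z0)) at 1 by ring. rewrite wp_near_pole by auto.
      rewrite wp_eq. replace (1 * z + - z0) with (z - z0) by ring. field. exact Hk.
  + exists (wp hex_lattice), 0%nat, 1%R. destruct (hex_lattice_gap z0 Hz) as (d & Hd & H).
    split; [apply analytic_at_iff; eexists; exists d; now apply wp_has_ps|]. split; [lra|].
    intros z _ _. cbn [Cpow]. field.
- exists (hexpt 1 0), (hexpt 0 1).
  assert (Hper : forall v, hex_lattice v -> period (wp hex_lattice) v).
  { intros v Hv z Hz _. apply wp_periodic; auto. intros Hn. exact (wp_not_analytic_at_lattice z Hn Hz). }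
  split; [|split; apply Hper; apply hex_lattice_iff; eauto].
  pose proof sqrt3_pos. unfold hexpt, Cconj, Cmult, Im; cbn [fst snd]. nra.
Qed.

Definition psi_arg (z : C) : C := (z - RtoC rho) / RtoC (rho * sqrt 3).
Definition psi_formula (z : C) : C := / RtoC (rho * sqrt 3) ^ 2 * wp hex_lattice (psi_arg z).
Definition psi_half_derivative (z : C) : C := / (2 * RtoC (rho * sqrt 3) ^ 3) * wp1 (psi_arg z).

Lemma scale_nz : RtoC (rho * sqrt 3) <> 0.
Proof. rewrite rho_eq. apply RtoC_nz. pose proof kappa_pos. lra. Qed.

Lemma psi_arg_affine z : psi_arg z = / RtoC (rho * sqrt 3) * z + - RtoC rho / RtoC (rho * sqrt 3).
Proof. unfold psi_arg. field. exact scale_nz. Qed.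

Lemma scale_inv_nz : / RtoC (rho * sqrt 3) <> 0.
Proof.
intros E. apply C1_nz. rewrite <- (Cinv_r _ scale_nz), E. ring.
Qed.

Lemma psi_formula_Cder z : ~ hex_lattice (psi_arg z) -> Cder psi_formula z (2 * psi_half_derivative z).
Proof.
intros Hz. pose proof scale_nz as Hc. pose proof psi_arg_affine as Haff.
set (c := RtoC (rho * sqrt 3)) in *.
assert (H := Cder_comp_affine (wp hex_lattice) (/ c ^ 2) (/ c) (- RtoC rho / c) z (wp1 (psi_arg z)) scale_inv_nz).
rewrite <- Haff in H. specialize (H (wp_Cder _ Hz)).
replace (2 * psi_half_derivative z) with (/ c ^ 2 * (/ c * wp1 (psi_arg z)))
  by (unfold psi_half_derivative; fold c; field; exact Hc).
intros eps He. destruct (H eps He) as (d & Hd & Hb). exists d. split; auto.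
intros h Hh. unfold psi_formula. fold c.
specialize (Hb h Hh). rewrite <- !Haff in Hb. exact Hb.
Qed.

Lemma psi_half_derivative_Cder z : ~ hex_lattice (psi_arg z) -> Cder psi_half_derivative z (3 * psi_formula z ^ 2).
Proof.
intros Hz. pose proof scale_nz as Hc. pose proof psi_arg_affine as Haff.
set (c := RtoC (rho * sqrt 3)) in *.
assert (H := Cder_comp_affine wp1 (/ (2 * c ^ 3)) (/ c) (- RtoC rho / c) z (wp2 (psi_arg z)) scale_inv_nz).
rewrite <- Haff in H. specialize (H (wp1_Cder _ Hz)).
replace (3 * psi_formula z ^ 2) with (/ (2 * c ^ 3) * (/ c * wp2 (psi_arg z)))
  by (rewrite wp_second_derivative by auto; unfold psi_formula; fold c; field; exact Hc).
intros eps He. destruct (H eps He) as (d & Hd & Hb). exists d. split; auto.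
intros h Hh. unfold psi_half_derivative. fold c.
specialize (Hb h Hh). rewrite <- !Haff in Hb. exact Hb.
Qed.

Lemma psi_formula_has_ps z0 r : (0 < r)%R ->
  (forall h, (Cmod h < r)%R -> ~ hex_lattice (psi_arg (z0 + h))) -> exists a, has_ps psi_formula z0 a r.
Proof.
intros Hr H. pose proof scale_nz as Hc. assert (Hp := proj1 (Cmod_gt_0 _) Hc).
assert (Hgap : forall w, hex_lattice w -> (r / Cmod (RtoC (rho * sqrt 3)) <= Cmod (psi_arg z0 - w))%R).
{ intros w Hw. apply Rnot_lt_le. intros Hlt.
  apply (H (RtoC (rho * sqrt 3) * (w - psi_arg z0))).
  - rewrite Cmod_mult, Cmod_minus_sym. apply (Rmult_lt_compat_l (Cmod (RtoC (rho * sqrt 3)))) in Hlt; auto.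
    replace (Cmod (RtoC (rho * sqrt 3)) * (r / Cmod (RtoC (rho * sqrt 3))))%R with r in Hlt by (field; lra). exact Hlt.
  - replace (psi_arg (z0 + RtoC (rho * sqrt 3) * (w - psi_arg z0))) with w; auto.
    unfold psi_arg. field. exact Hc. }
assert (Hps := wp_has_ps (psi_arg z0) _ (Rdiv_lt_0_compat _ _ Hr Hp) Hgap).
rewrite psi_arg_affine in Hps.
apply (has_ps_comp_affine (wp hex_lattice)) in Hps; [|exact scale_inv_nz].
replace (r / Cmod (RtoC (rho * sqrt 3)) / Cmod (/ RtoC (rho * sqrt 3)))%R with r in Hps
  by (rewrite Cmod_inv by exact Hc; field; lra).
eexists. eapply has_ps_ext; [|exact (has_ps_lin _ _ _ _ _ _ (/ RtoC (rho * sqrt 3) ^ 2) 0 Hps Hps)].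
intros h _. cbv beta. unfold psi_formula. rewrite psi_arg_affine. ring.
Qed.

Lemma psi_domain_ball z : ~ hex_lattice (psi_arg z) ->
  exists r, (0 < r)%R /\ forall h, (Cmod h < r)%R -> ~ hex_lattice (psi_arg (z + h)).
Proof.
intros Hz. pose proof scale_nz as Hc. assert (Hp := proj1 (Cmod_gt_0 _) Hc).
destruct (hex_lattice_gap _ Hz) as (d & Hd & H).
exists (d * Cmod (RtoC (rho * sqrt 3)))%R. split; [now apply Rmult_lt_0_compat|].
intros h Hh. replace (psi_arg (z + h)) with (psi_arg z + h / RtoC (rho * sqrt 3)) by (unfold psi_arg; field; exact Hc).
apply (gap_ball _ d); auto. rewrite Cmod_div by exact Hc.
apply Rmult_lt_reg_r with (Cmod (RtoC (rho * sqrt 3))); auto.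
unfold Rdiv. rewrite Rmult_assoc, Rinv_l, Rmult_1_r by lra. exact Hh.
Qed.

Lemma psi_domain : Defs.domain (fun z => ~ hex_lattice (psi_arg z)).
Proof.
pose proof scale_nz as Hc. assert (Hp := proj1 (Cmod_gt_0 _) Hc). split.
- intros z Hz. apply locally_C_iff. destruct (psi_domain_ball z Hz) as (r & Hr & H).
  exists r. split; auto. intros w Hw. replace w with (z + (w - z)) by ring. now apply H.
- intros A B HA HB Hcov (a & Ha & HAa) (b & Hb & HBb).
  set (c := RtoC (rho * sqrt 3)) in *.
  set (back := fun w => c * w + RtoC rho).
  assert (E1 : forall z, back (psi_arg z) = z) by (intros z; unfold back, psi_arg; fold c; field; exact Hc).
  assert (E2 : forall w, psi_arg (back w) = w) by (intros w; unfold back, psi_arg; fold c; field; exact Hc).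
  assert (Hop : forall D : C -> Prop, open (T := C_UniformSpace) D -> open (T := C_UniformSpace) (fun w => D (back w))).
  { intros D HD w Hw. apply locally_C_iff. destruct (proj1 (locally_C_iff _ _) (HD _ Hw)) as (r & Hr & H).
    exists (r / Cmod c)%R. split; [now apply Rdiv_lt_0_compat|]. intros x Hx. apply H.
    replace (back x - back w) with (c * (x - w)) by (unfold back; ring). rewrite Cmod_mult.
    apply (Rmult_lt_compat_l (Cmod c)) in Hx; auto.
    replace (Cmod c * (r / Cmod c))%R with r in Hx by (field; lra). exact Hx. }
  destruct (hex_complement_connected (fun w => A (back w)) (fun w => B (back w))) as (w & Hw & H1 & H2).
  + now apply Hop.
  + now apply Hop.
  + intros w Hw. apply Hcov. now rewrite E2.
  + exists (psi_arg a). now rewrite E1.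
  + exists (psi_arg b). now rewrite E1.
  + exists (back w). rewrite E2. auto.
Qed.

Lemma psi_arg_0 : psi_arg 0 = - RtoC centre.
Proof.
pose proof sqrt3_pos. pose proof kappa_pos as Hk. rewrite <- rho_eq in Hk.
assert (Hr : (rho <> 0)%R) by (intros E; rewrite E, Rmult_0_l in Hk; lra).
unfold psi_arg, centre. rewrite RtoC_inv, RtoC_mult by lra. field.
split; apply RtoC_nz; lra.
Qed.

Lemma psi_domain_0 : ~ hex_lattice (psi_arg 0).
Proof. rewrite psi_arg_0. apply not_hex_opp, centre_not_hex. Qed.

Lemma psi_formula_0 : psi_formula 0 = 0.
Proof. unfold psi_formula. rewrite psi_arg_0, wp_even, wp_centre by exact centre_not_hex. ring. Qed.

Lemma wp1_odd z : ~ hex_lattice z -> wp1 (- z) = - wp1 z.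
Proof.
intros Hz. unfold wp1.
replace (inv_pow_sum hex_lattice (- z) 3) with (- inv_pow_sum hex_lattice z 3); [ring|].
assert (Hs : forall x, ~ hex_lattice x -> is_sum_over hex_lattice (fun w => / (x - w) ^ 3) (inv_pow_sum hex_lattice x 3)).
{ intros x Hx. destruct (hex_lattice_gap x Hx) as (d & Hd & H). now apply (inv_pow_is_sum _ x d 0). }
replace (- inv_pow_sum hex_lattice z 3) with ((-1) * inv_pow_sum hex_lattice z 3) by ring.
apply (is_sum_over_unique hex_lattice (fun w => / (- z - - w) ^ 3)).
- eapply is_sum_over_ext; [|apply is_sum_over_scal, Hs, Hz].
  intros w _. cbv beta. replace ((- z - - w) ^ 3) with ((-1) * (z - w) ^ 3) by ring.
  rewrite Cinv_mult_l by (apply RtoC_nz; lra). f_equal. field.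
- apply (is_sum_over_reindex hex_lattice hex_lattice Copp Copp (fun w => / (- z - w) ^ 3));
    [| |now apply Hs, not_hex_opp]; intros w Hw; (split; [now apply hex_lattice_opp|ring]).
Qed.

(** Here the value of [rho] enters: [rho * sqrt 3 = kappa] and
    [wp1 centre = - 2 kappa ^ 3]. *)
Lemma psi_half_derivative_0 : psi_half_derivative 0 = 1.
Proof.
unfold psi_half_derivative. rewrite psi_arg_0, wp1_odd by exact centre_not_hex.
pose proof centre_bounds as Hc. pose proof sqrt3_pos. pose proof kappa_pos as Hk.
rewrite wp1_real by lra. rewrite rho_eq.
assert (E : wpR1 centre = (- (2 * kappa ^ 3))%R).
{ pose proof (wpR1_neg centre ltac:(lra)) as Hn. pose proof kappa_pow6 as E. unfold wp_k in E.
  assert (0 < kappa ^ 3)%R by now apply pow_lt.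
  replace (4 * kappa ^ 6)%R with ((2 * kappa ^ 3) * (2 * kappa ^ 3))%R in E by ring. nra. }
rewrite E, RtoC_opp, RtoC_mult, RtoC_pow. field. apply RtoC_nz. lra.
Qed.

Lemma psi_formula_germ : exists r, (0 < r)%R /\ (r <= 1 / 4)%R /\ forall u, (Cmod u < r)%R ->
  psi_formula (Iu u) = u ^ 2 / delta u ^ 2 /\ psi_half_derivative (Iu u) = / delta u ^ 3.
Proof.
destruct (psi_domain_ball 0 psi_domain_0) as (d & Hd & H).
assert (H' : forall z, (Cmod z < d)%R -> ~ hex_lattice (psi_arg z)).
{ intros z Hz. replace z with (0 + z) by ring. now apply H. }
exists (Rmin (1 / 4) (d / 64)). split; [apply Rmin_glb_lt; lra|]. split; [apply Rmin_l|]. intros u Hu.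
destruct (Rlt_Rmin _ _ _ Hu) as [H1 H2].
apply (germ_along_Iu _ _ d); auto.
- intros z Hz. apply psi_formula_Cder. auto.
- intros z Hz. apply psi_half_derivative_Cder. auto.
- exact psi_formula_0.
- exact psi_half_derivative_0.
- pose proof (Cmod_ge_0 u). nra.
Qed.

Lemma psi_formula_is_psi : is_psi (fun z => ~ hex_lattice (psi_arg z)) psi_formula.
Proof.
split; [exact psi_domain|]. split; [exact psi_domain_0|]. split.
- intros z Hz. destruct (psi_domain_ball z Hz) as (r & Hr & H).
  destruct (psi_formula_has_ps z r Hr H) as (a & Ha). apply analytic_at_iff. eauto.
- apply locally_C_iff. destruct psi_formula_germ as (r & Hr & _ & H). exists r. split; auto.
  intros u Hu. apply H. replace u with (u - 0) by ring. exact Hu.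
Qed.

(** Near a pole of the formula a continuation is bounded and the formula is not. *)
Lemma psi_pole_mismatch (psi : C -> C) z :
  hex_lattice (psi_arg z) -> analytic_at psi z ->
  exists r, (0 < r)%R /\ forall w, w <> z -> (Cmod (w - z) < r)%R -> psi w <> psi_formula w.
Proof.
intros Hz Ha. pose proof scale_nz as Hc. assert (Hp := proj1 (Cmod_gt_0 _) Hc).
apply analytic_at_iff in Ha. destruct Ha as (a & r & Ha).
destruct (has_ps_continuous _ _ _ _ Ha 1%R Rlt_0_1) as (d & Hd & Hcont).
set (c := RtoC (rho * sqrt 3)) in *.
destruct (wp_blowup (Cmod (c ^ 2) * (Cmod (psi z) + 1))) as (s & Hs & Hb).
exists (Rmin d (s * Cmod c)). split; [apply Rmin_glb_lt; [lra|nra]|].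
intros w Hne Hw E.
destruct (Rlt_Rmin _ _ _ Hw) as [H1 H2].
set (k := (w - z) / c).
assert (Hk0 : k <> 0).
{ intros Ek. apply Hne. apply Ceq_minus. replace (w - z) with (c * k) by (unfold k; field; exact Hc). rewrite Ek. ring. }
assert (Hk : (Cmod k < s)%R).
{ unfold k. rewrite Cmod_div by exact Hc. apply Rmult_lt_reg_r with (Cmod c); auto.
  unfold Rdiv. rewrite Rmult_assoc, Rinv_l, Rmult_1_r by lra. exact H2. }
specialize (Hcont (w - z) H1). replace (z + (w - z)) with w in Hcont by ring. specialize (Hb k Hk0 Hk).
assert (Ew : psi_formula w = / c ^ 2 * wp hex_lattice k).
{ unfold psi_formula. fold c. f_equal. 
  replace (psi_arg w) with (psi_arg z + k) by (unfold psi_arg, k; fold c; field; exact Hc).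
  apply wp_near_pole; auto. lra. }
assert (Hwp : wp hex_lattice k = c ^ 2 * psi w) by (rewrite E, Ew; field; exact Hc).
rewrite Hwp, Cmod_mult in Hb.
assert (Hc2 : (0 < Cmod (c ^ 2))%R) by (apply Cmod_gt_0; now apply Cpow_nz).
apply Rmult_lt_reg_l in Hb; auto.
pose proof (Cmod_triangle (psi w - psi z) (psi z)) as T.
replace (psi w - psi z + psi z) with (psi w) in T by ring. lra.
Qed.

(** The identity theorem along a connected domain: points near which the two
    functions agree, and points near which they differ, form disjoint open sets. *)
Lemma psi_unique (U : C -> Prop) (psi : C -> C) : is_psi U psi ->
  forall z, U z -> ~ hex_lattice (psi_arg z) /\ psi z = psi_formula z.
Proof.
intros ([Hopen Hconn] & HU0 & Han & Hloc).
set (G := fun z => ~ hex_lattice (psi_arg z) /\ psi z = psi_formula z).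
set (A := fun z => exists r, (0 < r)%R /\ forall w, (Cmod (w - z) < r)%R -> G w).
set (B := fun z => exists r, (0 < r)%R /\ forall w, w <> z -> (Cmod (w - z) < r)%R -> ~ G w).
assert (HAo : open (T := C_UniformSpace) A).
{ intros z (r & Hr & H). apply locally_C_iff. exists r. split; auto. intros x Hx.
  exists (r - Cmod (x - z))%R. split; [lra|]. intros w Hw. apply H.
  pose proof (Cmod_triangle3 w x z). lra. }
assert (HBo : open (T := C_UniformSpace) B).
{ intros z (r & Hr & H). apply locally_C_iff. exists r. split; auto. intros x Hx.
  destruct (Ceq_dec x z) as [->|Hne]; [exists r; auto|].
  assert (Hxz : (0 < Cmod (x - z))%R) by now apply Cmod_gt_0, Cminus_eq_contra.
  exists (Rmin (r - Cmod (x - z)) (Cmod (x - z))). split; [apply Rmin_glb_lt; lra|].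
  intros w _ Hw.
  destruct (Rlt_Rmin _ _ _ Hw) as [H1 H2].
  apply H.
  - intros ->. rewrite Cmod_minus_sym in H2. lra.
  - pose proof (Cmod_triangle3 w x z). lra. }
assert (Hdisj : forall z, A z -> B z -> False).
{ intros z (r & Hr & H) (s & Hs & H').
  set (t := (Rmin r s / 2)%R). assert (0 < Rmin r s)%R by now apply Rmin_glb_lt.
  pose proof (Rmin_l r s). pose proof (Rmin_r r s).
  assert (Ht : Cmod (z + RtoC t - z) = t).
  { replace (z + RtoC t - z) with (RtoC t) by ring. rewrite Cmod_R. apply Rabs_pos_eq. unfold t; lra. }
  apply (H' (z + RtoC t)).
  - intros E. rewrite E in Ht. replace (z - z) with (RtoC 0) in Ht by ring. rewrite Cmod_0 in Ht. unfold t in Ht; lra.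
  - rewrite Ht. unfold t; lra.
  - apply H. rewrite Ht. unfold t; lra. }
assert (Hcov : forall z, U z -> A z \/ B z).
{ intros z Hz. destruct (classic (hex_lattice (psi_arg z))) as [Hl|Hl].
  - right. destruct (psi_pole_mismatch psi z Hl (Han z Hz)) as (r & Hr & H).
    exists r. split; auto. intros w Hne Hw [_ E]. exact (H w Hne Hw E).
  - destruct (psi_domain_ball z Hl) as (r & Hr & Hball).
    destruct (psi_formula_has_ps z r Hr Hball) as (b & Hb).
    assert (Hdiff : analytic_at (fun x => 1 * psi x + (-1) * psi_formula x) z).
    { apply analytic_at_lin; [now apply Han|]. apply analytic_at_iff. eauto. }
    apply analytic_at_iff in Hdiff. destruct Hdiff as (e & s & He).
    destruct (has_ps_isolated_zeros _ _ _ _ He) as [(d & Hd & H)|(d & Hd & H)].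
    + left. exists (Rmin d r). split; [now apply Rmin_glb_lt|]. intros w Hw.
      destruct (Rlt_Rmin _ _ _ Hw) as [H1 H2].
      specialize (H _ H1). specialize (Hball _ H2). replace (z + (w - z)) with w in H, Hball by ring.
      split; auto. apply Ceq_minus. rewrite <- H. ring.
    + right. exists d. split; auto. intros w Hne Hw [_ E].
      apply (H (w - z)); [now apply Cminus_eq_contra|exact Hw|].
      replace (z + (w - z)) with w by ring. rewrite E. ring. }
(* At the points [Iu t], for small real [t], both functions are [t^2 / delta t^2], and
   these points accumulate at [0]. *)
assert (HA0 : A 0).
{ destruct (Hcov _ HU0) as [H|(r & Hr & H)]; [exact H|exfalso].
  apply locally_C_iff in Hloc. destruct Hloc as (s & Hs & Hpsi).
  destruct psi_formula_germ as (g & Hg & Hg4 & Hgerm).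
  destruct (psi_domain_ball 0 psi_domain_0) as (q & Hq & Hball).
  set (m := Rmin (Rmin s g) (Rmin r q)).
  assert (Hm : (0 < m)%R) by (repeat apply Rmin_glb_lt; lra).
  pose proof (Rmin_l (Rmin s g) (Rmin r q)). pose proof (Rmin_r (Rmin s g) (Rmin r q)).
  pose proof (Rmin_l s g). pose proof (Rmin_r s g). pose proof (Rmin_l r q). pose proof (Rmin_r r q).
  fold m in H0, H1.
  set (t := (m / 64)%R).
  assert (Ht : Cmod (RtoC t) = t) by (rewrite Cmod_R; apply Rabs_pos_eq; unfold t; lra).
  assert (Ht0 : RtoC t <> 0) by (apply RtoC_nz; unfold t; lra).
  assert (HI : (Cmod (Iu (RtoC t)) < m)%R).
  { eapply Rle_lt_trans; [apply Iu_bound; rewrite Ht; unfold t; lra|]. rewrite Ht. unfold t. nra. }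
  destruct (Hgerm (RtoC t)) as [E _]; [rewrite Ht; unfold t; lra|].
  assert (Ep := Hpsi (RtoC t) ltac:(replace (RtoC t - 0) with (RtoC t) by ring; rewrite Ht; unfold t; lra)).
  cbv beta in Ep.
  assert (Hd : delta (RtoC t) <> 0) by (apply delta_nz; rewrite Ht; unfold t; lra).
  apply (H (Iu (RtoC t))).
  - intros E0. rewrite E0, psi_formula_0 in E.
    assert (E2 : RtoC t ^ 2 = 0).
    { replace (RtoC t ^ 2) with (RtoC t ^ 2 / delta (RtoC t) ^ 2 * delta (RtoC t) ^ 2) by (field; exact Hd).
      rewrite <- E. ring. }
    exact (Cpow_nz _ 2 Ht0 E2).
  - replace (Iu (RtoC t) - 0) with (Iu (RtoC t)) by ring. lra.
  - split; [|congruence]. replace (Iu (RtoC t)) with (0 + Iu (RtoC t)) by ring. apply Hball. lra. }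
intros z Hz. destruct (Hcov z Hz) as [(r & Hr & H)|HB].
- apply H. replace (z - z) with (RtoC 0) by ring. now rewrite Cmod_0.
- exfalso. destruct (Hconn A B HAo HBo Hcov) as (x & _ & H1 & H2); eauto.
Qed.

Lemma delta_upper (u : C) : (Cmod u <= 1 / 2)%R -> (Cmod (delta u) <= 2)%R.
Proof.
intros H. pose proof (Re_one_minus_pow6 u H) as HR.
apply Rnot_lt_le. intros Hlt.
assert (E : (Cmod (delta u) ^ 6 = Cmod (1 - u ^ 6)%C)%R) by (rewrite <- Cmod_pow, delta_pow6 by lra; reflexivity).
assert (H6 : (2 ^ 6 <= Cmod (delta u) ^ 6)%R) by (apply pow_incr; lra).
assert (Hc : (Cmod (1 - u ^ 6)%C <= 2)%R).
{ eapply Rle_trans; [apply Cmod_triangle|]. rewrite Cmod_opp, Cmod_1, Cmod_pow.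
  assert (Cmod u ^ 6 <= 1 ^ 6)%R by (apply pow_incr; pose proof (Cmod_ge_0 u); lra). rewrite pow1 in *. lra. }
lra.
Qed.

Lemma generating_function (U : C -> Prop) (psi : C -> C) :
  U 0 -> open (T := C_UniformSpace) U -> (forall z, U z -> psi z = psi_formula z) ->
  exists r, (0 < r)%R /\ forall z u, (Cmod z < r)%R -> (Cmod u < r)%R ->
    is_H z u (delta u ^ 2 * psi (z * delta u + Iu u)) /\
    is_H z u (delta u ^ 2 * psi_formula (z * delta u + Iu u)).
Proof.
intros HU0 Hopen Heq.
destruct (proj1 (locally_C_iff _ _) (Hopen _ HU0)) as (d1 & Hd1 & HU).
destruct (psi_domain_ball 0 psi_domain_0) as (d2 & Hd2 & Hball).
destruct psi_formula_germ as (g & Hg & Hg4 & Hgerm).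
set (d := Rmin d1 d2). assert (Hd : (0 < d)%R) by now apply Rmin_glb_lt.
pose proof (Rmin_l d1 d2). pose proof (Rmin_r d1 d2). fold d in H, H0.
assert (Hdom : forall z, (Cmod z < d)%R -> ~ hex_lattice (psi_arg z)).
{ intros z Hz. replace z with (0 + z) by ring. apply Hball. lra. }
(* [|Iu u| <= 64 |u|^2] and [|delta u| <= 2] keep [z * delta u + Iu u] in the ball. *)
exists (Rmin g (d / 64)). split; [apply Rmin_glb_lt; lra|]. intros z u Hz Hu.
pose proof (Rmin_l g (d / 64)). pose proof (Rmin_r g (d / 64)).
pose proof (Cmod_ge_0 z). pose proof (Cmod_ge_0 u).
assert (HI : (Cmod (Iu u) < d / 2)%R) by (eapply Rle_lt_trans; [apply Iu_bound; lra|nra]).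
pose proof (delta_upper u ltac:(lra)) as Hup.
assert (Hzd : (Cmod (z * delta u) < d / 2)%R) by (rewrite Cmod_mult; nra).
destruct (Hgerm u ltac:(lra)) as [E1 E2].
assert (Hnear : forall h, (Cmod h < d / 2)%R -> ~ hex_lattice (psi_arg (Iu u + h))).
{ intros h Hh. apply Hdom. eapply Rle_lt_trans; [apply Cmod_triangle|lra]. }
destruct (psi_formula_has_ps (Iu u) (d / 2) ltac:(lra) Hnear) as (a & Ha).
assert (HH : is_H z u (delta u ^ 2 * psi_formula (z * delta u + Iu u))).
{ apply (urn_series psi_formula psi_half_derivative (Iu u) u (delta u) a (d / 2)); auto.
  - intros h Hh. now apply psi_formula_Cder, Hnear.
  - intros h Hh. now apply psi_half_derivative_Cder, Hnear.
  - apply delta_nz. lra. }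
split; [|exact HH]. rewrite Heq; [exact HH|]. apply HU.
replace (z * delta u + Iu u - 0) with (z * delta u + Iu u) by ring.
eapply Rle_lt_trans; [apply Cmod_triangle|lra].
Qed.

Theorem theorem3 :
  let c : C := RtoC (rho * sqrt 3) in
  let arg (z : C) : C := (z - RtoC rho) / c in
  let formula (z : C) : C := / c ^ 2 * wp hex_lattice (arg z) in
  is_psi (fun z => ~ hex_lattice (arg z)) formula /\
  (forall (U : C -> Prop) (psi : C -> C), is_psi U psi ->
    (forall z, U z -> ~ hex_lattice (arg z) /\ psi z = formula z) /\
    (exists r : R, (0 < r)%R /\
      forall z u : C, (Cmod z < r)%R -> (Cmod u < r)%R ->
        is_H z u (delta u ^ 2 * psi (z * delta u + Iu u)) /\
        is_H z u (delta u ^ 2 *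
          (/ c ^ 2 * wp hex_lattice ((z * delta u + Iu u - RtoC rho) / c))))) /\
  elliptic (wp hex_lattice).
Proof.
cbv zeta. split; [exact psi_formula_is_psi|]. split; [|exact wp_elliptic].
intros U psi Hpsi. pose proof (psi_unique U psi Hpsi) as Huniq. split; [exact Huniq|].
destruct Hpsi as ([Hopen _] & HU0 & _).
exact (generating_function U psi HU0 Hopen (fun z Hz => proj2 (Huniq z Hz))).
Qed.
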